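(* Fix $\epsilon>0$ and $p>0$. Assume that $\delta=o(\sqrt{d/N})$. There exists a (randomized) algorithm that, given $\mathbf{x}_1,\dots,\mathbf{x}_n\in\mathbb{R}^d$ and the estimate $\hat\delta$ as in the context, finds with probability at least $1-p$ a unit vector $\mathbf{w}\in\mathbb{R}^d$ such that $(\mathbf{w}^{\top}\mathbf{u})^2\ge 1-\epsilon$, in total time $\tilde{O}\left(\frac{N^{3/4}d^{1/4}}{\sqrt{\delta}}\right)$.
   Context: Setting: $\mathbf{x}_1,\dots,\mathbf{x}_n\in\mathbb{R}^d$ with $n>d$ and $\|\mathbf{x}_i\|\le 1$ for all $i$; $\mathbf{X}=\frac1n\sum_{i=1}^n\mathbf{x}_i\mathbf{x}_i^{\top}$ has eigenvalues $\lambda_1\ge\lambda_2\ge\dots\ge\lambda_d$ with eigengap $\delta=\lambda_1-\lambda_2>0$, and $\mathbf{u}=\mathbf{u}_1$ is its (unit) leading eigenvector. $N$ is the total number of non-zero entries in $\mathbf{x}_1,\dots,\mathbf{x}_n$. An estimate $\hat\delta$ is given with $c_1\delta\le\hat\delta\le c_2\delta$ for universal constants $c_1,c_2$ satisfying $c_2-c_1=\Theta(1)$. $\tilde O(\cdot)$ hides poly-logarithmic dependencies on $d,\epsilon^{-1},p^{-1},\delta^{-1}$. Time is measured in elementary (arithmetic) operations. *)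

(* Defs.v *)
From mathcomp Require Import all_boot all_order all_algebra.
From mathcomp Require Import all_classical all_reals all_analysis.
Set Implicit Arguments.
Unset Strict Implicit.
Unset Printing Implicit Defensive.
Import Order.TTheory GRing.Theory Num.Theory.
Import numFieldNormedType.Exports.
Local Open Scope ring_scope.

(** * Randomized real RAM

    Programs work on variables and arrays holding natural numbers (indices,
    counters) and variables and arrays holding exact real numbers.  Variables
    and arrays are named by natural numbers; a program, being finite syntax,
    mentions finitely many of them.  Every executed command costs one time
    unit and performs at most one arithmetic operation, comparison, memory
    access or random draw.  There is no conversion from reals to naturals. *)

Variant nat_op := NAdd | NSub | NMul.
Variant real_op := RAdd | RSub | RMul | RDiv.

Variant instr :=
| IConst of nat & nat                  (* x := c *)
| INat of nat_op & nat & nat & nat     (* x := y op z *)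
| ILoad of nat & nat & nat             (* x := a[y] *)
| IStore of nat & nat & nat            (* a[x] := y *)
| IRand of nat & nat                   (* x := uniform in {0, ..., y} *)
| IOfNat of nat & nat                  (* r := y, a natural seen as a real *)
| IReal of real_op & nat & nat & nat   (* r := s op t *)
| ISqrt of nat & nat                   (* r := sqrt s *)
| IRLoad of nat & nat & nat            (* r := a[y] *)
| IRStore of nat & nat & nat.          (* a[x] := r *)

Variant test :=
| TNatLe of nat & nat | TNatLt of nat & nat
| TRealLe of nat & nat | TRealLt of nat & nat.

Inductive prog :=
| Skip
| Do of instr
| Seq of prog & prog
| If of test & prog & prog
| While of test & prog.

Section Semantics.
Variable R : realType.

Record state := State {
  nvar : nat -> nat;
  rvar : nat -> R;
  narr : nat -> nat -> nat;
  rarr : nat -> nat -> R }.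

Definition upd T (f : nat -> T) x v := fun y => if y == x then v else f y.

Definition set_nvar x v s :=
  State (upd (nvar s) x v) (rvar s) (narr s) (rarr s).
Definition set_rvar r v s :=
  State (nvar s) (upd (rvar s) r v) (narr s) (rarr s).
Definition set_narr a i v s :=
  State (nvar s) (rvar s) (upd (narr s) a (upd (narr s a) i v)) (rarr s).
Definition set_rarr a i v s :=
  State (nvar s) (rvar s) (narr s) (upd (rarr s) a (upd (rarr s a) i v)).

Definition eval_nat_op o : nat -> nat -> nat :=
  match o with NAdd => addn | NSub => subn | NMul => muln end.

Definition eval_real_op o (x y : R) : R :=
  match o with
  | RAdd => x + y | RSub => x - y | RMul => x * y | RDiv => x / y
  end.

Definition eval_test t s : bool :=
  match t with
  | TNatLe x y => (nvar s x <= nvar s y)%N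
  | TNatLt x y => (nvar s x < nvar s y)%N
  | TRealLe r q => rvar s r <= rvar s q
  | TRealLt r q => rvar s r < rvar s q
  end.

(** The equally likely successor states: a singleton except for [IRand]. *)
Definition exec i s : seq state :=
  match i with
  | IConst x c => [:: set_nvar x c s]
  | INat o x y z => [:: set_nvar x (eval_nat_op o (nvar s y) (nvar s z)) s]
  | ILoad x a y => [:: set_nvar x (narr s a (nvar s y)) s]
  | IStore a x y => [:: set_narr a (nvar s x) (nvar s y) s]
  | IRand x y => [seq set_nvar x v s | v <- iota 0 (nvar s y).+1]
  | IOfNat r y => [:: set_rvar r (nvar s y)%:R s]
  | IReal o r q t => [:: set_rvar r (eval_real_op o (rvar s q) (rvar s t)) s]
  | ISqrt r q => [:: set_rvar r (Num.sqrt (rvar s q)) s]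
  | IRLoad r a y => [:: set_rvar r (rarr s a (nvar s y)) s]
  | IRStore a x r => [:: set_rarr a (nvar s x) (rvar s r) s]
  end.

(** One time unit of executing [P] followed by the commands in [K]; a
    configuration has halted when no command is left. *)
Definition step P (K : seq prog) s : seq (seq prog * state) :=
  match P with
  | Skip => [:: (K, s)]
  | Do i => [seq (K, s') | s' <- exec i s]
  | Seq P1 P2 => [:: (P1 :: P2 :: K, s)]
  | If t P1 P2 => [:: ((if eval_test t s then P1 else P2) :: K, s)]
  | While t P1 => [:: (if eval_test t s then P1 :: P :: K else K, s)]
  end.

(** Halting after at most [t] steps, whatever the random draws. *)
Fixpoint halts_in (t : nat) (K : seq prog) (s : state) : bool :=
  match K, t with
  | [::], _ => true
  | _ :: _, 0 => false
  | P :: K', t'.+1 => all (fun c => halts_in t' c.1 c.2) (step P K' s)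
  end.

(** Probability of having halted after at most [t] steps in a state that
    satisfies [E]. *)
Fixpoint prob_in (t : nat) (E : state -> bool) (K : seq prog) (s : state) : R :=
  match K, t with
  | [::], _ => (E s)%:R
  | _ :: _, 0 => 0
  | P :: K', t'.+1 =>
      (size (step P K' s))%:R^-1 *
        \sum_(c <- step P K' s) prob_in t' E c.1 c.2
  end.

End Semantics.

(** * Leading eigenvector computation *)

Section PCA.
Variable R : realType.

Definition dotv d (v w : 'cV[R]_d) : R := (v^T *m w) 0 0.
(* Euclidean; the library norm on matrices is the maximum norm. *)
Definition norm2 d (v : 'cV[R]_d) : R := Num.sqrt (dotv v v).

Record instance := Instance {
  npts : nat;
  pdim : nat;
  pts : 'I_npts -> 'cV[R]_pdim;
  eigs : seq R;
  lead : 'cV[R]_pdim;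
  gap_est : R }.

Definition covmx (I : instance) : 'M[R]_(pdim I) :=
  (npts I)%:R^-1 *: \sum_(i < npts I) pts i *m (pts i)^T.

Definition gap (I : instance) : R := (eigs I)`_0 - (eigs I)`_1.

Definition nonzero (I : instance) : {set 'I_(npts I) * 'I_(pdim I)} :=
  [set ij | pts ij.1 ij.2 0 != 0]%SET.

Definition nnz (I : instance) : nat := #|nonzero I|.

(** [eigs] lists all eigenvalues, with multiplicity, in nonincreasing order;
    the gap between the first two presupposes [pdim] at least 2. *)
Definition wf_instance (c1 c2 : R) (I : instance) : Prop :=
  [/\ (1 < pdim I < npts I)%N,
      forall i, norm2 (pts (i := I) i) <= 1,
      char_poly (covmx I) = \prod_(l <- eigs I) ('X - l%:P) /\
        sorted >=%R (eigs I),
      covmx I *m lead I = (eigs I)`_0 *: lead I /\ norm2 (lead I) = 1 &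
      0 < gap I /\ c1 * gap I <= gap_est I <= c2 * gap I].

(** Sparse input: the nonzero entries row by row ([enum] on pairs of indices
    is lexicographic) as three parallel arrays of length [nnz I].  Everything
    not listed is initially zero. *)
Definition input (I : instance) (eps p : R) : state R :=
  let nz := enum (nonzero I) in
  State
    (nth 0%N [:: npts I; pdim I; nnz I])
    (nth 0 [:: eps; p; gap_est I])
    (fun a => nth 0%N (nth [::] [:: [seq val ij.1 | ij <- nz];
                                    [seq val ij.2 | ij <- nz]] a))
    (fun a => nth 0 (nth [::] [:: [seq pts ij.1 ij.2 0 | ij <- nz]] a)).

(** The result is read in the real array 1. *)
Definition output (d : nat) (s : state R) : 'cV[R]_d := \col_j rarr s 1 j.

Definition good (I : instance) (eps : R) (s : state R) : bool :=
  let w := output (pdim I) s in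
  (norm2 w == 1) && (1 - eps <= dotv w (lead I) ^+ 2).

Definition solves_in_time (P : prog) (I : instance) (eps p T : R) : Prop :=
  exists t : nat,
    [/\ t%:R <= T,
        halts_in t [:: P] (input I eps p) &
        1 - p <= prob_in t (good I eps) [:: P] (input I eps p)].

(** At least 1 for positive arguments; its powers represent, up to constant
    factors, the poly-logarithmic factors in all four quantities. *)
Definition logfactor (I : instance) (eps p : R) : R :=
  ln (3 + (pdim I)%:R + eps^-1 + p^-1 + (gap I)^-1).

Definition time_bound (I : instance) : R :=
  (nnz I)%:R `^ (3 / 4) * (pdim I)%:R `^ (1 / 4) / Num.sqrt (gap I).

End PCA.

(* Main.v *)
Require Import Defs.
From mathcomp Require Import all_boot all_order all_algebra.
From mathcomp Require Import all_classical all_reals all_analysis.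
From mathcomp Require Import ring lra zify.
Set Implicit Arguments.
Unset Strict Implicit.
Unset Printing Implicit Defensive.
Import Order.TTheory GRing.Theory Num.Theory.
Import numFieldNormedType.Exports.
Local Open Scope ring_scope.

(** One time unit pays for one operation on an exact real, however many
    digits it has. A vector of bounded integers therefore fits in a single
    real, its coordinates being the digits in a large base [B], and one
    multiplication and one addition handle all the coordinates at once. Let
    [M] be the Gram matrix of the points after multiplication by a large [Q]
    and rounding to integers. Only the [m] columns that carry a nonzero
    entry matter, as the leading eigenvector vanishes elsewhere
    ([lead_supp]). A few passes over the [N] nonzero entries compute the [m]
    columns of [M] in packed form ([wp_rows], [wp_gram]). From then on a
    product [M t] costs [m] multiplications ([packE], [wp_pack]) and [m]
    extractions of a digit ([digits_floor], [wp_unpack]), each of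
    polylogarithmic cost ([wp_floor]).

    The eigenvector is found with the Chebyshev recurrence [t = 2 (X / mu) c
    - p], where [X] is the covariance matrix, [mu] a trial value for its
    leading eigenvalue and [c], [p] the last two iterates. Along the leading
    eigenvector [u] the iterates grow at least by the factor [1 + sqrt (gap
    / 2)] per step if [mu <= l1 - gap / 4] ([grow_inv_step]). On the
    complement of [u] they grow only linearly if [mu >= l2], because an
    energy is conserved up to rounding errors ([energy_step],
    [perp_inv_step]). So about [1 / sqrt gap] steps, up to a logarithm,
    decide: if the norm never passes a fixed threshold, then [mu > l1 - gap
    / 4] ([round_survive]); if it does and [mu >= l2], the normalized
    iterate is close to [u] ([round_exceed]). Bisection on [mu] leaves an
    interval whose lower end exceeds [l2], and the iterate obtained there is
    the answer ([wp_search]).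

    Randomness serves only to make the start correlated with [u]: a uniform
    integer vector [g] with large entries satisfies [|<g, u>| < 1] with
    small probability, since conditionally on the other coordinates a
    coordinate where [u] is not small must fall in a short interval
    ([count_draws]).

    The total time is [N + m / sqrt gap] up to logarithmic factors. The
    second term is within the bound since [m <= min(d, N)], which is at most
    [N^(3/4) d^(1/4)]. The first one is because [gap <= sqrt (d / N)]
    ([nnz_time_bound]). The number [n] of points and [N] enter the
    logarithms, where they are harmless since both are polynomial in [d] and
    [1 / gap] ([npts_gap], [log_goal_le]). *)

(** * Diagonalization of real symmetric matrices *)

Section Spectral.
Variable R : realType.

Lemma simmx_char_poly d (H A : 'M[R]_d) : H *m H^T = 1%:M ->
  char_poly (H *m A *m H^T) = char_poly A.
Proof.
move=> HH; have HH' := mulmx1C HH.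
rewrite /char_poly.
have -> : char_poly_mx (H *m A *m H^T) =
    map_mx polyC H *m char_poly_mx A *m map_mx polyC H^T.
  rewrite /char_poly_mx mulmxBr mulmxBl !map_mxM scalar_mxC; congr (_ - _).
  by rewrite -mulmxA -map_mxM HH map_mx1 mulmx1.
by rewrite !det_mulmx mulrAC -det_mulmx -map_mxM HH map_mx1 det1 mul1r.
Qed.

(** For [v] distinct from the first axis [e], the reflection in the
    hyperplane orthogonal to [w = e - v] exchanges [e] and [v]. As [|w|^2 =
    2 (1 - a)] with [a] the inner product of [e] and [v], it is [1 - w^T w /
    (1 - a)]. *)
Lemma householder d (v : 'rV[R]_d.+1) : v *m v^T = 1%:M ->
  exists H : 'M[R]_d.+1, H *m H^T = 1%:M /\ (delta_mx 0 0 : 'rV_d.+1) *m H = v.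
Proof.
move=> vv; set e : 'rV_d.+1 := delta_mx 0 0.
have ee : e *m e^T = 1%:M.
  by rewrite trmx_delta mul_delta_mx; apply/matrixP => i j; rewrite !ord1 !mxE.
case: (eqVneq v e) => [->|nve].
  by exists 1%:M; rewrite trmx1 !mulmx1.
have [w wE] : {w | w = e - v} by exists (e - v).
pose a := (e *m v^T) 0 0.
have eva : e *m v^T = a%:M by rewrite [LHS]mx11_scalar.
have vea : v *m e^T = a%:M by rewrite -[v]trmxK -trmx_mul eva tr_scalar_mx.
have ww : w *m w^T = (2 * (1 - a))%:M.
  rewrite wE linearB /= mulmxBl !mulmxBr ee vv eva vea.
  by rewrite -!raddfB /=; congr (_%:M); ring.
have wn0 : w != 0 by rewrite wE subr_eq0 eq_sym.
have a1 : 1 - a != 0.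
  apply: contra wn0 => /eqP a0; move: ww; rewrite a0 mulr0 => /matrixP /(_ 0 0).
  rewrite !mxE eqxx mulr1n => /eqP.
  rewrite psumr_eq0 => [/allP ww|i _]; last by rewrite mxE -expr2 sqr_ge0.
  apply/eqP/rowP => i; have := ww i (mem_index_enum i).
  by rewrite !mxE -expr2 expf_eq0 /= => /eqP.
have eW : e *m w^T = (1 - a)%:M.
  by rewrite wE linearB /= mulmxBr ee eva -raddfB.
pose H := 1%:M - (1 - a)^-1 *: (w^T *m w).
have HT : H^T = H by rewrite /H linearB /= trmx1 linearZ /= trmx_mul trmxK.
exists H; split.
  rewrite HT /H mulmxBl !mulmxBr !mul1mx mulmx1 -scalemxAl -scalemxAr.
  rewrite mulmxA -[w^T *m w *m w^T]mulmxA ww -mulmxA mul_scalar_mx -scalemxAr !scalerA.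
  have -> : (1 - a)^-1 * ((1 - a)^-1 * (2 * (1 - a))) = (1 - a)^-1 + (1 - a)^-1.
    by field.
  by rewrite scalerDl opprB addrK subrK.
rewrite /H mulmxBr mulmx1 -scalemxAr mulmxA eW mul_scalar_mx scalerA mulVf // scale1r.
by rewrite wE subKr.
Qed.

(** Induction on the dimension. A reflection moves a unit eigenvector for
    the head of [s] to the first axis; symmetry then makes the matrix block
    diagonal, and the lower block has the tail of [s] as its spectrum.
    Following the list in this way is what puts the eigenvalues on the
    diagonal in the order of [s]. *)
Lemma sym_diag d (A : 'M[R]_d) (s : seq R) :
  A^T = A -> char_poly A = \prod_(l <- s) ('X - l%:P) ->
  exists Q : 'M[R]_d, Q *m Q^T = 1%:M /\ Q *m A *m Q^T = diag_mx (\row_i s`_i).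
Proof.
elim: d A s => [|d IH] A s AT cpA.
  by exists 1%:M; split; apply/matrixP => -[].
have szs : size s = d.+1.
  by have := size_char_poly A; rewrite cpA size_prod_XsubC => -[].
case: s szs cpA => [//|l s] _ cpA.
have : eigenvalue A l.
  by rewrite eigenvalue_root_char cpA big_cons rootM root_XsubC eqxx.
move=> /eigenvalueP [v0 Av0 v0n0].
have n0 : 0 < (v0 *m v0^T) 0 0.
  rewrite mxE lt0r sumr_ge0 ?andbT => [|i _]; last by rewrite mxE -expr2 sqr_ge0.
  apply: contra v0n0; rewrite psumr_eq0 => [/allP h|i _].
    apply/eqP/rowP => i; have := h i (mem_index_enum i).
    by rewrite !mxE -expr2 expf_eq0 /= => /eqP.
  by rewrite mxE -expr2 sqr_ge0.
pose c := Num.sqrt ((v0 *m v0^T) 0 0).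
pose v := c^-1 *: v0.
have vv : v *m v^T = 1%:M.
  rewrite /v linearZ /= -scalemxAl -scalemxAr scalerA -invfM -expr2 sqr_sqrtr ?ltW //.
  rewrite [X in _ *: X]mx11_scalar -mul_scalar_mx -scalar_mxM mulVf //.
  by rewrite gt_eqF.
have Av : v *m A = l *: v by rewrite /v -scalemxAl Av0 !scalerA mulrC.
have [H [HH eH]] := householder vv.
(* [B], and [B'] below with its rows and columns split, are kept opaque so that
   the block operations do not unfold the product. *)
have [B BH] : {B | B = H *m A *m H^T} by eexists.
have BT : B^T = B by rewrite BH !trmx_mul trmxK AT mulmxA.
have eB : (delta_mx 0 0 : 'rV_d.+1) *m B = l *: delta_mx 0 0.
  by rewrite BH !mulmxA eH Av -scalemxAl -eH -mulmxA HH mulmx1.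
have [B' B'E] : {B' : 'M[R]_(1 + d) | B' = B :> 'M[R]_d.+1} by exists B.
have B'T : B'^T = B' by rewrite B'E BT.
have B00 : ulsubmx B' = l%:M.
  apply/matrixP => i j; rewrite !ord1 !mxE /= mulr1n.
  have /matrixP /(_ 0 0) := eB; rewrite -rowE !mxE eqxx mulr1 => <-.
  by rewrite -B'E; apply: (@f_equal2 _ _ _ (fun_of_matrix B')); apply/val_inj.
have B01 : ursubmx B' = 0.
  apply/matrixP => i j; rewrite !ord1 [LHS]mxE [LHS]mxE [RHS]mxE.
  have /matrixP /(_ 0 (rshift 1 j)) := eB; rewrite -rowE [LHS]mxE [RHS]mxE [delta_mx _ _ _ _]mxE /= mulr0 => <-.
  by rewrite -B'E; apply: (@f_equal2 _ _ _ (fun_of_matrix B')); apply/val_inj.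
have B10 : dlsubmx B' = 0.
  by rewrite -[LHS]trmxK trmx_dlsub B'T B01 trmx0.
have BE : B' = block_mx l%:M 0 0 (drsubmx B') by rewrite -[LHS]submxK B00 B01 B10.
have A'T : (drsubmx B')^T = drsubmx B'.
  by rewrite trmx_drsub B'T.
have cpB : char_poly B' = ('X - l%:P) * char_poly (drsubmx B').
  move: (drsubmx B') BE => C ->; rewrite /char_poly /char_poly_mx.
  rewrite map_block_mx !map_mx0 map_scalar_mx scalar_mx_block.
  rewrite opp_block_mx add_block_mx !oppr0 !addr0 det_ublock.
  by rewrite -raddfB /= det_scalar1.
have cpA' : char_poly (drsubmx B') = \prod_(l <- s) ('X - l%:P).
  have : char_poly B = char_poly A by rewrite BH simmx_char_poly.
  rewrite cpA big_cons -B'E cpB.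
  by apply: mulfI; rewrite polyXsubC_eq0.
have [Q' [QQ' Q'A]] := IH _ _ A'T cpA'.
pose Q1 : 'M[R]_(1 + d) := block_mx 1%:M 0 0 Q'.
have Q1Q1 : Q1 *m Q1^T = 1%:M.
  rewrite /Q1 tr_block_mx !trmx0 trmx1 mulmx_block !(mulmx0, mul0mx, mulmx1) QQ'.
  by rewrite !(addr0, add0r) -scalar_mx_block.
exists (Q1 *m H); split.
  by rewrite trmx_mul mulmxA -[Q1 *m H *m _]mulmxA HH mulmx1.
rewrite trmx_mul mulmxA -2!(mulmxA Q1) -BH.
have QB : Q1 *m B' *m Q1^T = block_mx l%:M 0 0 (diag_mx (\row_i s`_i)).
  rewrite [in LHS]BE /Q1 tr_block_mx !trmx0 trmx1 !mulmx_block.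
  by rewrite !(mulmx0, mul0mx, mulmx1, mul1mx, addr0, add0r) Q'A.
rewrite -B'E [LHS]QB; apply/matrixP => i j; rewrite [RHS]mxE.
case: (splitP (i : 'I_(1 + d))) => i' Di; case: (splitP (j : 'I_(1 + d))) => j' Dj.
- have -> : i = lshift d i' by apply: val_inj.
  have -> : j = lshift d j' by apply: val_inj.
  by rewrite [LHS]block_mxEul !mxE !ord1 !eqxx.
- have -> : i = lshift d i' by apply: val_inj.
  have -> : j = rshift 1 j' by apply: val_inj.
  by rewrite [LHS]block_mxEur !mxE !ord1.
- have -> : i = rshift 1 i' by apply: val_inj.
  have -> : j = lshift d j' by apply: val_inj.
  by rewrite [LHS]block_mxEdl !mxE !ord1.
- have -> : i = rshift 1 i' by apply: val_inj.
  have -> : j = rshift 1 j' by apply: val_inj.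
  by rewrite [LHS]block_mxEdr !mxE.
Qed.

End Spectral.

(** * Euclidean norm, and the bound by the second eigenvalue *)

Section Vectors.
Variable R : realType.
Implicit Types (d : nat).

Lemma dotvE d (v w : 'cV[R]_d) : dotv v w = \sum_i v i 0 * w i 0.
Proof. by rewrite /dotv mxE; apply: eq_bigr => i _; rewrite mxE. Qed.

Lemma dotvC d (v w : 'cV[R]_d) : dotv v w = dotv w v.
Proof. by rewrite !dotvE; apply: eq_bigr => i _; rewrite mulrC. Qed.

Lemma dotvDl d (a b w : 'cV[R]_d) : dotv (a + b) w = dotv a w + dotv b w.
Proof. by rewrite /dotv linearD mulmxDl mxE. Qed.
Lemma dotvZl d k (a w : 'cV[R]_d) : dotv (k *: a) w = k * dotv a w.
Proof. by rewrite /dotv linearZ /= -scalemxAl mxE. Qed.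
Lemma dotvNl d (a w : 'cV[R]_d) : dotv (- a) w = - dotv a w.
Proof. by rewrite -scaleN1r dotvZl mulN1r. Qed.
Lemma dotv0l d (w : 'cV[R]_d) : dotv 0 w = 0.
Proof. by rewrite -(scale0r 0) dotvZl mul0r. Qed.
Lemma dotv0r d (w : 'cV[R]_d) : dotv w 0 = 0.
Proof. by rewrite dotvC dotv0l. Qed.
Lemma dotvDr d (a b w : 'cV[R]_d) : dotv w (a + b) = dotv w a + dotv w b.
Proof. by rewrite ![dotv w _]dotvC dotvDl. Qed.
Lemma dotvZr d k (a w : 'cV[R]_d) : dotv w (k *: a) = k * dotv w a.
Proof. by rewrite ![dotv w _]dotvC dotvZl. Qed.
Lemma dotvNr d (a w : 'cV[R]_d) : dotv w (- a) = - dotv w a.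
Proof. by rewrite ![dotv w _]dotvC dotvNl. Qed.

Definition dotvB := (dotvDl, dotvDr, dotvZl, dotvZr, dotvNl, dotvNr).

Lemma dotv_ge0 d (v : 'cV[R]_d) : 0 <= dotv v v.
Proof. by rewrite dotvE sumr_ge0 // => i _; rewrite -expr2 sqr_ge0. Qed.

Lemma dotv_mull d e (A : 'M[R]_(d, e)) v w : dotv (A *m v) w = dotv v (A^T *m w).
Proof. by rewrite /dotv trmx_mul mulmxA. Qed.

Lemma norm2_ge0 d (v : 'cV[R]_d) : 0 <= norm2 v.
Proof. exact: sqrtr_ge0. Qed.

Lemma sqr_norm2 d (v : 'cV[R]_d) : norm2 v ^+ 2 = dotv v v.
Proof. by rewrite sqr_sqrtr // dotv_ge0. Qed.

Lemma norm2_eq0 d (v : 'cV[R]_d) : (norm2 v == 0) = (v == 0).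
Proof.
apply/eqP/eqP => [v0|->]; last by rewrite /norm2 dotv0l sqrtr0.
have /eqP : dotv v v = 0 by rewrite -sqr_norm2 v0 expr0n.
rewrite dotvE psumr_eq0 => [/allP h|i _]; last by rewrite -expr2 sqr_ge0.
apply/colP => i; have := h i (mem_index_enum i).
by rewrite !mxE -expr2 expf_eq0 /= => /eqP.
Qed.

(** Expand the square of [|w| v - |v| w]. *)
Lemma CauchySchwarz d (v w : 'cV[R]_d) : dotv v w <= norm2 v * norm2 w.
Proof.
have [v0|v0] := eqVneq (norm2 v) 0.
  by rewrite v0 mul0r; move/eqP: v0; rewrite norm2_eq0 => /eqP ->; rewrite dotv0l.
have [w0|w0] := eqVneq (norm2 w) 0.
  by rewrite w0 mulr0; move/eqP: w0; rewrite norm2_eq0 => /eqP ->; rewrite dotvC dotv0l.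
have pv : 0 < norm2 v by rewrite lt0r v0 norm2_ge0.
have pw : 0 < norm2 w by rewrite lt0r w0 norm2_ge0.
have := dotv_ge0 (norm2 w *: v - norm2 v *: w).
rewrite !dotvB [dotv w v]dotvC -!sqr_norm2.
move: (dotv v w) (norm2 v) (norm2 w) pv pw => x a b pa pb h.
have h2 : 0 <= (a * b) * (a * b - x) by nra.
by rewrite -subr_ge0; move: h2; rewrite pmulr_rge0 // mulr_gt0.
Qed.

Lemma norm2D d (v w : 'cV[R]_d) : norm2 (v + w) <= norm2 v + norm2 w.
Proof.
rewrite -(ler_pXn2r (n := 2)) ?nnegrE ?addr_ge0 ?norm2_ge0 // sqr_norm2.
rewrite !dotvB [dotv w v]dotvC -!sqr_norm2.
have := CauchySchwarz v w; nra.
Qed.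

Lemma norm2Z d k (v : 'cV[R]_d) : norm2 (k *: v) = `|k| * norm2 v.
Proof.
by rewrite /norm2 dotvZl dotvZr mulrA -expr2 sqrtrM ?sqr_ge0 // sqrtr_sqr.
Qed.

Lemma norm2N d (v : 'cV[R]_d) : norm2 (- v) = norm2 v.
Proof. by rewrite -scaleN1r norm2Z normrN1 mul1r. Qed.

Lemma norm2_0 d : norm2 (0 : 'cV[R]_d) = 0.
Proof. by apply/eqP; rewrite norm2_eq0. Qed.

Lemma norm2_sum (T : Type) (r : seq T) (P : pred T) d (F : T -> 'cV[R]_d) :
  norm2 (\sum_(i <- r | P i) F i) <= \sum_(i <- r | P i) norm2 (F i).
Proof.
elim/big_ind2: _ => [|v x w y hv hw|i _]; rewrite ?norm2_0 //.
by rewrite (le_trans (norm2D _ _)) // lerD.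
Qed.

Lemma normr_dotv d (v w : 'cV[R]_d) : `|dotv v w| <= norm2 v * norm2 w.
Proof.
rewrite ler_norml CauchySchwarz andbT lerNl -dotvNl.
by rewrite (le_trans (CauchySchwarz _ _)) // norm2N.
Qed.

Lemma norm2_coord d (v : 'cV[R]_d) i : `|v i 0| <= norm2 v.
Proof.
rewrite -(ler_pXn2r (n := 2)) ?nnegrE ?norm2_ge0 // sqr_norm2 real_normK ?num_real //.
rewrite dotvE (bigD1 i) //= -expr2 lerDl sumr_ge0 // => j _.
by rewrite -expr2 sqr_ge0.
Qed.

(** In the eigenbasis [Q], the strict inequality between the first two
    eigenvalues forces [Q u] onto the first axis, so [Q w] vanishes there
    and is only multiplied by eigenvalues that are at most [s`_1]. These are
    nonnegative by semidefiniteness, so their squares compare too. *)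
Lemma second_eig_bound d (A : 'M[R]_d) (s : seq R) (u w : 'cV[R]_d) :
  (1 < d)%N -> A^T = A -> (forall v, 0 <= dotv v (A *m v)) ->
  char_poly A = \prod_(l <- s) ('X - l%:P) -> sorted >=%R s -> s`_1 < s`_0 ->
  A *m u = s`_0 *: u -> u != 0 -> dotv u w = 0 ->
  0 <= s`_1 /\ norm2 (A *m w) <= s`_1 * norm2 w.
Proof.
move=> d1 AT psd cpA srt gap Au u0 uw.
have szs : size s = d.
  by have := size_char_poly A; rewrite cpA size_prod_XsubC => -[].
have [Q [QQ QAQ]] := sym_diag AT cpA; have QQ' := mulmx1C QQ.
pose D := diag_mx (\row_(i < d) s`_i).
have QA (v : 'cV[R]_d) : Q *m (A *m v) = D *m (Q *m v).
  by rewrite /D -QAQ -!mulmxA [Q^T *m _]mulmxA QQ' mul1mx.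
have DE (v : 'cV[R]_d) i : (D *m v) i 0 = s`_i * v i 0.
  by rewrite /D mul_diag_mx !mxE.
have isoQ v w' : dotv (Q *m v) (Q *m w') = dotv v w'.
  by rewrite dotv_mull mulmxA QQ' mul1mx.
have sge0 i : (i < d)%N -> 0 <= s`_i.
  move=> id; have := psd (Q^T *m (delta_mx (Ordinal id) 0)).
  rewrite -isoQ QA (mulmxA Q) QQ mul1mx.
  rewrite dotvE (bigD1 (Ordinal id)) //= big1 ?addr0 => [|j ji].
    by rewrite DE !mxE !eqxx mul1r mulr1.
  by rewrite !mxE (negbTE ji) mul0r.
have le_s i : (0 < i < d)%N -> s`_i <= s`_1.
  move=> /andP[i0 id]; have := sorted_leq_nth (@rev_trans _ _ le_trans) (@lexx _ R) 0 srt.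
  by move=> /(_ 1%N i); rewrite !inE szs => /(_ d1 id i0).
have Qu0 (i : 'I_d) : i != 0%N :> nat -> (Q *m u) i 0 = 0.
  move=> i0; have := QA u; rewrite Au -scalemxAr => /matrixP /(_ i 0).
  rewrite DE mxE => /eqP; rewrite -subr_eq0 -mulrBl mulf_eq0 subr_eq0.
  case/orP=> [/eqP e|/eqP //].
  have := le_s i; rewrite lt0n i0 ltn_ord -e => /(_ isT).
  by rewrite leNgt gap.
have d0 : (0 < d)%N by apply: leq_trans d1.
pose o := Ordinal d0.
have Quo : (Q *m u) o 0 != 0.
  apply: contra u0 => /eqP e; suff : Q *m u = 0.
    by move=> /(congr1 (mulmx Q^T)); rewrite mulmxA QQ' mul1mx mulmx0 => ->.
  apply/colP => i; rewrite [RHS]mxE; have [i0|/Qu0 //] := eqVneq (val i) 0%N.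
  by have -> : i = o by apply: val_inj.
have Qw : (Q *m w) o 0 = 0.
  move: uw; rewrite -isoQ dotvE (bigD1 o) //= big1 ?addr0 => [/eqP|j jo].
    by rewrite mulf_eq0 (negbTE Quo) => /eqP.
  by rewrite Qu0 ?mul0r //; apply: contra jo => /eqP e; apply/eqP/val_inj.
split; first exact: sge0.
rewrite -(ler_pXn2r (n := 2)) ?nnegrE ?mulr_ge0 ?norm2_ge0 ?sge0 //.
rewrite exprMn !sqr_norm2 -isoQ -[dotv w w]isoQ QA.
rewrite !dotvE mulr_sumr ler_sum // => i _.
rewrite DE; have [i0|i0] := eqVneq (val i) 0%N.
  by have -> : i = o; [apply: val_inj|rewrite Qw !(mulr0, mul0r)].
rewrite mulrACA -!expr2 ler_wpM2r ?sqr_ge0 //.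
by rewrite ler_pXn2r ?nnegrE ?sge0 // le_s // lt0n i0 ltn_ord.
Qed.

End Vectors.

(** * The perturbed Chebyshev recurrence *)

Section Chebyshev.
Variable R : realType.

(** For numbers, [c^2 + p^2 - 2 a c p] is constant along the recurrence [t =
    2 a c - p]; this is its matrix form. Both [c - A p] and [A c - p] are
    bounded by its square root when [A] is a contraction, so that iterates
    grow at most linearly. *)
Definition energy d (A : 'M[R]_d) (p c : 'cV[R]_d) : R :=
  dotv c c + dotv p p - 2 * dotv (A *m c) p.

(** The energy equals [|A c - p|^2 + |c|^2 - |A c|^2], hence [|A c - p| <=
    D]; and an error [e] changes it by [2 <A c - p, e> + |e|^2]. *)
Lemma energy_step d (A : 'M[R]_d) p c e (D E : R) :
  A^T = A -> norm2 (A *m c) <= norm2 c -> 0 <= D ->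
  energy A p c <= D ^+ 2 -> norm2 e <= E ->
  energy A c (2 *: (A *m c) - p + e) <= (D + E) ^+ 2.
Proof.
move=> AT Ac D0 en eE.
have dle : norm2 (A *m c - p) <= D.
  rewrite -(ler_pXn2r (n := 2)) ?nnegrE ?norm2_ge0 // sqr_norm2.
  apply: le_trans en; rewrite !dotvB [dotv p (A *m c)]dotvC /energy.
  have : norm2 (A *m c) ^+ 2 <= norm2 c ^+ 2.
    by rewrite ler_pXn2r ?nnegrE ?norm2_ge0.
  by rewrite !sqr_norm2; lra.
have -> : energy A c (2 *: (A *m c) - p + e) =
    energy A p c + 2 * dotv (A *m c - p) e + dotv e e.
  rewrite /energy dotv_mull AT !dotvB [dotv p (A *m c)]dotvC.
  by rewrite [dotv e (A *m c)]dotvC [dotv e p]dotvC; ring.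
have := CauchySchwarz (A *m c - p) e; rewrite -(sqr_norm2 e).
have : norm2 (A *m c - p) * norm2 e <= D * E by rewrite ler_pM ?norm2_ge0.
have : norm2 e ^+ 2 <= E ^+ 2.
  by rewrite ler_pXn2r ?nnegrE ?norm2_ge0 // (le_trans _ eE) ?norm2_ge0.
nra.
Qed.

(** The energy also equals [|c - A p|^2 + |p|^2 - |A p|^2]. *)
Lemma energy_norm d (A : 'M[R]_d) p c (D : R) :
  A^T = A -> norm2 (A *m p) <= norm2 p -> 0 <= D ->
  energy A p c <= D ^+ 2 -> norm2 c <= D + norm2 p.
Proof.
move=> AT Ap D0 en.
have dle : norm2 (c - A *m p) <= D.
  rewrite -(ler_pXn2r (n := 2)) ?nnegrE ?norm2_ge0 // sqr_norm2.
  apply: le_trans en; rewrite !dotvB [dotv (A *m p) c]dotvC /energy (dotv_mull A c) AT.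
  have : norm2 (A *m p) ^+ 2 <= norm2 p ^+ 2.
    by rewrite ler_pXn2r ?nnegrE ?norm2_ge0.
  by rewrite !sqr_norm2; lra.
rewrite -[X in norm2 X](subrK (A *m p)); apply: le_trans (norm2D _ _) _.
exact: lerD.
Qed.

Definition perp d (u v : 'cV[R]_d) := v - dotv u v *: u.

Lemma perp_orth d (u v : 'cV[R]_d) : norm2 u = 1 -> dotv u (perp u v) = 0.
Proof.
by move=> u1; rewrite /perp !dotvB -sqr_norm2 u1 expr1n mulr1 subrr.
Qed.

Lemma perpD d (u v w : 'cV[R]_d) : perp u (v + w) = perp u v + perp u w.
Proof. by rewrite /perp dotvDr scalerDl opprD addrACA. Qed.

Lemma perpZ d k (u v : 'cV[R]_d) : perp u (k *: v) = k *: perp u v.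
Proof. by rewrite /perp dotvZr scalerBr scalerA. Qed.

Lemma perpN d (u v : 'cV[R]_d) : perp u (- v) = - perp u v.
Proof. by rewrite -scaleN1r perpZ scaleN1r. Qed.

Lemma perp_mulmx d (A : 'M[R]_d) x (u v : 'cV[R]_d) :
  A^T = A -> A *m u = x *: u -> perp u (A *m v) = A *m perp u v.
Proof.
move=> AT Au; rewrite /perp mulmxBr -scalemxAr Au.
by rewrite dotvC dotv_mull AT Au dotvZr dotvC !scalerA mulrC.
Qed.

Lemma norm2_split d (u v : 'cV[R]_d) : norm2 u = 1 ->
  dotv v v = dotv u v ^+ 2 + norm2 (perp u v) ^+ 2.
Proof.
move=> u1; rewrite sqr_norm2 /perp !dotvB -[dotv u u]sqr_norm2 u1 expr1n.
by rewrite [dotv v u]dotvC; ring.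
Qed.

Lemma norm2_perp d (u v : 'cV[R]_d) : norm2 u = 1 -> norm2 (perp u v) <= norm2 v.
Proof.
move=> u1; rewrite -(ler_pXn2r (n := 2)) ?nnegrE ?norm2_ge0 //.
by rewrite (sqr_norm2 v) (norm2_split v u1) lerDr sqr_ge0.
Qed.

(** The square root of the energy of the component orthogonal to [u]
    increases by at most [E], the size of the rounding errors, at each step;
    the norm increases by at most that square root. *)
Definition perp_inv d (A : 'M[R]_d) u (D E : R) (k : nat) p c : Prop :=
  energy A (perp u p) (perp u c) <= (D + k%:R * E) ^+ 2 /\
  norm2 (perp u p) <= k%:R * (D + k%:R * E).

Lemma perp_inv_norm d (A : 'M[R]_d) u D E k p c :
  norm2 u = 1 -> A^T = A ->
  (forall w, dotv u w = 0 -> norm2 (A *m w) <= norm2 w) -> 0 <= D -> 0 <= E ->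
  perp_inv A u D E k p c -> norm2 (perp u c) <= k.+1%:R * (D + k%:R * E).
Proof.
move=> u1 AT contr D0 E0 [en np].
have DE0 : 0 <= D + k%:R * E by rewrite addr_ge0 ?mulr_ge0.
have := energy_norm AT (contr _ (perp_orth _ u1)) DE0 en.
by rewrite -natr1 mulrDl mul1r; lra.
Qed.

Lemma perp_inv_step d (A : 'M[R]_d) x u D E k p c e :
  norm2 u = 1 -> A^T = A -> A *m u = x *: u ->
  (forall w, dotv u w = 0 -> norm2 (A *m w) <= norm2 w) -> 0 <= D -> 0 <= E ->
  perp_inv A u D E k p c -> norm2 e <= E ->
  perp_inv A u D E k.+1 c (2 *: (A *m c) - p + e).
Proof.
move=> u1 AT Au contr D0 E0 inv eE; have [en np] := inv.
have DE0 : 0 <= D + k%:R * E by rewrite addr_ge0 ?mulr_ge0.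
split.
  rewrite !perpD perpN perpZ (perp_mulmx _ AT Au).
  have -> : D + k.+1%:R * E = D + k%:R * E + E by rewrite -natr1; ring.
  apply: energy_step => //; first exact: contr (perp_orth _ u1).
  exact: le_trans (norm2_perp _ u1) eE.
apply: le_trans (perp_inv_norm u1 AT contr D0 E0 inv) _.
by rewrite ler_wpM2l // lerD2l ler_wpM2r // ler_nat.
Qed.

(** Along an eigenvector for [x] with [2 x >= rho + 1 / rho], the quantity
    [ac - ap / rho] is multiplied by at least [rho] at each step. The bound
    [f >= rho^k (S - h) + h] survives an error of size [h (rho - 1)], as [h]
    is the fixed point of [f |-> rho f - h (rho - 1)]. *)
Definition grow_inv (rho h S : R) (k : nat) (ap ac : R) : Prop :=
  0 <= ap /\ rho ^+ k * (S - h) + h <= ac - ap / rho.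

Lemma grow_inv_ge rho h S k ap ac : 1 < rho -> 0 <= h <= S ->
  grow_inv rho h S k ap ac -> 0 <= ac /\ rho ^+ k * (S - h) <= ac.
Proof.
move=> r1 /andP[h0 hS] [ap0 f].
have r0 : 0 < rho by lra.
have : 0 <= ap / rho by rewrite divr_ge0 // ltW.
have : 0 <= rho ^+ k * (S - h) by rewrite mulr_ge0 ?exprn_ge0 ?subr_ge0 // ltW.
by split; lra.
Qed.

Lemma grow_inv_step rho h S x k ap ac e : 1 < rho -> 0 <= h <= S ->
  rho + rho^-1 <= 2 * x -> `|e| <= h * (rho - 1) ->
  grow_inv rho h S k ap ac -> grow_inv rho h S k.+1 ac (2 * x * ac - ap + e).
Proof.
move=> r1 hS xr eh inv; have [ac0 _] := grow_inv_ge r1 hS inv.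
have [ap0 f] := inv; split=> //.
have r0 : 0 < rho by lra.
have : (rho + rho^-1) * ac <= 2 * x * ac by rewrite ler_wpM2r.
have : rho * (rho ^+ k * (S - h) + h) <= rho * (ac - ap / rho).
  by rewrite ler_wpM2l // ltW.
have -> : rho * (ac - ap / rho) = rho * ac - ap by field; rewrite gt_eqF.
move: eh; rewrite ler_norml exprS => /andP[e1 e2].
lra.
Qed.

Lemma bernoulli (h : R) k : 0 <= h -> 1 + k%:R * h <= (1 + h) ^+ k.
Proof.
move=> h0; elim: k => [|k IH]; first by rewrite mul0r addr0 expr0.
rewrite exprS -natr1; have : (1 + h) * (1 + k%:R * h) <= (1 + h) * (1 + h) ^+ k.
  by rewrite ler_wpM2l // addr_ge0.
have : 0 <= k%:R * h * h by rewrite !mulr_ge0.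
lra.
Qed.

Lemma growth (h : R) j r k : 0 <= h -> 1 <= j%:R * h -> (j * r <= k)%N ->
  2 ^+ r <= (1 + h) ^+ k.
Proof.
move=> h0 jh jrk; apply: (@le_trans _ _ ((1 + h) ^+ (j * r))).
  rewrite exprM lerXn2r ?nnegrE ?exprn_ge0 ?addr_ge0 //.
  by apply: le_trans (bernoulli j h0); lra.
by rewrite ler_weXn2l // lerDl.
Qed.

End Chebyshev.

(** * Rounding the data to integers *)

Section Rounding.
Variable R : realType.

Definition flr (r : R) : R := (Num.floor r)%:~R.

Lemma flr_itv r : flr r <= r < flr r + 1.
Proof.
by rewrite /flr floor_le /= -[X in _ + X]/(1%:~R) -intrD floorD1_gt.
Qed.

Lemma flr0 : flr 0 = 0. Proof. by rewrite /flr floor0. Qed.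

Lemma norm2_le_sum d (v : 'cV[R]_d) : norm2 v <= \sum_i `|v i 0|.
Proof.
have {1}-> : v = \sum_i v i 0 *: delta_mx i 0.
  apply/colP => j; rewrite summxE (bigD1 j) //= big1 ?addr0 => [|i ij].
    by rewrite !mxE !eqxx mulr1.
  by rewrite !mxE eq_sym (negbTE ij) mulr0.
apply: le_trans (norm2_sum _ _ _) _; apply: ler_sum => i _.
rewrite norm2Z.
by rewrite /norm2 dotvE (bigD1 i) //= big1 ?addr0 => [|j ji];
  rewrite !mxE ?eqxx ?(negbTE ji) ?mul0r //= mulr1 sqrtr1 mulr1.
Qed.

Lemma norm2_sparse d (v : 'cV[R]_d) (P : {pred 'I_d}) (N : nat) (b : R) :
  (#|P| <= N)%N -> 0 <= b -> (forall c, c \notin P -> v c 0 = 0) ->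
  (forall c, `|v c 0| <= b) -> norm2 v <= N%:R * b.
Proof.
move=> PN b0 vP vb; apply: le_trans (norm2_le_sum v) _.
rewrite (bigID [pred c | c \in P]) /= [X in _ + X]big1 ?addr0 => [|c /vP ->]; last by rewrite normr0.
apply: (@le_trans _ _ (\sum_(c in P) b)); first by apply: ler_sum.
by rewrite sumr_const mulr_natl ler_wpMn2l.
Qed.

Definition roundv (Q : R) d (v : 'cV[R]_d) : 'cV[R]_d := \col_c flr (Q * v c 0).

Definition vsupp d (v : 'cV[R]_d) : {pred 'I_d} := [pred c | v c 0 != 0].

Lemma roundv_err Q d (v : 'cV[R]_d) (N : nat) : 0 < Q ->
  (#|vsupp v| <= N)%N ->
  norm2 (Q^-1 *: roundv Q v - v) <= N%:R / Q.
Proof.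
move=> Q0 vN; apply: norm2_sparse vN _ _ _ => [|c|c].
- by rewrite invr_ge0 ltW.
- by rewrite inE negbK !mxE => /eqP ->; rewrite mulr0 flr0 mulr0 subrr.
rewrite !mxE -[X in _ - X](mulKf (lt0r_neq0 Q0)) -mulrBr normrM gtr0_norm ?invr_gt0 //.
rewrite ler_piMr ?invr_ge0 ?(ltW Q0) //.
have /andP[h1 h2] := flr_itv (Q * v c 0).
by rewrite ler_norml; lra.
Qed.

Definition gram n d (y : 'I_n -> 'cV[R]_d) : 'M[R]_d := \sum_i y i *m (y i)^T.

Lemma gram_mul n d (y : 'I_n -> 'cV[R]_d) t :
  gram y *m t = \sum_i dotv (y i) t *: y i.
Proof.
rewrite /gram mulmx_suml; apply: eq_bigr => i _.
by rewrite -mulmxA [(y i)^T *m t]mx11_scalar mul_mx_scalar.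
Qed.

Lemma tr_gram n d (y : 'I_n -> 'cV[R]_d) : (gram y)^T = gram y.
Proof.
by rewrite /gram linear_sum; apply: eq_bigr => i _; rewrite /= trmx_mul trmxK.
Qed.

Lemma dotv_gram n d (y : 'I_n -> 'cV[R]_d) v :
  dotv v (gram y *m v) = \sum_i dotv (y i) v ^+ 2.
Proof.
rewrite gram_mul /dotv mulmx_sumr summxE; apply: eq_bigr => i _.
by rewrite -scalemxAr mxE -/(dotv v (y i)) dotvC expr2.
Qed.

(** For each point, [y y^T - x x^T = y (y - x)^T + (y - x) x^T], where [y =
    roundv Q x / Q] is within [N / Q] of [x]. *)
Lemma gram_err n d (x : 'I_n -> 'cV[R]_d) (Q : R) (N : nat) t :
  (forall i, norm2 (x i) <= 1) ->
  (forall i, #|vsupp (x i)| <= N)%N -> 0 < Q -> N%:R <= Q -> (0 < n)%N ->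
  norm2 ((n%:R * Q ^+ 2)^-1 *: (gram (fun i => roundv Q (x i)) *m t)
         - n%:R^-1 *: (gram x *m t)) <= 3 * (N%:R / Q) * norm2 t.
Proof.
move=> x1 xN Q0 NQ n0.
pose y i := Q^-1 *: roundv Q (x i).
have nR : 0 < n%:R :> R by rewrite ltr0n.
have -> : (n%:R * Q ^+ 2)^-1 *: (gram (fun i => roundv Q (x i)) *m t)
         - n%:R^-1 *: (gram x *m t) =
    n%:R^-1 *: \sum_i (dotv (y i) t *: (y i - x i) + dotv (y i - x i) t *: x i).
  rewrite invfM -scalerA -scalerBr; congr (_ *: _).
  rewrite !gram_mul scaler_sumr -sumrB; apply: eq_bigr => i _.
  have -> : (Q ^+ 2)^-1 *: (dotv (roundv Q (x i)) t *: roundv Q (x i)) = dotv (y i) t *: y i.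
    by rewrite /y dotvZl !scalerA -exprVn; congr (_ *: _); ring.
  by rewrite dotvDl dotvNl scalerBr scalerBl addrA subrK.
rewrite norm2Z ger0_norm ?invr_ge0 ?(ltW nR) // ler_pdivrMl //.
apply: le_trans (norm2_sum _ _ _) _.
rewrite (mulr_natl _ n) -[X in _ *+ X]card_ord -sumr_const.
apply: ler_sum => i _.
have ye := roundv_err Q0 (xN i); rewrite -/(y i) in ye.
have NQ1 : N%:R / Q <= 1 by rewrite ler_pdivrMr // mul1r.
have y2 : norm2 (y i) <= 2.
  rewrite -[y i](subrK (x i)); apply: le_trans (norm2D _ _) _.
  have := x1 i; lra.
apply: le_trans (norm2D _ _) _; rewrite !norm2Z.
have t0 := norm2_ge0 t.
have h1 : `|dotv (y i) t| * norm2 (y i - x i) <= (2 * norm2 t) * (N%:R / Q).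
  rewrite ler_pM ?norm2_ge0 // (le_trans (normr_dotv _ _)) //.
  by rewrite ler_wpM2r.
have h2 : `|dotv (y i - x i) t| * norm2 (x i) <= (N%:R / Q * norm2 t) * 1.
  rewrite ler_pM ?norm2_ge0 // (le_trans (normr_dotv _ _)) //.
  by rewrite ler_wpM2r.
by lra.
Qed.

(** The error has two sources: the final rounding moves each of the at most
    [N] coordinates that occur by less than 1, and [M] is only the Gram
    matrix of the rounded points. *)
Lemma rounded_step n d (x : 'I_n -> 'cV[R]_d) (Q mu : R) (N : nat) (p c : 'cV[R]_d) :
  (forall i, norm2 (x i) <= 1) ->
  (#|[pred c | [exists i, c \in vsupp (x i)]]| <= N)%N ->
  0 < Q -> N%:R <= Q -> (0 < n)%N -> 0 < mu ->
  let M := gram (fun i => roundv Q (x i)) in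
  let kappa := 2 / (mu * n%:R * Q * Q) in
  let A := mu^-1 *: (n%:R^-1 *: gram x) in
  exists2 e, (\col_j (flr (kappa * (M *m c) j 0) - p j 0)) = 2 *: (A *m c) - p + e
    & norm2 e <= N%:R + 2 / mu * (3 * (N%:R / Q) * norm2 c).
Proof.
move=> x1 xN Q0 NQ n0 mu0 M kappa A.
have nR : 0 < n%:R :> R by rewrite ltr0n.
have xN' i : (#|vsupp (x i)| <= N)%N.
  apply: leq_trans xN; apply: subset_leq_card; apply/fintype.subsetP => j.
  by rewrite !inE => h; apply/existsP; exists i.
pose f : 'cV[R]_d := \col_j (flr (kappa * (M *m c) j 0) - kappa * (M *m c) j 0).
pose g := (2 / mu) *: ((n%:R * Q ^+ 2)^-1 *: (M *m c) - n%:R^-1 *: (gram x *m c)).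
exists (f + g).
  have -> : A *m c = mu^-1 *: (n%:R^-1 *: (gram x *m c)) by rewrite /A -!scalemxAl.
  rewrite /f /g; move: (M *m c) (gram x *m c) => a b.
  apply/colP => j; rewrite !mxE /kappa.
  by field; rewrite !gt_eqF.
apply: le_trans (norm2D _ _) _; apply: lerD.
  rewrite -[leRHS]mulr1; apply: norm2_sparse xN _ _ _ => // j.
    rewrite inE negb_exists => /forallP h; rewrite mxE.
    suff -> : (M *m c) j 0 = 0 by rewrite mulr0 flr0 subrr.
    rewrite /M gram_mul summxE big1 // => i _; rewrite !mxE.
    by have := h i; rewrite negbK => /eqP ->; rewrite mulr0 flr0 mulr0.
  rewrite mxE ler_norml; have := flr_itv (kappa * (M *m c) j 0); lra.
rewrite norm2Z gtr0_norm ?divr_gt0 // ler_wpM2l ?divr_ge0 ?(ltW mu0) //.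
exact: gram_err.
Qed.

End Rounding.

(** * What one run of the rounded recurrence certifies about its shift *)

Section RoundAnalysis.
Variable R : realType.
Variables (n d N : nat) (x : 'I_n -> 'cV[R]_d) (u : 'cV[R]_d) (l1 l2 : R).
Variables (Z eps kd : R) (H : nat).
Let X := n%:R^-1 *: gram x.
Hypothesis (n0 : (0 < n)%N) (x1 : forall i, norm2 (x i) <= 1).
Hypothesis actN : (#|[pred c | [exists i, c \in vsupp (x i)]]| <= N)%N.
Hypothesis (u1 : norm2 u = 1) (Xu : X *m u = l1 *: u).
Hypothesis (l20 : 0 <= l2) (l12 : l2 < l1) (l1_le1 : l1 <= 1).
Hypothesis Xperp : forall w, dotv u w = 0 -> norm2 (X *m w) <= l2 * norm2 w.
(* [kd] stands for a multiple of the inverse estimated gap, and [Z] for a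
   number larger than every other parameter of the problem. *)
Hypothesis (Z64 : 64 <= Z) (ZH : Z = 2 ^+ H) (nZ : n%:R <= Z) (NZ : 64 * N%:R <= Z).
Hypothesis (gapZ : 64 / (l1 - l2) <= kd) (kdZ : kd <= Z).
Hypothesis (eps0 : 0 < eps) (epsZ : eps^-1 <= Z).

(* The scales are separated by powers of [Z].  Rounding errors are at most [Z] in
   each step, and add up to less than the size [Sc] of the leading component at
   the start.  The orthogonal component starts below [Z^7] and stays below
   [Z^11], far below the threshold [Theta].  The precision [Q] of the data makes
   their rounding harmless for vectors of norm [Theta]. *)
Let Sc := Z ^+ 4.
Let Theta := Z ^+ 16.
Let Q := Z ^+ 32.
Let M := gram (fun i => roundv Q (x i)).

(** [2 / mu] for the covariance matrix, corrected by the factor [n Q^2] that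
    the integer Gram matrix carries. *)
Definition kappa_of (n' : nat) (Q' mu : R) := 2 / (mu * n'%:R * Q' * Q').
Let kappa mu := kappa_of n Q mu.

Definition next_vec mu (p c : 'cV[R]_d) : 'cV[R]_d :=
  \col_j (flr (kappa mu * (M *m c) j 0) - p j 0).

Let h0 := Num.sqrt ((l1 - l2) / 2).
Let rho := 1 + h0.
Let A mu := mu^-1 *: X.

(** For a shift at least [l2], the scaled matrix is a contraction on the
    complement of [u], which therefore stays small; for a shift below [l1]
    by a quarter of the gap, the component along [u] grows exponentially.
    Both happen for the shifts in between. *)
Definition round_inv (mu : R) (k : nat) (p c : 'cV[R]_d) : Prop :=
  (l2 <= mu -> perp_inv (A mu) u (Z ^+ 7) Z k p c) /\
  (mu <= l1 - (l1 - l2) / 4 ->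
     grow_inv rho (Z / h0) Sc k (dotv u p) (dotv u c)).

Let Z1 : 1 <= Z. Proof. have := Z64; lra. Qed.
Let Z0 : 0 < Z. Proof. have := Z64; lra. Qed.
Let gap0 : 0 < l1 - l2. Proof. by rewrite subr_gt0. Qed.

Ltac slra := have := Z64; have := l12; have := l20; have := l1_le1; have := gap0; have := Z0; lra.

Let Zle a b : (a <= b)%N -> Z ^+ a <= Z ^+ b.
Proof. by move=> ab; rewrite ler_weXn2l. Qed.

Let Zgt0 a : 0 < Z ^+ a. Proof. exact: exprn_gt0. Qed.

Let inv_gapZ : (l1 - l2)^-1 <= Z / 64.
Proof. by have := gapZ; have := kdZ; slra. Qed.

Let h00 : 0 < h0. Proof. by rewrite sqrtr_gt0 divr_gt0. Qed.

Let h0E : h0 ^+ 2 = (l1 - l2) / 2.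
Proof. by rewrite sqr_sqrtr // divr_ge0 // ltW. Qed.

Let inv_h0 : h0^-1 <= Z.
Proof.
have [le1|gt1] := leP h0^-1 1; first exact: le_trans Z1.
apply: (@le_trans _ _ (h0^-1 ^+ 2)); first by rewrite expr2 ler_peMl ?invr_ge0 ?(ltW h00) ?(ltW gt1).
by rewrite exprVn h0E invf_div; have := inv_gapZ; slra.
Qed.

Let muZ mu : 3 / 8 * (l1 - l2) <= mu -> 0 < mu /\ mu^-1 <= Z / 16.
Proof.
move=> hmu; have mu0 : 0 < mu by slra.
split=> //; apply: (@le_trans _ _ (3 / 8 * (l1 - l2))^-1).
  by rewrite lef_pV2 ?posrE //; slra.
by rewrite invfM invf_div; have := inv_gapZ; slra.
Qed.

Let XT : X^T = X. Proof. by rewrite /X linearZ /= tr_gram. Qed.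

Lemma round_init mu t : dotv u t >= Sc -> norm2 t <= Z ^+ 7 -> round_inv mu 0 0 t.
Proof.
move=> ut tZ; split=> _.
  have p0 : perp u 0 = 0 by rewrite /perp dotv0r scale0r subr0.
  rewrite /perp_inv !mul0r addr0 p0; split.
    rewrite /energy !dotv0r mulr0 subr0 addr0 -sqr_norm2.
    rewrite ler_pXn2r ?nnegrE ?norm2_ge0 ?exprn_ge0 ?(ltW Z0) //.
    exact: le_trans (norm2_perp _ u1) tZ.
  by rewrite norm2_0.
by rewrite /grow_inv dotv0r mul0r subr0 expr0 mul1r subrK.
Qed.

(** The factor [norm2 c / Q] is at most [Z^-16], which absorbs [1 / mu]. *)
Lemma err_bound mu (c : 'cV[R]_d) : 3 / 8 * (l1 - l2) <= mu -> norm2 c <= Theta ->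
  N%:R + 2 / mu * (3 * (N%:R / Q) * norm2 c) <= Z.
Proof.
move=> /muZ [mu0 imu] cT.
have Q0 : 0 < Q by exact: Zgt0.
have h1 : norm2 c / Q <= 1.
  by rewrite ler_pdivrMr // mul1r (le_trans cT) // Zle.
have h2 : 0 <= norm2 c / Q by rewrite divr_ge0 ?norm2_ge0 // ltW.
have h3 : norm2 c / Q * Z <= 1.
  rewrite mulrAC ler_pdivrMr // mul1r (le_trans (ler_wpM2r (ltW Z0) cT)) //.
  by rewrite /Theta -exprSr Zle.
have -> : 2 / mu * (3 * (N%:R / Q) * norm2 c) = 6 * mu^-1 * N%:R * (norm2 c / Q).
  by field; rewrite !gt_eqF.
have N0 : 0 <= N%:R :> R by [].
have imu0 : 0 <= mu^-1 by rewrite invr_ge0 ltW.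
have h4 : mu^-1 * (norm2 c / Q) <= Z / 16 * (norm2 c / Q) by rewrite ler_wpM2r.
have h5 : N%:R * (mu^-1 * (norm2 c / Q)) <= N%:R * 16^-1 by rewrite ler_wpM2l //; slra.
have := NZ; slra.
Qed.

(** With [h0 = sqrt (gap / 2)] one has [rho + 1 / rho <= 2 + h0^2 = 2 + gap
    / 2], which is at most twice [l1 / mu] because [mu <= l1 - gap / 4 <=
    1]. *)
Lemma round_step mu k p c : 3 / 8 * (l1 - l2) <= mu -> norm2 c <= Theta ->
  round_inv mu k p c -> round_inv mu k.+1 c (next_vec mu p c).
Proof.
move=> hmu cT [ip ig].
have [mu0 imu] := muZ hmu.
have Q0 : 0 < Q by exact: Zgt0.
have NQ : N%:R <= Q.
  apply: (@le_trans _ _ (Z ^+ 1)); last exact: Zle.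
  by rewrite expr1; have := NZ; have : 0 <= N%:R :> R by []; slra.
have [e E eb] := rounded_step p c x1 actN Q0 NQ n0 mu0.
have Ee : norm2 e <= Z by apply: le_trans eb (err_bound hmu cT).
have -> : next_vec mu p c = 2 *: (A mu *m c) - p + e by exact: E.
have AT : (A mu)^T = A mu by rewrite /A linearZ /= XT.
have Au : A mu *m u = (mu^-1 * l1) *: u by rewrite /A -scalemxAl Xu scalerA.
split=> [/[dup] l2mu /ip {}ip|/[dup] mul /ig {}ig].
  apply: (perp_inv_step (x := mu^-1 * l1)) => //; rewrite ?exprn_ge0 ?(ltW Z0) //.
  move=> w uw; rewrite /A -scalemxAl norm2Z ger0_norm ?invr_ge0 ?(ltW mu0) //.
  rewrite ler_pdivrMl //; apply: le_trans (Xperp uw) _.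
  by rewrite ler_wpM2r ?norm2_ge0.
have -> : dotv u (2 *: (A mu *m c) - p + e) =
    2 * (mu^-1 * l1) * dotv u c - dotv u p + dotv u e.
  rewrite !dotvB; congr (_ - _ + _); rewrite [dotv u (_ *m _)]dotvC dotv_mull AT Au.
  by rewrite dotvZr dotvC; ring.
apply: grow_inv_step => //.
- by rewrite ltrDl.
- rewrite divr_ge0 ?(ltW Z0) ?(ltW h00) //=.
  apply: (@le_trans _ _ (Z * Z)); first by rewrite ler_wpM2l ?(ltW Z0).
  by rewrite -expr2 Zle.
- have hx : 1 + (l1 - l2) / 4 <= mu^-1 * l1.
    rewrite ler_pdivlMl //.
    have : mu * (l1 - l2) <= 1 * (l1 - l2) by rewrite ler_wpM2r //; slra.
    by slra.
  have r0 : 0 < rho by rewrite addr_gt0.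
  have : rho + rho^-1 <= 2 + h0 ^+ 2.
    rewrite -subr_ge0; have -> : 2 + h0 ^+ 2 - (rho + rho^-1) = h0 ^+ 3 / rho.
      by rewrite /rho; field; rewrite gt_eqF.
    by rewrite divr_ge0 ?exprn_ge0 ?(ltW h00) ?(ltW r0).
  by rewrite h0E; slra.
have -> : Z / h0 * (rho - 1) = Z by rewrite /rho addrAC subrr add0r divfK // gt_eqF.
by apply: le_trans (normr_dotv _ _) _; rewrite u1 mul1r.
Qed.

(** Otherwise the leading component would have doubled [16 H] times, once
    every [2 sqrt kd >= 1 / h0] steps, and [2^(16 H)] is the threshold. *)
Lemma round_survive mu k p c : 32 * H%:R * Num.sqrt kd <= k%:R ->
  round_inv mu k p c -> norm2 c <= Theta -> l1 - (l1 - l2) / 4 < mu.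
Proof.
move=> Kk [_ ig] cT; rewrite ltNge; apply/negP => /ig {}ig.
have r1 : 1 < rho by rewrite ltrDl.
have hS : 0 <= Z / h0 <= Sc.
  rewrite divr_ge0 ?(ltW Z0) ?(ltW h00) //=.
  apply: (@le_trans _ _ (Z * Z)); first by rewrite ler_wpM2l ?(ltW Z0).
  by rewrite -expr2 Zle.
have [_ ge] := grow_inv_ge r1 hS ig.
pose s := Num.sqrt kd.
have kd64 : 64 <= kd.
  apply: le_trans gapZ; rewrite ler_pdivlMr //; slra.
have s1 : 1 <= s.
  by rewrite -[1]sqrtr1 ler_sqrt; slra.
have hs : h0^-1 <= s.
  rewrite -(ler_pXn2r (n := 2)) ?nnegrE ?invr_ge0 ?(ltW h00) ?sqrtr_ge0 //.
  rewrite exprVn h0E invf_div sqr_sqrtr; last slra.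
  by have := gapZ; have : 0 < (l1 - l2)^-1 by [rewrite invr_gt0]; slra.
pose j := (Num.truncn s).+1.
have sj : s < j%:R by have := truncnS_gt s.
have js : j%:R <= 2 * s.
  have /truncn_itv : 0 <= s by slra.
  by rewrite /j => /andP[h _]; rewrite -natr1; slra.
have jh : 1 <= j%:R * h0.
  rewrite -ler_pdivrMr // mul1r; exact: le_trans hs (ltW sj).
have jk : (j * (16 * H) <= k)%N.
  rewrite -(ler_nat R) !natrM; apply: le_trans Kk.
  have : j%:R * (16 * H%:R) <= 2 * s * (16 * H%:R) :> R by rewrite ler_wpM2r // mulr_ge0.
  by rewrite -/s; slra.
have := growth (ltW h00) jh jk; rewrite mulnC exprM -ZH -/rho => rk.
have ST : 2 <= Sc - Z / h0.
  have : Z / h0 <= Z ^+ 2 by rewrite expr2 ler_wpM2l ?(ltW Z0).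
  have : 64 * 64 <= Z ^+ 2 by rewrite expr2 ler_pM.
  rewrite /Sc (exprM Z 2 2); nra.
have : Z ^+ 16 * 2 <= rho ^+ k * (Sc - Z / h0) by rewrite ler_pM ?exprn_ge0 ?(ltW Z0).
have : dotv u c <= norm2 c.
  by apply: le_trans (CauchySchwarz _ _) _; rewrite u1 mul1r.
by have := Zgt0 16; move: cT ge; rewrite -/Theta; slra.
Qed.

(** The orthogonal component is at most [Z^11] while the iterate exceeds
    [Z^16], so it carries a fraction at most [Z^-10 <= eps] of the squared
    norm. *)
Lemma round_exceed mu k p c : l2 <= mu -> 0 < mu -> k.+2%:R <= Z ^+ 3 ->
  round_inv mu k p c -> Theta < norm2 c ->
  1 - eps <= dotv ((norm2 c)^-1 *: c) u ^+ 2.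
Proof.
move=> l2mu mu0 kZ [/(_ l2mu) ip _] cT.
have AT : (A mu)^T = A mu by rewrite /A linearZ /= XT.
have contr w : dotv u w = 0 -> norm2 (A mu *m w) <= norm2 w.
  move=> uw; rewrite /A -scalemxAl norm2Z ger0_norm ?invr_ge0 ?(ltW mu0) //.
  rewrite ler_pdivrMl //; apply: le_trans (Xperp uw) _.
  by rewrite ler_wpM2r ?norm2_ge0.
have Zk0 a : 0 <= Z ^+ a by rewrite ltW.
have := perp_inv_norm u1 AT contr (Zk0 7) (ltW Z0) ip => pn.
have k0 : 0 <= k%:R :> R by [].
have pn' : norm2 (perp u c) <= Z ^+ 11.
  apply: le_trans pn _; apply: (@le_trans _ _ (Z ^+ 3 * Z ^+ 8)); last first.
    by rewrite -exprD.
  apply: ler_pM => //; first by rewrite addr_ge0 ?mulr_ge0 // ltW.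
    by apply: le_trans kZ; rewrite ler_nat.
  have : k%:R * Z <= Z ^+ 3 * Z by rewrite ler_wpM2r ?(ltW Z0) // (le_trans _ kZ) // ler_nat -addn2 leq_addr.
  have : Z ^+ 4 <= Z ^+ 7 by exact: Zle.
  have : 64 * Z ^+ 7 <= Z * Z ^+ 7 by rewrite ler_wpM2r.
  rewrite -exprS -exprSr; have := Zk0 7; slra.
have c0 : 0 < norm2 c by exact: lt_trans (Zgt0 16) cT.
rewrite dotvZl exprMn exprVn dotvC mulrC.
have := norm2_split c u1; rewrite -sqr_norm2 => cE.
have -> : dotv u c ^+ 2 = norm2 c ^+ 2 - norm2 (perp u c) ^+ 2 by rewrite cE addrK.
rewrite mulrBl divff ?expf_neq0 ?gt_eqF // lerD2l lerN2.
rewrite ler_pdivrMr ?exprn_gt0 //.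
apply: (@le_trans _ _ (Z ^+ 22)).
  by rewrite (exprM Z 11 2) ler_pXn2r ?nnegrE ?norm2_ge0.
have : 1 <= eps * Z by rewrite -ler_pdivrMl // mulr1.
have : Z ^+ 32 <= norm2 c ^+ 2.
  by rewrite (exprM Z 16 2) ler_pXn2r ?nnegrE ?norm2_ge0 // ltW.
have : Z * Z ^+ 22 <= Z ^+ 32 by rewrite -exprS Zle.
move: (norm2 c ^+ 2) (Z ^+ 32) (Z ^+ 22) (Zk0 22%N) => a b e e0 h1 h2 h3.
apply: (@le_trans _ _ (eps * (Z * e))); first by rewrite mulrA ler_peMl.
by rewrite ler_wpM2l ?(ltW eps0) // (le_trans h1).
Qed.

(** A sum of [n <= Z] terms, each at most [(2 Q)^2 Theta = 4 Z^80]. *)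
Lemma range_M c j : norm2 c <= Theta -> `|(M *m c) j 0| <= Z ^+ 128 / 4.
Proof.
move=> cT; apply: le_trans (norm2_coord _ _) _.
rewrite /M gram_mul; apply: le_trans (norm2_sum _ _ _) _.
have Q0 : 0 < Q by exact: Zgt0.
have NQ : N%:R <= Q.
  apply: (@le_trans _ _ (Z ^+ 1)); last exact: Zle.
  by rewrite expr1; have := NZ; have : 0 <= N%:R :> R by []; slra.
have rb i : norm2 (roundv Q (x i)) <= 2 * Q.
  have xN' : (#|vsupp (x i)| <= N)%N.
    apply: leq_trans actN; apply: subset_leq_card; apply/fintype.subsetP => j'.
    by rewrite !inE => h; apply/existsP; exists i.
  have := roundv_err Q0 xN' => re.
  have -> : roundv Q (x i) = Q *: (Q^-1 *: roundv Q (x i) - x i + x i).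
    by rewrite subrK scalerA divff ?scale1r // gt_eqF.
  rewrite norm2Z gtr0_norm // [2 * _]mulrC ler_wpM2l ?(ltW Q0) //.
  apply: le_trans (norm2D _ _) _; have := x1 i.
  have : N%:R / Q <= 1 by rewrite ler_pdivrMr // mul1r.
  by slra.
apply: (@le_trans _ _ (\sum_(i < n) (2 * Q * Theta * (2 * Q)))).
  apply: ler_sum => i _; rewrite norm2Z ler_pM ?norm2_ge0 //.
  by apply: le_trans (normr_dotv _ _) _; rewrite ler_pM ?norm2_ge0.
rewrite sumr_const card_ord -[_ *+ n]mulr_natl.
apply: (@le_trans _ _ (Z * (2 * Q * Theta * (2 * Q)))).
  by rewrite ler_wpM2r // !mulr_ge0 ?exprn_ge0 ?(ltW Z0) ?(ltW Q0).
have -> : Z * (2 * Q * Theta * (2 * Q)) = 4 * Z ^+ 81.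
  by rewrite /Q /Theta; ring.
have : Z ^+ 82 <= Z ^+ 128 by exact: Zle.
have : 64 * Z ^+ 81 <= Z ^+ 82 by rewrite [leRHS]exprS ler_wpM2r ?exprn_ge0 ?(ltW Z0).
have := Zgt0 81; slra.
Qed.

Lemma range_kappa mu c j : 3 / 8 * (l1 - l2) <= mu -> norm2 c <= Theta ->
  `|kappa mu * (M *m c) j 0| < Z ^+ 128.
Proof.
move=> hmu cT; have [mu0 imu] := muZ hmu.
have nR : 1 <= n%:R :> R by rewrite ler1n.
have n0' : 0 < n%:R :> R by slra.
have Q1 : 1 <= Q by rewrite /Q exprn_ege1.
have Q0 : 0 < Q by slra.
have k0 : 0 < kappa mu by rewrite divr_gt0 // !mulr_gt0.
rewrite normrM gtr0_norm //.
have kZ : kappa mu <= 1.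
  rewrite /kappa /kappa_of ler_pdivrMr ?mulr_gt0 // mul1r.
  have h : 2 / mu <= Q by apply: (@le_trans _ _ (Z ^+ 1)); [rewrite expr1; slra|exact: Zle].
  rewrite ler_pdivrMr // mulrC in h.
  have : mu * Q * 1 <= mu * Q * (n%:R * Q).
    have nQ1 : 1 <= n%:R * Q by exact: mulr_ege1.
    by apply: ler_wpM2l nQ1; rewrite mulr_ge0 ?(ltW mu0) ?(ltW Q0).
  by slra.
have := range_M j cT => rM.
have : kappa mu * `|(M *m c) j 0| <= 1 * (Z ^+ 128 / 4) by rewrite ler_pM ?(ltW k0).
have := Zgt0 128; slra.
Qed.

End RoundAnalysis.

(** * Elementary facts on an instance *)

Section Instance.
Variable R : realType.
Variables (c1 c2 : R) (I : instance R).
Hypothesis wf : wf_instance c1 c2 I.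

Definition active : {pred 'I_(pdim I)} :=
  [pred c | [exists i, c \in vsupp (pts (i := I) i)]].

Lemma nonzeroE i c : ((i, c) \in nonzero I) = (c \in vsupp (pts (i := I) i)).
Proof. by rewrite /nonzero finset.inE. Qed.

Lemma card_active : (#|active| <= nnz I)%N.
Proof.
apply: (@leq_trans #|[set ij.2 | ij in nonzero I]%SET|).
  apply: subset_leq_card; apply/fintype.subsetP => c; rewrite inE => /existsP[i ic].
  by apply/imsetP; exists (i, c); rewrite ?nonzeroE.
exact: leq_imset_card.
Qed.

Lemma covE : covmx I = (npts I)%:R^-1 *: gram (pts (i := I)).
Proof. by []. Qed.

Lemma cov_sym : (covmx I)^T = covmx I.
Proof. by rewrite covE linearZ /= tr_gram. Qed.

Lemma npts_gt0 : (0 < npts I)%N.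
Proof. by case: wf => /andP[h1 h2] *; lia. Qed.

Lemma dotv_cov v : dotv v (covmx I *m v) =
  (npts I)%:R^-1 * \sum_i dotv (pts (i := I) i) v ^+ 2.
Proof. by rewrite covE -scalemxAl dotvZr dotv_gram. Qed.

Lemma cov_psd v : 0 <= dotv v (covmx I *m v).
Proof.
by rewrite dotv_cov mulr_ge0 ?invr_ge0 ?ler0n // sumr_ge0 // => i _; rewrite sqr_ge0.
Qed.

Lemma lead_unit : norm2 (lead I) = 1. Proof. by case: wf => _ _ _ []. Qed.
Lemma lead_eig : covmx I *m lead I = (eigs I)`_0 *: lead I.
Proof. by case: wf => _ _ _ []. Qed.
Lemma gap_gt0 : 0 < gap I. Proof. by case: wf => _ _ _ _ []. Qed.
Lemma pts_le1 i : norm2 (pts (i := I) i) <= 1. Proof. by case: wf. Qed.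

Lemma lead_neq0 : lead I != 0.
Proof. by rewrite -norm2_eq0 lead_unit oner_eq0. Qed.

Lemma lead_dot : dotv (lead I) (lead I) = 1.
Proof. by rewrite -sqr_norm2 lead_unit expr1n. Qed.

Lemma eig0E : (eigs I)`_0 = dotv (lead I) (covmx I *m lead I).
Proof. by rewrite lead_eig dotvZr lead_dot mulr1. Qed.

Lemma eig1_bound w : dotv (lead I) w = 0 ->
  0 <= (eigs I)`_1 /\ norm2 (covmx I *m w) <= (eigs I)`_1 * norm2 w.
Proof.
case: (wf) => /andP[d1 _] _ [cp srt] _ _; apply: second_eig_bound => //.
- exact: cov_sym.
- exact: cov_psd.
- by rewrite -subr_gt0; exact: gap_gt0.
- exact: lead_eig.
- exact: lead_neq0.
Qed.

Lemma eig1_ge0 : 0 <= (eigs I)`_1.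
Proof. by have [] := @eig1_bound 0 (dotv0r _). Qed.

Lemma gap_le_eig0 : gap I <= (eigs I)`_0.
Proof. by rewrite /gap; have := eig1_ge0; lra. Qed.

Lemma dotv_pts_le1 i : dotv (pts (i := I) i) (lead I) ^+ 2 <= 1.
Proof.
have := normr_dotv (pts (i := I) i) (lead I); rewrite lead_unit mulr1 => h.
by rewrite -real_normK ?num_real // exprn_ile1 // (le_trans h) // pts_le1.
Qed.

Lemma eig0_le1 : (eigs I)`_0 <= 1.
Proof.
have n0 := npts_gt0; have nR : 0 < (npts I)%:R :> R by rewrite ltr0n.
rewrite eig0E dotv_cov ler_pdivrMl // mulr1.
rewrite -[X in _ <= X%:R]card_ord -sumr_const; apply: ler_sum => i _.
exact: dotv_pts_le1.
Qed.

(** The leading eigenvalue is the mean of the numbers [<x_i, u>^2 <= 1], in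
    which only nonzero points count, and there are at most [nnz I] of these. *)
Lemma npts_gap : (npts I)%:R * gap I <= (nnz I)%:R.
Proof.
have n0 := npts_gt0; have nR : 0 < (npts I)%:R :> R by rewrite ltr0n.
apply: (@le_trans _ _ ((npts I)%:R * (eigs I)`_0)).
  by rewrite ler_wpM2l ?ler0n // gap_le_eig0.
rewrite eig0E dotv_cov mulVKf ?gt_eqF //.
pose P : {pred 'I_(npts I)} := [pred i | [exists c, c \in vsupp (pts (i := I) i)]].
have PN : (#|P| <= nnz I)%N.
  apply: (@leq_trans #|[set ij.1 | ij in nonzero I]%SET|).
    apply: subset_leq_card; apply/fintype.subsetP => i; rewrite inE => /existsP[c ic].
    by apply/imsetP; exists (i, c); rewrite ?nonzeroE.
  exact: leq_imset_card.
apply: (@le_trans _ _ #|P|%:R); last by rewrite ler_nat.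
rewrite -sumr_const (bigID P) /= [X in _ + X]big1 ?addr0 => [|i iP].
  by apply: ler_sum => i _; exact: dotv_pts_le1.
suff -> : pts (i := I) i = 0 by rewrite dotv0l expr0n.
apply/colP => c; rewrite mxE; apply/eqP; apply: contraNT iP => h.
by apply/existsP; exists c.
Qed.

(** The multiple [l1 u = X u] of the leading eigenvector is a combination of
    the points, and [l1 > 0]. *)
Lemma lead_supp c : c \notin active -> lead I c 0 = 0.
Proof.
move=> hc; have := lead_eig => /matrixP /(_ c 0).
rewrite covE -scalemxAl gram_mul !mxE summxE big1 ?mulr0 => [|i _]; last first.
  rewrite mxE; suff -> : pts (i := I) i c 0 = 0 by rewrite mulr0.
  by apply/eqP; apply: contraNT hc => h; apply/existsP; exists i.
move/esym/eqP; rewrite mulf_eq0 => /orP[|/eqP //].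
by rewrite gt_eqF //; have := gap_le_eig0; have := gap_gt0; lra.
Qed.

Lemma nnz_gt0 : (0 < nnz I)%N.
Proof.
rewrite -(ltr0n R); apply: lt_le_trans npts_gap.
by rewrite mulr_gt0 ?gap_gt0 // ltr0n npts_gt0.
Qed.

End Instance.

(** * Anticoncentration of a random integer combination *)

Section AntiConcentration.
Variable R : realType.

Fixpoint draws (G m : nat) : seq (seq nat) :=
  if m is m'.+1 then [seq v :: w | v <- iota 0 G.+1, w <- draws G m'] else [:: [::]].

Lemma size_draws G m : size (draws G m) = (G.+1 ^ m)%N.
Proof.
elim: m => //= m IH.
by rewrite size_cat size_map size_allpairs IH size_iota expnS mulSn.
Qed.

Lemma in_draws G m w : w \in draws G m -> size w = m /\ all (fun v => v <= G)%N w.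
Proof.
elim: m w => [|m IH] w; first by rewrite inE => /eqP ->.
move=> /allpairsP[[v w'] [hv hw ->]]; have [sz aw] := IH _ hw.
by split; rewrite /= ?sz // aw andbT; move: hv; rewrite mem_iota /=; lia.
Qed.

Fixpoint lincomb (us : seq R) (w : seq nat) : R :=
  if us is u :: us' then if w is v :: w' then u * v%:R + lincomb us' w' else 0 else 0.

Definition near0 (x : R) : bool := `|x| < 1.

(** Integers [v] with [u v + c] in an interval of length 2 lie less than [2
    / |u| <= 2 k] apart. *)
Lemma count_interval (u c : R) (k n a : nat) : (0 < k)%N -> 1 <= `|u| * k%:R ->
  (count (fun v => near0 (u * v%:R + c)) (iota a n) <= 2 * k)%N.
Proof.
move=> k0 uk.
elim: n a => [//|n IH] a /=.
case: (boolP (near0 (u * a%:R + c))) => [h|_] /=; last exact: IH.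
have far : forall v, (a + 2 * k <= v)%N -> ~~ near0 (u * v%:R + c).
  move=> v hv; apply/negP; rewrite /near0 => h2; rewrite /near0 in h.
  have : `|u * v%:R - u * a%:R| < 2.
    have -> : u * v%:R - u * a%:R = (u * v%:R + c) - (u * a%:R + c) by ring.
    by apply: le_lt_trans (ler_normB _ _) _; lra.
  rewrite -mulrBr -natrB; last by lia.
  rewrite normrM normr_nat ltNge => /negP; apply.
  apply: (@le_trans _ _ (`|u| * (2 * k)%:R)); first by rewrite natrM; lra.
  by rewrite ler_wpM2l // ler_nat; lia.
have [le|gt] := leqP n (2 * k).-1.
  have := count_size (fun v => near0 (u * v%:R + c)) (iota a.+1 n); rewrite size_iota; lia.
have -> : n = ((2 * k).-1 + (n - (2 * k).-1))%N by lia.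
rewrite iotaD count_cat.
have -> : count (fun v => near0 (u * v%:R + c)) (iota (a.+1 + (2 * k).-1) (n - (2 * k).-1)) = 0%N.
  apply/eqP; rewrite -leqn0 leqNgt -has_count; apply/hasPn => v; rewrite mem_iota => hv.
  by apply: far; lia.
have := count_size (fun v => near0 (u * v%:R + c)) (iota a.+1 (2 * k).-1); rewrite size_iota; lia.
Qed.

(** Conditioned on the other draws, the coordinate where [us] is large must
    fall in an interval containing at most [2 k] integers. *)
Lemma count_draws (us : seq R) (c : R) (G k : nat) : (0 < k)%N ->
  has (fun u => 1 <= `|u| * k%:R) us ->
  (count (fun w => near0 (lincomb us w + c)) (draws G (size us))
     * G.+1 <= 2 * k * G.+1 ^ size us)%N.
Proof.
move=> k0; elim: us c => [//|u us IH] c /= /orP[uk|hus].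
  rewrite -[(_ ++ _)%SEQ]/[seq v :: w | v <- iota 0 G.+1, w <- draws G (size us)].
  (* The head coefficient is the large one: count its values for each choice of
     the other draws. *)
  have -> : count (fun w => near0 (lincomb (u :: us) w + c))
        [seq v :: w | v <- iota 0 G.+1, w <- draws G (size us)] =
      sumn [seq count (fun v => near0 (u * v%:R + (lincomb us w + c))) (iota 0 G.+1)
           | w <- draws G (size us)].
    elim: (iota 0 G.+1) => [|v s IHs] /=.
      by elim: (draws _ _).
    rewrite count_cat IHs count_map.
    elim: (draws G (size us)) => //= w l <-.
    by rewrite -(addrA (u * v%:R)) addnACA.
  have : (sumn [seq count (fun v => near0 (u * v%:R + (lincomb us w + c))) (iota 0 G.+1)
           | w <- draws G (size us)] <= 2 * k * size (draws G (size us)))%N.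
    elim: (draws G (size us)) => [|w l IHl] //=; rewrite mulnS leq_add //.
    exact: (count_interval (lincomb us w + c) G.+1 0 k0 uk).
  by rewrite size_draws expnS; nia.
rewrite -[(_ ++ _)%SEQ]/[seq v :: w | v <- iota 0 G.+1, w <- draws G (size us)].
have : (count (fun w => near0 (lincomb (u :: us) w + c))
     [seq v :: w | v <- iota 0 G.+1, w <- draws G (size us)] * G.+1 <=
     size (iota 0 G.+1) * (2 * k * G.+1 ^ size us))%N.
  elim: (iota 0 G.+1) => [//|v s IHs] /=.
  rewrite count_cat mulnDl [X in (_ <= X)%N]mulSn; apply: leq_add IHs.
  rewrite count_map; apply: leq_trans (IH (u * v%:R + c) hus).
  by rewrite leq_mul2r; apply/orP; right; apply/eq_leq/eq_count => w /=; rewrite addrCA addrA.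
by move=> h; apply: leq_trans h _; rewrite size_iota expnS mulnCA.
Qed.

End AntiConcentration.

(** * Symbolic execution with time bounds *)

Section Framework.
Variable R : realType.
Implicit Types (s : state R) (P : prog) (Q : nat -> state R -> Prop).

(** Quantifying over the continuation and the remaining time makes
    deterministic pieces of a randomized program compose by rewriting. *)
Definition runs P s t s' : Prop := forall K t',
  halts_in (t + t') (P :: K) s = halts_in t' K s' /\
  forall E, prob_in (t + t') E (P :: K) s = prob_in t' E K s'.

Lemma runs_step1 P s s' :
  (forall K, step P K s = [:: (K, s')]) -> runs P s 1 s'.
Proof.
move=> h K t'; split=> [|E]; rewrite add1n [LHS]/= h; first by rewrite /= andbT.
by rewrite big_seq1 invr1 mul1r.
Qed.

Lemma runs_skip s : runs Skip s 1 s. Proof. exact: runs_step1. Qed.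

Lemma runs_do i s s' : exec i s = [:: s'] -> runs (Do i) s 1 s'.
Proof. by move=> h; apply: runs_step1 => K; rewrite /= h. Qed.

Lemma runs_unfold P s t (L : seq prog -> seq prog) s' :
  (forall K, step P K s = [:: (L K, s)]) ->
  (forall K t', halts_in (t + t') (L K) s = halts_in t' K s' /\
     forall E, prob_in (t + t') E (L K) s = prob_in t' E K s') ->
  runs P s t.+1 s'.
Proof.
move=> h h' K t'; have [h1 h2] := h' K t'; split=> [|E]; rewrite addSn [LHS]/= h.
  by rewrite /= h1 andbT.
by rewrite big_seq1 invr1 mul1r /= h2.
Qed.

Lemma runs_seq P1 P2 s t1 t2 s1 s2 :
  runs P1 s t1 s1 -> runs P2 s1 t2 s2 -> runs (Seq P1 P2) s (t1 + t2).+1 s2.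
Proof.
move=> h1 h2; apply: (@runs_unfold _ _ _ (fun K => P1 :: P2 :: K)) => // K t'.
have [a1 b1] := h1 (P2 :: K) (t2 + t')%N; have [a2 b2] := h2 K t'.
by rewrite -addnA a1 a2; split=> // E; rewrite b1 b2.
Qed.

Lemma runs_if t P1 P2 s k s' :
  runs (if eval_test t s then P1 else P2) s k s' -> runs (If t P1 P2) s k.+1 s'.
Proof.
by move=> h; apply: (@runs_unfold _ _ _ (fun K => (if eval_test t s then P1 else P2) :: K)).
Qed.

Lemma runs_while_false t P s : ~~ eval_test t s -> runs (While t P) s 1 s.
Proof. by move=> /negbTE h; apply: runs_step1 => K; rewrite /= h. Qed.

Lemma runs_while_true t P s k1 k2 s1 s2 : eval_test t s ->
  runs P s k1 s1 -> runs (While t P) s1 k2 s2 -> runs (While t P) s (k1 + k2).+1 s2.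
Proof.
move=> h h1 h2; apply: (@runs_unfold _ _ _ (fun K => P :: While t P :: K)) => K.
  by rewrite /= h.
move=> t'; have [a1 b1] := h1 (While t P :: K) (k2 + t')%N; have [a2 b2] := h2 K t'.
by rewrite -addnA a1 a2; split=> // E; rewrite b1 b2.
Qed.

(** A total-correctness assertion in which the postcondition also sees the
    running time. *)
Definition wp P Q s : Prop := exists t s', runs P s t s' /\ Q t s'.

Lemma wp_skip Q s : Q 1%N s -> wp Skip Q s.
Proof. by move=> h; exists 1%N, s; split=> //; exact: runs_skip. Qed.

Lemma wp_do i Q s s' : exec i s = [:: s'] -> Q 1%N s' -> wp (Do i) Q s.
Proof. by move=> h q; exists 1%N, s'; split=> //; exact: runs_do. Qed.

Lemma wp_seq P1 P2 Q s :
  wp P1 (fun t1 s1 => wp P2 (fun t2 s2 => Q (t1 + t2).+1 s2) s1) s -> wp (Seq P1 P2) Q s.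
Proof.
move=> [t1 [s1 [h1 [t2 [s2 [h2 q]]]]]].
by exists (t1 + t2).+1, s2; split=> //; exact: runs_seq h1 h2.
Qed.

Lemma wp_do_seq i P Q s s' : exec i s = [:: s'] ->
  wp P (fun t => Q t.+2) s' -> wp (Seq (Do i) P) Q s.
Proof. by move=> h q; apply: wp_seq; apply: wp_do h _. Qed.

(** Variants of [wp_do_seq] whose premises receive the operands already
    looked up; without them the operands would be terms in which the current
    state occurs again and again, and symbolic execution would be
    exponential. *)
Lemma wp_const x c P Q s :
  wp P (fun t => Q t.+2) (set_nvar x c s) -> wp (Seq (Do (IConst x c)) P) Q s.
Proof. exact: wp_do_seq. Qed.
Lemma wp_nat o x y z a b P Q s : nvar s y = a -> nvar s z = b ->
  wp P (fun t => Q t.+2) (set_nvar x (eval_nat_op o a b) s) ->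
  wp (Seq (Do (INat o x y z)) P) Q s.
Proof. by move=> <- <-; exact: wp_do_seq. Qed.
Lemma wp_load x a y v P Q s : narr s a (nvar s y) = v ->
  wp P (fun t => Q t.+2) (set_nvar x v s) -> wp (Seq (Do (ILoad x a y)) P) Q s.
Proof. by move=> <-; exact: wp_do_seq. Qed.
Lemma wp_store a x y i v P Q s : nvar s x = i -> nvar s y = v ->
  wp P (fun t => Q t.+2) (set_narr a i v s) -> wp (Seq (Do (IStore a x y)) P) Q s.
Proof. by move=> <- <-; exact: wp_do_seq. Qed.
Lemma wp_ofnat r y v P Q s : nvar s y = v ->
  wp P (fun t => Q t.+2) (set_rvar r v%:R s) -> wp (Seq (Do (IOfNat r y)) P) Q s.
Proof. by move=> <-; exact: wp_do_seq. Qed.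
Lemma wp_real o r q t a b P Q s : rvar s q = a -> rvar s t = b ->
  wp P (fun t => Q t.+2) (set_rvar r (eval_real_op o a b) s) ->
  wp (Seq (Do (IReal o r q t)) P) Q s.
Proof. by move=> <- <-; exact: wp_do_seq. Qed.
Lemma wp_sqrt r q a P Q s : rvar s q = a ->
  wp P (fun t => Q t.+2) (set_rvar r (Num.sqrt a) s) -> wp (Seq (Do (ISqrt r q)) P) Q s.
Proof. by move=> <-; exact: wp_do_seq. Qed.
Lemma wp_rload r a y v P Q s : rarr s a (nvar s y) = v ->
  wp P (fun t => Q t.+2) (set_rvar r v s) -> wp (Seq (Do (IRLoad r a y)) P) Q s.
Proof. by move=> <-; exact: wp_do_seq. Qed.
Lemma wp_rstore a x r i v P Q s : nvar s x = i -> rvar s r = v ->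
  wp P (fun t => Q t.+2) (set_rarr a i v s) -> wp (Seq (Do (IRStore a x r)) P) Q s.
Proof. by move=> <- <-; exact: wp_do_seq. Qed.

Lemma wp_if t P1 P2 Q s :
  (eval_test t s -> wp P1 (fun k => Q k.+1) s) ->
  (~~ eval_test t s -> wp P2 (fun k => Q k.+1) s) -> wp (If t P1 P2) Q s.
Proof.
move=> h1 h2.
have [k [s' [h q]]] : wp (if eval_test t s then P1 else P2) (fun k => Q k.+1) s.
  by case: ifP => [/h1|/negbT/h2].
by exists k.+1, s'; split=> //; apply: runs_if.
Qed.

(** The body takes time at most [c] and runs at most [n] times. *)
Lemma wp_while t P (c n : nat) (I : nat -> state R -> Prop) Q s :
  I 0%N s ->
  (forall k s, I k s -> eval_test t s ->
     (k < n)%N /\ wp P (fun k' s' => (k' <= c)%N /\ I k.+1 s') s) ->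
  (forall k T s, (k <= n)%N -> (T <= n * c.+1 + 1)%N -> I k s -> ~~ eval_test t s -> Q T s) ->
  wp (While t P) Q s.
Proof.
move=> I0 body exit.
suff : forall r k s, (k + r = n)%N -> I k s ->
    exists T s', [/\ runs (While t P) s T s', (T <= r * c.+1 + 1)%N, ~~ eval_test t s' &
      exists2 k', (k' <= n)%N & I k' s'].
  move=> /(_ n 0%N s erefl I0) [T [s' [h1 h2 h3 [k' kn Ik]]]].
  by exists T, s'; split=> //; apply: exit Ik h3.
elim=> [|r IH] k s0 kr Ik; have [ht|ht] := boolP (eval_test t s0).
- by have [] := body _ _ Ik ht; rewrite -kr addn0 ltnn.
- exists 1%N, s0; split=> //; first exact: runs_while_false.
  by exists k => //; rewrite -kr addn0.
- have [kn [T1 [s1 [h1 [T1c Ik1]]]]] := body _ _ Ik ht.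
  have kr1 : (k.+1 + r = n)%N by rewrite addSnnS.
  have [T2 [s2 [h2 T2c ns2 ex]]] := IH _ _ kr1 Ik1.
  exists (T1 + T2).+1, s2; split=> //; first exact: runs_while_true h1 h2.
  by rewrite mulSn; lia.
- exists 1%N, s0; split=> //; first exact: runs_while_false.
  by exists k => //; rewrite -kr leq_addr.
Qed.

End Framework.

Arguments upd T f x v y /.

Ltac lookup := rewrite /=; reflexivity.
Ltac exec1 := first
  [ apply: wp_real; [lookup|lookup|] | apply: wp_nat; [lookup|lookup|]
  | apply: wp_const | apply: wp_ofnat; [lookup|] | apply: wp_sqrt; [lookup|]
  | apply: wp_load; [lookup|] | apply: wp_store; [lookup|lookup|]
  | apply: wp_rload; [lookup|] | apply: wp_rstore; [lookup|lookup|] ].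

Definition seqs : seq prog -> prog := foldr Seq Skip.

(** Names of natural variables ([n_]), real variables ([r_]), arrays of
    naturals ([a_]) and arrays of reals ([x_]). They are notations so that
    lookups in an updated state reduce. *)
Notation n_pts := 0%N (only parsing).
Notation n_nnz := 2%N (only parsing).
Notation n_e := 3%N (only parsing).
Notation n_m := 4%N (only parsing).
Notation n_col := 5%N (only parsing).
Notation n_id := 6%N (only parsing).
Notation n_one := 7%N (only parsing).
Notation n_zero := 8%N (only parsing).
Notation n_j := 9%N (only parsing).
Notation n_Z := 10%N (only parsing).
Notation n_G := 11%N (only parsing).
Notation n_flag := 12%N (only parsing).
Notation n_cst := 13%N (only parsing).

Notation r_eps := 0%N (only parsing).
Notation r_p := 1%N (only parsing).
Notation r_gap := 2%N (only parsing).
Notation r_one := 3%N (only parsing).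
Notation r_two := 4%N (only parsing).
Notation r_half := 5%N (only parsing).
Notation r_Z := 6%N (only parsing).
Notation r_log := 7%N (only parsing).
Notation r_B := 8%N (only parsing).
Notation r_beta := 9%N (only parsing).
Notation r_in := 10%N (only parsing).
Notation r_fl := 11%N (only parsing).
Notation r_bit := 12%N (only parsing).
Notation r_tmp := 13%N (only parsing).
Notation r_kd := 14%N (only parsing).
Notation r_Q := 15%N (only parsing).
Notation r_S := 16%N (only parsing).
Notation r_K := 17%N (only parsing).
Notation r_tau := 18%N (only parsing).
Notation r_n := 19%N (only parsing).
Notation r_lo := 20%N (only parsing).
Notation r_hi := 21%N (only parsing).
Notation r_mid := 22%N (only parsing).
Notation r_kappa := 23%N (only parsing).
Notation r_k := 24%N (only parsing).
Notation r_Y := 25%N (only parsing).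
Notation r_nrm := 26%N (only parsing).
Notation r_x := 27%N (only parsing).
Notation r_diff := 28%N (only parsing).
Notation r_pow := 29%N (only parsing).
Notation r_goal := 30%N (only parsing).
Notation r_zero := 31%N (only parsing).

Notation a_row := 0%N (only parsing).
Notation a_col := 1%N (only parsing).
Notation a_id := 2%N (only parsing).
Notation a_back := 3%N (only parsing).
Notation a_g := 4%N (only parsing).

Notation x_val := 0%N (only parsing).
Notation x_out := 1%N (only parsing).
Notation x_pow := 2%N (only parsing).
Notation x_int := 3%N (only parsing).
Notation x_row := 4%N (only parsing).
Notation x_gram := 5%N (only parsing).
Notation x_prev := 6%N (only parsing).
Notation x_cur := 7%N (only parsing).

(** Two states built by assignments to the same variables are equal when
    they agree variable by variable. *)
Ltac state_ext :=
  let y := fresh "y" in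
  rewrite /set_rvar /set_nvar /=; congr State; apply/funext => y; rewrite /upd /=;
  repeat match goal with |- context [eq_op y ?k] =>
    let h := fresh in case: (eqVneq y k) => [h|_]; rewrite ?h //= end.

(** * Rounding a real by bisection *)

Section Floor.
Variable R : realType.

(** No instruction truncates a real, so the integer part is found one binary
    digit at a time, starting from [- B] with [B] a power of two. *)
Definition floor_prog : prog := seqs
  [:: Do (IReal RSub r_fl r_zero r_B); Do (IReal RAdd r_bit r_B r_zero);
      While (TRealLe r_one r_bit) (seqs
        [:: Do (IReal RAdd r_tmp r_fl r_bit);
            If (TRealLe r_tmp r_in) (Do (IReal RAdd r_fl r_tmp r_zero)) Skip;
            Do (IReal RDiv r_bit r_bit r_two)])].

Definition floor_time HB := (HB.+1 * 10 + 10)%N.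

Lemma flr_unique (r a : R) : a \is a Num.int -> a <= r < a + 1 -> a = flr r.
Proof.
move=> /intrP[k ->] h; rewrite /flr; congr (_%:~R); apply/esym/floor_def.
by rewrite intrD.
Qed.

(** The invariant is [a <= in < a + 2 bit] with [a + B] a multiple of [2
    bit]. The value is asserted only for an argument in range, the time for
    every argument: halting is required also after unlucky draws, for which
    nothing bounds the numbers. *)
Lemma wp_floor (s : state R) HB Q :
  rvar s r_one = 1 -> rvar s r_two = 2 -> rvar s r_zero = 0 -> rvar s r_B = 2 ^+ HB ->
  (forall t a w1 w2, (t <= floor_time HB)%N ->
     (`|rvar s r_in| < 2 ^+ HB -> a = flr (rvar s r_in)) ->
     Q t (set_rvar r_tmp w1 (set_rvar r_bit w2 (set_rvar r_fl a s)))) ->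
  wp floor_prog Q s.
Proof.
move=> s3 s4 s31 s8 hQ.
apply: wp_do_seq; first reflexivity.
apply: wp_do_seq; first reflexivity.
apply: wp_seq.
pose I k s' := exists a w1, s' = set_rvar r_tmp w1 (set_rvar r_bit (2 ^+ HB / 2 ^+ k) (set_rvar r_fl a s))
  /\ (a + 2 ^+ HB) / (2 * (2 ^+ HB / 2 ^+ k)) \is a Num.int
  /\ (`|rvar s r_in| < 2 ^+ HB -> a <= rvar s r_in < a + 2 * (2 ^+ HB / 2 ^+ k)).
have p0 k : 0 < 2 ^+ k :> R by rewrite exprn_gt0.
have bk k : (1 <= 2 ^+ HB / 2 ^+ k :> R) = (k <= HB)%N.
  by rewrite ler_pdivlMr // mul1r ler_eXn2l // ltr1n.
apply: (wp_while (c := 9%N) (n := HB.+1) (I := I)).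
- exists (- 2 ^+ HB), (rvar s r_tmp); split.
    by state_ext; rewrite ?s8 ?s31 ?sub0r ?addr0 ?expr0 ?divr1.
  rewrite expr0 divr1 addNr mul0r; split; first exact: rpred0.
  by rewrite ltr_norml; lra.
- move=> k s' [a [w1 [-> [ai hI]]]] /=; rewrite /upd /= s3 bk => kH; split=> //.
  have bS : 2 ^+ HB / 2 ^+ k.+1 = 2 ^+ HB / 2 ^+ k / 2 :> R.
    by rewrite exprS; field; rewrite gt_eqF.
  rewrite /I bS; move: (2 ^+ HB / 2 ^+ k) (bk k) ai hI => b; rewrite kH => b1 ai hI.
  have b0 : b != 0 by rewrite gt_eqF //; lra.
  apply: wp_do_seq; first reflexivity.
  apply: wp_seq; apply: wp_if => /=; rewrite /upd /= => hr.
    apply: wp_do; first reflexivity.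
    apply: wp_do_seq; first reflexivity.
    apply: wp_skip; split=> //; exists (a + b), (a + b); split.
      by state_ext; rewrite ?s4 ?s31 ?addr0.
    split.
      have -> : (a + b + 2 ^+ HB) / (2 * (b / 2)) = (a + 2 ^+ HB) / (2 * b) * 2 + 1 by field.
      exact: rpredD (rpredM ai (natr_int _ 2)) (rpred1 _).
    by move=> /hI; lra.
  apply: wp_skip.
  apply: wp_do_seq; first reflexivity.
  apply: wp_skip; split=> //; exists a, (a + b); split.
    by state_ext; rewrite ?s4.
  split.
    have -> : (a + 2 ^+ HB) / (2 * (b / 2)) = (a + 2 ^+ HB) / (2 * b) * 2 by field.
    exact: rpredM ai (natr_int _ 2).
  by move: hr; rewrite -ltNge => hr /hI; lra.
move=> k T s' kn Tn [a [w1 [-> [ai hI]]]] /=; rewrite /upd /= s3 bk -ltnNge => kH.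
have kE : k = HB.+1 by apply/eqP; rewrite eqn_leq kn.
move: ai hI; rewrite kE exprS; have -> : 2 * (2 ^+ HB / (2 * 2 ^+ HB)) = 1 :> R.
  by field; rewrite gt_eqF.
rewrite divr1 => ai hI.
apply: wp_skip; apply: hQ; first by rewrite /floor_time; lia.
move=> /hI; apply: flr_unique.
by rewrite -(addrK (2 ^+ HB) a) rpredB // -natrX natr_int.
Qed.

End Floor.

(** * Computing the parameters *)

Section Init.
Variable R : realType.

(** The parameters of a run: size and entries of the input, the binary
    logarithm [k_log] of the scale [k_Z], and the multiple [k_kd] of the
    inverse gap estimate. *)
Record consts := Consts {
  k_n : nat; k_nnz : nat; k_row : nat -> nat; k_col : nat -> nat; k_val : nat -> R;
  k_log : nat; k_kd : R }.

Definition k_Z c : R := 2 ^+ k_log c.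
Definition k_G c := ((2 ^ k_log c) ^ 2)%N.
Definition k_HB c := (k_log c * 128)%N.
Definition k_B c : R := 2 ^+ k_HB c.
(** The number of steps after which a component growing by a factor [1 +
    sqrt (gap / 2)] per step must have passed the threshold. *)
Definition k_K c : R := 32 * (k_log c)%:R * Num.sqrt (k_kd c).

Definition has_consts (c : consts) (s : state R) : Prop :=
  nvar s n_nnz = k_nnz c /\ nvar s n_one = 1%N /\ nvar s n_zero = 0%N /\
  nvar s n_G = k_G c /\
  rvar s r_one = 1 /\ rvar s r_two = 2 /\ rvar s r_half = 2^-1 /\
  rvar s r_B = k_B c /\ rvar s r_beta = (k_B c)^-1 /\ rvar s r_Q = k_Z c ^+ 32 /\
  rvar s r_S = k_Z c ^+ 4 /\ rvar s r_K = k_K c /\ rvar s r_tau = (k_kd c)^-1 /\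
  rvar s r_n = (k_n c)%:R /\ rvar s r_zero = 0 /\
  narr s a_row = k_row c /\ narr s a_col = k_col c /\ rarr s x_val = k_val c.

Definition init_prog (kc : nat) : prog := seqs
  [:: Do (IConst n_one 1); Do (IOfNat r_one n_one);
      Do (IReal RAdd r_two r_one r_one); Do (IReal RDiv r_half r_one r_two);
      Do (IConst n_cst kc); Do (IOfNat r_tmp n_cst); Do (IReal RDiv r_kd r_tmp r_gap);
      Do (IOfNat r_n n_pts); Do (IOfNat r_x n_nnz); Do (IReal RAdd r_goal r_n r_x);
      Do (IReal RDiv r_x r_one r_eps); Do (IReal RAdd r_goal r_goal r_x);
      Do (IReal RDiv r_x r_one r_p); Do (IReal RAdd r_goal r_goal r_x);
      Do (IReal RMul r_goal r_goal r_tmp); Do (IReal RAdd r_goal r_goal r_kd);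
      Do (IConst n_Z 1); Do (IOfNat r_Z n_Z);
      While (TRealLt r_Z r_goal) (seqs
        [:: Do (INat NAdd n_Z n_Z n_Z); Do (IOfNat r_Z n_Z);
            Do (IReal RAdd r_log r_log r_one)]);
      Do (INat NMul n_G n_Z n_Z);
      Do (IReal RMul r_tmp r_Z r_Z); Do (IReal RMul r_S r_tmp r_tmp);
      Do (IReal RMul r_tmp r_S r_S); Do (IReal RMul r_tmp r_tmp r_tmp);
      Do (IReal RMul r_Q r_tmp r_tmp); Do (IReal RMul r_tmp r_Q r_Q);
      Do (IReal RMul r_B r_tmp r_tmp); Do (IReal RDiv r_beta r_one r_B);
      Do (IConst n_cst 32); Do (IOfNat r_tmp n_cst); Do (ISqrt r_K r_kd);
      Do (IReal RMul r_tmp r_tmp r_log); Do (IReal RMul r_K r_tmp r_K);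
      Do (IReal RDiv r_tau r_one r_kd)].

(** The scale must exceed this to dominate the size of the input and the
    inverses of the gap, of the accuracy and of the failure probability. *)
Definition log_goal (kc : nat) n nnz (eps p gp : R) : R :=
  (n%:R + nnz%:R + eps^-1 + p^-1) * kc%:R + kc%:R / gp.

(** Doubling stops at the first power of two above [log_goal], so that [H]
    is logarithmic in it. *)
Lemma wp_init kc (s : state R) n nnz eps p gp Q :
  nvar s n_pts = n -> nvar s n_nnz = nnz -> nvar s n_zero = 0%N ->
  rvar s r_eps = eps -> rvar s r_p = p -> rvar s r_gap = gp ->
  rvar s r_zero = 0 -> rvar s r_log = 0 ->
  (forall t H s', (t <= 8 * H + 100)%N ->
     log_goal kc n nnz eps p gp <= 2 ^+ H ->
     (H = 0%N \/ 2 ^+ H < 2 * log_goal kc n nnz eps p gp) ->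
     has_consts (Consts n nnz (narr s a_row) (narr s a_col) (rarr s x_val) H (kc%:R / gp)) s' ->
     nvar s' n_m = nvar s n_m ->
     narr s' = narr s -> rarr s' = rarr s -> Q t s') ->
  wp (init_prog kc) Q s.
Proof.
move=> sn sN sz se sp sg s0 sl hQ.
pose goal := log_goal kc n nnz eps p gp.
have [H gH Hmin] : exists2 H, goal <= 2 ^+ H & forall k, (k < H)%N -> 2 ^+ k < goal.
  have ex : exists H, goal <= 2 ^+ H.
    exists (Num.truncn goal).+1; apply: (@le_trans _ _ (Num.truncn goal).+1%:R).
      exact: ltW (truncnS_gt _).
    by rewrite -natrX ler_nat ltnW // ltn_expl.
  exists (ex_minn ex); first by case: ex_minnP.
  case: ex_minnP => m _ hm k km; rewrite ltNge; apply/negP => /hm.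
  by rewrite leqNgt km.
pose c := Consts n nnz (narr s a_row) (narr s a_col) (rarr s x_val) H (kc%:R / gp).
do 18!exec1.
apply: wp_seq.
pose J k s' := nvar s' n_Z = (2 ^ k)%N /\ rvar s' r_Z = 2 ^+ k /\ rvar s' r_log = k%:R /\
  nvar s' n_nnz = nnz /\ nvar s' n_one = 1%N /\ nvar s' n_zero = 0%N /\
  nvar s' n_m = nvar s n_m /\
  rvar s' r_one = 1 /\ rvar s' r_two = 2 /\ rvar s' r_half = 2^-1 /\
  rvar s' r_kd = kc%:R / gp /\ rvar s' r_goal = goal /\ rvar s' r_n = n%:R /\
  rvar s' r_zero = 0 /\ narr s' = narr s /\ rarr s' = rarr s.
apply: (wp_while (c := 7%N) (n := H) (I := J)).
- rewrite /J /= !sn !sN !sz !se !sp !sg !s0 !sl.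
  by rewrite /goal /log_goal !mul1r.
- move=> k s' [h1 [h2 [h3 [h4 [h5 [h6 [h7 [h8 [h9 [h10 [h11 [h12 [h13 [h14 [h15 h16]]]]]]]]]]]]]]].
  rewrite /= h2 h12 => kg; split.
    by rewrite ltnNge; apply/negP => Hk; move: kg; rewrite ltNge (le_trans gH) // ler_weXn2l // ler1n.
  do 3!exec1.
  apply: wp_skip; split=> //; rewrite /J /= h1 h3 h8.
  by rewrite addnn -mul2n -expnS natrX natr1; do !split.
move=> k T s' kH TH [h1 [h2 [h3 [h4 [h5 [h6 [h7 [h8 [h9 [h10 [h11 [h12 [h13 [h14 [h15 h16]]]]]]]]]]]]]]].
rewrite /= h2 h12 -leNgt => kg.
have kE : k = H by apply/eqP; rewrite eqn_leq kH leqNgt; apply/negP => /Hmin; rewrite ltNge kg.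
do 15!exec1.
apply: wp_skip; apply: (hQ _ H) => //.
- by rewrite -/goal; lia.
- case: H {c gH kH TH kE} Hmin => [|H'] Hmin; [by left|right].
  by rewrite exprS ltr_pM2l // Hmin.
rewrite /has_consts /= h1 h2 h3 h4 h5 h6 h8 h9 h10 h11 h13 h14 h15 h16 kE.
rewrite /k_G /k_Z /k_B /k_HB /k_K /= exprM !mul1r.
move: (2 ^+ H) => z; rewrite invf_div; do !split=> //; by [ring | congr (_ ^-1); ring].
Qed.

End Init.

(** * Packing the Gram matrix, column by column, into single reals *)

Section Preprocess.
Variable R : realType.

(** Columns holding a nonzero entry are numbered from 1 in order of first
    occurrence. Memory is initially zero, so the number 0 marks a column not
    seen yet and no loop over all [d] columns is needed. *)
Definition ids_prog : prog := seqs
  [:: Do (IReal RAdd r_pow r_one r_zero); Do (IConst n_e 0);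
      While (TNatLt n_e n_nnz) (seqs
        [:: Do (ILoad n_col a_col n_e); Do (ILoad n_id a_id n_col);
            If (TNatLe n_id n_zero) (seqs
              [:: Do (INat NAdd n_m n_m n_one); Do (IStore a_id n_col n_m);
                  Do (IStore a_back n_m n_col); Do (IReal RMul r_pow r_pow r_beta);
                  Do (IRStore x_pow n_m r_pow)]) Skip;
            Do (INat NAdd n_e n_e n_one)])].

Definition ids_ok (col : nat -> nat) (N m : nat) (idf back : nat -> nat) : Prop :=
  [/\ (m <= N)%N, forall e, (e < N)%N -> (0 < idf (col e))%N,
      forall c, (0 < idf c)%N ->
        [/\ (idf c <= m)%N, back (idf c) = c & exists2 e, (e < N)%N & col e = c] &
      forall j, (0 < j <= m)%N -> idf (back j) = j].

Lemma ids_ok_old col N m idf back :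
  ids_ok col N m idf back -> (0 < idf (col N))%N -> ids_ok col N.+1 m idf back.
Proof.
move=> [mN h1 h2 h3] hN; split=> //; first exact: leqW.
  by move=> e; rewrite ltnS leq_eqVlt => /orP[/eqP -> //|/h1].
by move=> c /h2[? ? [e eN ec]]; split=> //; exists e => //; exact: ltnW.
Qed.

Lemma ids_ok_new col N m idf back : ids_ok col N m idf back -> idf (col N) = 0%N ->
  ids_ok col N.+1 m.+1 (upd idf (col N) m.+1) (upd back m.+1 (col N)).
Proof.
move=> [mN h1 h2 h3] hN; split=> //.
- move=> e; rewrite ltnS leq_eqVlt => /orP[/eqP ->|/h1] /=; first by rewrite eqxx.
  by case: ifP.
- move=> c /=; case: eqVneq => [-> _|_ /h2[im ib [e eN ec]]].
    by rewrite leqnn eqxx; split=> //; exists N.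
  have -> : (idf c == m.+1) = false by apply/negbTE; rewrite neq_ltn ltnS im.
  by split; [exact: leqW|done|exists e => //; exact: ltnW].
move=> j /andP[j0]; rewrite leq_eqVlt => /orP[/eqP ->|jm] /=; first by rewrite !eqxx.
rewrite (ltn_eqF jm); case: eqVneq => [e|_]; last by apply: h3; rewrite j0 -ltnS.
by have := h3 j; rewrite j0 -ltnS jm e hN => /(_ isT) j0'; rewrite -j0' in j0.
Qed.

Lemma wp_ids (c : consts R) s Q :
  has_consts c s -> nvar s n_m = 0%N -> narr s a_id =1 (fun _ => 0%N) ->
  (forall t s', (t <= 30 * k_nnz c + 10)%N -> has_consts c s' ->
     ids_ok (k_col c) (k_nnz c) (nvar s' n_m) (narr s' a_id) (narr s' a_back) ->
     (forall j, (0 < j <= nvar s' n_m)%N -> rarr s' x_pow j = (k_B c)^-1 ^+ j) ->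
     (forall a, a != x_pow -> rarr s' a = rarr s a) -> Q t s') ->
  wp ids_prog Q s.
Proof.
move=> hc sm sid hQ.
have [_ [s1 [_ [_ [r1 [_ [_ [_ [_ [_ [_ [_ [_ [_ [r0 _]]]]]]]]]]]]]]] := hc.
do 2!exec1; apply: wp_seq.
pose J k s' := [/\ has_consts c s', nvar s' n_e = k, (k <= k_nnz c)%N,
  ids_ok (k_col c) k (nvar s' n_m) (narr s' a_id) (narr s' a_back) &
  [/\ rvar s' r_pow = (k_B c)^-1 ^+ nvar s' n_m,
   (forall j, (0 < j <= nvar s' n_m)%N -> rarr s' x_pow j = (k_B c)^-1 ^+ j) &
   (forall a, a != x_pow -> rarr s' a = rarr s a)]].
apply: (wp_while (c := 29%N) (n := k_nnz c) (I := J)).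
- split=> //=.
    rewrite sm; split=> // [e|j]; first by rewrite sid.
    by case: j.
  rewrite sm r1 r0 addr0; split=> // j; by case: j.
- move=> k s' [hc' ek kN ids [pw pws fr]] /=.
  have [hN [h1 [h0 [_ [_ [_ [_ [_ [hbeta [_ [_ [_ [_ [_ [_ [_ [hcol _]]]]]]]]]]]]]]]]] := hc'.
  rewrite hN => kN'; split; first by rewrite -ek.
  do 2!exec1; apply: wp_seq; apply: wp_if => /=; rewrite h0 hcol ek leqn0.
    move=> /eqP i0.
    do 5!exec1; apply: wp_skip; exec1; apply: wp_skip; split=> //.
    rewrite /J /= h1 !addn1 ek hbeta.
    split=> //; first by rewrite ek in kN'.
      exact: ids_ok_new.
    rewrite pw exprSr; split=> // [j /andP[j0]|a ax].
      rewrite leq_eqVlt => /orP[/eqP ->|jm]; first by rewrite eqxx exprSr.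
      by rewrite (ltn_eqF jm); apply: pws; rewrite j0 -ltnS.
    by rewrite (negbTE ax); apply: fr.
  rewrite -lt0n => i0; apply: wp_skip; exec1; apply: wp_skip; split=> //.
  rewrite /J /= h1 !addn1 ek; split=> //; first by rewrite ek in kN'.
  exact: ids_ok_old.
move=> k T s' kN Tn [hc' ek _ ids [pw pws fr]] /=.
have [hN _] := hc'; rewrite hN ek -leqNgt => kN'.
have kE : k = k_nnz c by apply/eqP; rewrite eqn_leq kN kN'.
apply: wp_skip; apply: hQ => //; first by lia.
by rewrite -kE.
Qed.

Record ids := Ids { i_m : nat; i_id : nat -> nat; i_back : nat -> nat; i_pow : nat -> R }.

Definition has_ids (g : ids) (s : state R) : Prop :=
  nvar s n_m = i_m g /\ narr s a_id = i_id g /\ narr s a_back = i_back g /\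
  rarr s x_pow = i_pow g.

(** The rounded point number [i] becomes the real whose base-[B] digits are
    its coordinates, at the positions given by the column numbers. *)
Definition rows_prog : prog := seqs
  [:: Do (IConst n_e 0);
      While (TNatLt n_e n_nnz) (seqs
        [:: Do (ILoad n_col a_col n_e); Do (ILoad n_id a_id n_col);
            Do (ILoad n_col a_row n_e); Do (IRLoad r_tmp x_val n_e);
            Do (IReal RMul r_in r_tmp r_Q); floor_prog; Do (IRStore x_int n_e r_fl);
            Do (IRLoad r_tmp x_pow n_id); Do (IReal RMul r_tmp r_fl r_tmp);
            Do (IRLoad r_x x_row n_col); Do (IReal RAdd r_x r_x r_tmp);
            Do (IRStore x_row n_col r_x); Do (INat NAdd n_e n_e n_one)])].

Definition entry (c : consts R) e : R := flr (k_Z c ^+ 32 * k_val c e).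

Definition row_sum (c : consts R) (g : ids) k i : R :=
  \sum_(0 <= e < k) if k_row c e == i then entry c e * i_pow g (i_id g (k_col c e)) else 0.

Lemma wp_rows (c : consts R) g s Q :
  has_consts c s -> has_ids g s -> rarr s x_row =1 (fun _ => 0) ->
  (forall e, (e < k_nnz c)%N -> `|k_Z c ^+ 32 * k_val c e| < k_B c) ->
  (forall t s', (t <= (floor_time (k_HB c) + 40) * k_nnz c + 10)%N ->
     has_consts c s' -> has_ids g s' ->
     (forall e, (e < k_nnz c)%N -> rarr s' x_int e = entry c e) ->
     (forall i, rarr s' x_row i = row_sum c g (k_nnz c) i) ->
     (forall a, a != x_int -> a != x_row -> rarr s' a = rarr s a) -> Q t s') ->
  wp rows_prog Q s.
Proof.
move=> hc hg sr hv hQ.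
exec1; apply: wp_seq.
pose J k s' := [/\ has_consts c s', has_ids g s', nvar s' n_e = k &
  [/\ forall e, (e < k)%N -> rarr s' x_int e = entry c e,
   forall i, rarr s' x_row i = row_sum c g k i &
   (forall a, a != x_int -> a != x_row -> rarr s' a = rarr s a)]].
apply: (wp_while (c := (floor_time (k_HB c) + 39)%N) (n := k_nnz c) (I := J)).
- split=> //; split=> // i; by rewrite /row_sum big_geq //= sr.
- move=> k s' [hc' hg' ek [hx hr fr]] /=.
  have [hN [h1 [h0 [_ [r1 [r2 [_ [rB [_ [rQ [_ [_ [_ [_ [r0 [hrow [hcol hval]]]]]]]]]]]]]]]]] := hc'.
  have [hm [hid [hback hpow]]] := hg'.
  rewrite hN ek => kN; split=> //.
  do 5!exec1; apply: wp_seq; apply: (wp_floor (HB := k_HB c)) => //= t a w1 w2 tle ha.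
  have {ha} aE : a = entry c k by rewrite ha /entry hval ek rQ mulrC // hv.
  do 7!exec1; apply: wp_skip; split; first by lia.
  split; [exact: hc'|exact: hg'|by rewrite /= ek h1 addn1|rewrite /= ek; split].
  + move=> e; rewrite ltnS leq_eqVlt => /orP[/eqP ->|ek']; first by rewrite eqxx.
    by rewrite (ltn_eqF ek') hx.
  + move=> i; rewrite /row_sum big_nat_recr //= -/(row_sum c g k i) hrow eq_sym.
    case: eqVneq => [<-|_]; last by rewrite addr0 hr.
    by rewrite hr aE hpow hid hcol.
  + by move=> b bi br; rewrite (negbTE bi) (negbTE br); apply: fr.
move=> k T s' kN Tn [hc' hg' ek [hx hr fr]] /=.
have [hN _] := hc'; rewrite hN ek -leqNgt => kN'.
have kE : k = k_nnz c by apply/eqP; rewrite eqn_leq kN kN'.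
apply: wp_skip; apply: hQ => //; rewrite -?kE //.
by move: Tn; rewrite -kE; move: (floor_time _) => f; nia.
Qed.

(** Column [j] of the Gram matrix is the sum of the points weighted by their
    [j]-th coordinates. With packed points this costs one multiplication and
    one addition per nonzero entry, although the matrix may have many more
    entries. *)
Definition gram_prog : prog := seqs
  [:: Do (IConst n_e 0);
      While (TNatLt n_e n_nnz) (seqs
        [:: Do (ILoad n_col a_col n_e); Do (ILoad n_id a_id n_col);
            Do (ILoad n_col a_row n_e); Do (IRLoad r_tmp x_int n_e);
            Do (IRLoad r_x x_row n_col); Do (IReal RMul r_x r_tmp r_x);
            Do (IRLoad r_tmp x_gram n_id); Do (IReal RAdd r_x r_tmp r_x);
            Do (IRStore x_gram n_id r_x); Do (INat NAdd n_e n_e n_one)])].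

Definition gram_sum (c : consts R) (g : ids) k j : R :=
  \sum_(0 <= e < k)
    if i_id g (k_col c e) == j then entry c e * row_sum c g (k_nnz c) (k_row c e) else 0.

Lemma wp_gram (c : consts R) g s Q :
  has_consts c s -> has_ids g s -> rarr s x_gram =1 (fun _ => 0) ->
  (forall e, (e < k_nnz c)%N -> rarr s x_int e = entry c e) ->
  (forall i, rarr s x_row i = row_sum c g (k_nnz c) i) ->
  (forall t s', (t <= 40 * k_nnz c + 10)%N ->
     has_consts c s' -> has_ids g s' ->
     (forall j, rarr s' x_gram j = gram_sum c g (k_nnz c) j) ->
     (forall a, a != x_gram -> rarr s' a = rarr s a) -> Q t s') ->
  wp gram_prog Q s.
Proof.
move=> hc hg sg hx hr hQ.
exec1; apply: wp_seq.
pose J k s' := [/\ has_consts c s', has_ids g s', nvar s' n_e = k &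
   forall j, rarr s' x_gram j = gram_sum c g k j] /\
   (forall a, a != x_gram -> rarr s' a = rarr s a).
apply: (wp_while (c := 39%N) (n := k_nnz c) (I := J)).
- by split=> //; split=> // i; rewrite /gram_sum big_geq //= sg.
- move=> k s' [[hc' hg' ek hj] fr] /=.
  have [hN [h1 [h0 [_ [r1 [r2 [_ [rB [_ [rQ [_ [_ [_ [_ [r0 [hrow [hcol hval]]]]]]]]]]]]]]]]] := hc'.
  have [hm [hid [hback hpow]]] := hg'.
  rewrite hN ek => kN; split=> //.
  do 10!exec1; apply: wp_skip; split=> //.
  split; last by move=> b bi; rewrite /= (negbTE bi); apply: fr.
  rewrite /= ek h1 addn1; split=> // j.
  rewrite /gram_sum big_nat_recr //= -/(gram_sum c g k j) hid hcol eq_sym.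
  case: eqVneq => [<-|_]; last by rewrite addr0 hj.
  by rewrite hj hrow !fr // hx // hr.
move=> k T s' kN Tn [[hc' hg' ek hj] fr] /=.
have [hN _] := hc'; rewrite hN ek -leqNgt => kN'.
have kE : k = k_nnz c by apply/eqP; rewrite eqn_leq kN kN'.
by apply: wp_skip; apply: hQ => //; rewrite -?kE //; lia.
Qed.

End Preprocess.

(** * The random start *)

Section Random.
Variable R : realType.
Implicit Types (s : state R) (w : seq nat).

Definition rand_store : prog :=
  seqs [:: Do (IStore a_g n_j n_id); Do (INat NAdd n_j n_j n_one)].

Definition rand_loop : prog :=
  While (TNatLe n_j n_m) (Seq (Do (IRand n_id n_G)) rand_store).

Definition rand_body s v : state R :=
  set_nvar n_j (nvar s n_j + nvar s n_one)%N
    (set_narr a_g (nvar s n_j) v (set_nvar n_id v s)).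

Definition rand_final s w : state R := foldl rand_body s w.

Lemma rand_tail s v :
  runs rand_store
    (set_nvar n_id v s) 5 (rand_body s v).
Proof.
apply: (@runs_seq _ _ _ _ 1 3); first exact: runs_do.
by apply: (@runs_seq _ _ _ _ 1 1); [exact: runs_do|exact: runs_skip].
Qed.

Lemma halts_step1 t P K K' s s' : step P K s = [:: (K', s')] ->
  halts_in t.+1 (P :: K) s = halts_in t K' s'.
Proof. by move=> h; rewrite [LHS]/= h /= andbT. Qed.

Lemma prob_step1 t P K K' s s' E : step P K s = [:: (K', s')] ->
  prob_in t.+1 E (P :: K) s = prob_in t E K' s'.
Proof. by move=> h; rewrite [LHS]/= h big_seq1 invr1 mul1r. Qed.

Lemma halts_draw t x y K s :
  halts_in t.+1 (Do (IRand x y) :: K) s =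
  all (fun v => halts_in t K (set_nvar x v s)) (iota 0 (nvar s y).+1).
Proof.
rewrite -[LHS]/(all (fun c => halts_in t c.1 c.2)
  [seq (K, s') | s' <- [seq set_nvar x v s | v <- iota 0 (nvar s y).+1]]).
by rewrite !all_map.
Qed.

Lemma prob_draw t x y K s E :
  prob_in t.+1 E (Do (IRand x y) :: K) s =
  (nvar s y).+1%:R^-1 * \sum_(v <- iota 0 (nvar s y).+1) prob_in t E K (set_nvar x v s).
Proof.
rewrite -[LHS]/((size [seq (K, s') | s' <- [seq set_nvar x v s | v <- iota 0 (nvar s y).+1]])%:R^-1 *
  \sum_(c <- [seq (K, s') | s' <- [seq set_nvar x v s | v <- iota 0 (nvar s y).+1]]) prob_in t E c.1 c.2).
by rewrite !size_map size_iota !big_map.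
Qed.

Lemma rand_halts t K s r : nvar s n_one = 1%N -> (nvar s n_j + r = (nvar s n_m).+1)%N ->
  (forall w, w \in draws (nvar s n_G) r -> halts_in t K (rand_final s w)) ->
  halts_in (8 * r + 1 + t) (rand_loop :: K) s.
Proof.
elim: r s => [|r IH] s s1 hr hw.
  have h : ~~ eval_test (TNatLe n_j n_m) s by rewrite /= -ltnNge -hr addn0.
  have [-> _] := runs_while_false (Seq (Do (IRand n_id n_G)) rand_store) h K t.
  by apply: (hw [::]); rewrite inE.
have jm : (nvar s n_j <= nvar s n_m)%N by rewrite -ltnS -hr -addSnnS leq_addr.
have -> : (8 * r.+1 + 1 + t = (5 + (8 * r + 1 + t)).+3)%N by lia.
rewrite (@halts_step1 _ _ _ (Seq (Do (IRand n_id n_G)) rand_store :: rand_loop :: K) _ s);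
  last by rewrite /= jm.
rewrite (@halts_step1 _ _ _ (Do (IRand n_id n_G) :: rand_store :: rand_loop :: K) _ s) //.
rewrite halts_draw; apply/allP => v hv.
have [h _] := rand_tail s v (rand_loop :: K) (8 * r + 1 + t).
rewrite [X in is_true X](h : _ = _); apply: IH => //=.
  by rewrite s1 -addnA add1n.
move=> w hw'; apply: (hw (v :: w)).
by apply/allpairsP; exists (v, w).
Qed.

Lemma rand_prob t E K s r : nvar s n_one = 1%N -> (nvar s n_j + r = (nvar s n_m).+1)%N ->
  prob_in (8 * r + 1 + t) E (rand_loop :: K) s =
  ((nvar s n_G).+1 ^ r)%:R^-1 *
    \sum_(w <- draws (nvar s n_G) r) prob_in t E K (rand_final s w).
Proof.
elim: r s => [|r IH] s s1 hr.
  have h : ~~ eval_test (TNatLe n_j n_m) s by rewrite /= -ltnNge -hr addn0.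
  have [_ ->] := runs_while_false (Seq (Do (IRand n_id n_G)) rand_store) h K t.
  by rewrite expn0 invr1 mul1r big_seq1.
have jm : (nvar s n_j <= nvar s n_m)%N by rewrite -ltnS -hr -addSnnS leq_addr.
have -> : (8 * r.+1 + 1 + t = (5 + (8 * r + 1 + t)).+3)%N by lia.
rewrite (@prob_step1 _ _ _ (Seq (Do (IRand n_id n_G)) rand_store :: rand_loop :: K) _ s);
  last by rewrite /= jm.
rewrite (@prob_step1 _ _ _ (Do (IRand n_id n_G) :: rand_store :: rand_loop :: K) _ s) //.
rewrite prob_draw big_allpairs_dep.
rewrite expnS natrM invfM -mulrA; congr (_ * _).
rewrite mulr_sumr; apply: eq_bigr => v _.
have [_ h] := rand_tail s v (rand_loop :: K) (8 * r + 1 + t).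
rewrite [LHS](h E : _ = _) IH //=.
by rewrite s1 -addnA add1n.
Qed.

Lemma rand_final_inv (P : state R -> Prop) s w :
  (forall s' v, P s' -> P (rand_body s' v)) -> P s -> P (rand_final s w).
Proof.
by move=> h; elim: w s => [//|v w IH] s Ps; apply: IH; exact: h.
Qed.

Lemma rand_final_g s w : nvar s n_one = 1%N ->
  (forall i, (i < size w)%N ->
     narr (rand_final s w) a_g (nvar s n_j + i)%N = nth 0%N w i) /\
  (forall k, (k < nvar s n_j)%N -> narr (rand_final s w) a_g k = narr s a_g k).
Proof.
elim: w s => [//|v w IH] s s1.
have [//|h1 h2] := IH (rand_body s v).
have e : (nvar s n_j + 1)%N = (nvar s n_j).+1 by rewrite addn1.
rewrite /= s1 e in h1 h2.
split=> [[|i] hi|k hk] /=.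
- by rewrite addn0 h2 // eqxx.
- by rewrite -addSnnS h1.
- by rewrite h2 ?(ltn_eqF hk) // ltnW.
Qed.

End Random.

(** * One step of the recurrence on packed vectors *)

(** Proves that registers outside a list are unchanged, given [fr] saying so
    for an earlier state. *)
Ltac frame_tac fr :=
  let r := fresh "r" in let rL := fresh "rL" in
  move=> r rL; rewrite -(fr r rL); move: rL; rewrite !inE /=;
  do ?[case: (r == _) => //].

Ltac frame0_tac :=
  let r := fresh "r" in move=> r; rewrite !inE /=; do ?[case: (r == _) => //].

Section Loop.
Variable R : realType.
Variables (c : consts R) (g : ids R) (gr : nat -> R) (gd : nat -> nat).

Let m := i_m g.
Let B := k_B c.

(** What stays constant during the search: the parameters, the column
    numbering, the packed Gram matrix [gr] and the random start [gd]. *)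
Definition has_main (s : state R) : Prop :=
  has_consts c s /\ has_ids g s /\ rarr s x_gram = gr /\ narr s a_g = gd.

Lemma main_one s : has_main s -> nvar s n_one = 1%N.
Proof. by move=> [[_ [h _]] _]. Qed.
Lemma main_zero s : has_main s -> nvar s n_zero = 0%N.
Proof. by move=> [[_ [_ [h _]]] _]. Qed.
Lemma main_m s : has_main s -> nvar s n_m = m.
Proof. by move=> [_ [[h _] _]]. Qed.
Lemma main_back s : has_main s -> narr s a_back = i_back g.
Proof. by move=> [_ [[_ [_ [h _]]] _]]. Qed.
Lemma main_gram s : has_main s -> rarr s x_gram = gr.
Proof. by move=> [_ [_ [h _]]]. Qed.
Lemma main_g s : has_main s -> narr s a_g = gd.
Proof. by move=> [_ [_ [_ h]]]. Qed.
Lemma main_reals s : has_main s ->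
  [/\ rvar s r_one = 1, rvar s r_two = 2, rvar s r_half = 2^-1, rvar s r_B = B &
   [/\ rvar s r_Q = k_Z c ^+ 32, rvar s r_S = k_Z c ^+ 4, rvar s r_K = k_K c,
       rvar s r_tau = (k_kd c)^-1 & rvar s r_n = (k_n c)%:R /\ rvar s r_zero = 0]].
Proof.
by move=> [[_ [_ [_ [_ [? [? [? [? [_ [? [? [? [? [? [? _]]]]]]]]]]]]]]] _].
Qed.

Definition reset_prog : prog := seqs
  [:: Do (IConst n_j 1);
      While (TNatLe n_j n_m) (seqs
        [:: Do (ILoad n_id a_g n_j); Do (IOfNat r_x n_id); Do (IReal RMul r_x r_S r_x);
            Do (IRStore x_cur n_j r_x); Do (IRStore x_prev n_j r_zero);
            Do (INat NAdd n_j n_j n_one)])].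

Lemma wp_reset s Q : has_main s ->
  (forall t s', (t <= 20 * m + 10)%N -> has_main s' ->
     (forall j, (0 < j <= m)%N ->
        rarr s' x_prev j = 0 /\ rarr s' x_cur j = k_Z c ^+ 4 * (gd j)%:R) ->
     rarr s' x_out = rarr s x_out ->
     (forall r, r \notin [:: r_x] -> rvar s' r = rvar s r) -> Q t s') ->
  wp reset_prog Q s.
Proof.
move=> hs hQ; exec1; apply: wp_seq.
pose J k s' := [/\ has_main s', nvar s' n_j = k.+1,
  (forall j, (0 < j <= k)%N ->
        rarr s' x_prev j = 0 /\ rarr s' x_cur j = k_Z c ^+ 4 * (gd j)%:R),
  rarr s' x_out = rarr s x_out &
  (forall r, r \notin [:: r_x] -> rvar s' r = rvar s r)].
apply: (wp_while (c := 19%N) (n := m) (I := J)).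
- by split=> //; case.
- move=> k s' [hs' jk hj ho fr].
  rewrite [eval_test _ _]/= (main_m hs') jk => km; split=> //.
  have [_ _ _ _ [_ rS _ _ [_ r0]]] := main_reals hs'.
  do 6!exec1; apply: wp_skip; split=> //; split.
  + exact: hs'.
  + by rewrite /= (main_one hs') jk addn1.
  + move=> j /andP[j0]; rewrite /= jk leq_eqVlt => /orP[/eqP ->|jk'].
      by rewrite eqxx r0 rS (main_g hs').
    by rewrite (ltn_eqF jk'); apply: hj; rewrite j0 -ltnS.
  + exact: ho.
  + frame_tac fr.
move=> k T s' km TB [hs' jk hj ho fr].
rewrite [eval_test _ _]/= (main_m hs') jk -leqNgt => mk.
have kE : k = m by apply/eqP; rewrite eqn_leq km mk.
apply: wp_skip; apply: hQ => //; first by lia.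
by rewrite -kE.
Qed.

(** The packed product of the Gram matrix with the current vector. *)
Definition pack_prog : prog := seqs
  [:: Do (IReal RAdd r_Y r_zero r_zero); Do (IConst n_j 1);
      While (TNatLe n_j n_m) (seqs
        [:: Do (IRLoad r_x x_cur n_j); Do (IRLoad r_tmp x_gram n_j);
            Do (IReal RMul r_x r_tmp r_x); Do (IReal RAdd r_Y r_Y r_x);
            Do (INat NAdd n_j n_j n_one)])].

Lemma wp_pack s Q : has_main s ->
  (forall t s', (t <= 20 * m + 10)%N -> has_main s' ->
     rvar s' r_Y = \sum_(1 <= j < m.+1) gr j * rarr s x_cur j ->
     rarr s' = rarr s -> nvar s' n_flag = nvar s n_flag ->
     (forall r, r \notin [:: r_x; r_tmp; r_Y] -> rvar s' r = rvar s r) -> Q t s') ->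
  wp pack_prog Q s.
Proof.
move=> hs hQ; do 2!exec1; apply: wp_seq.
have [_ _ _ _ [_ _ _ _ [_ r0]]] := main_reals hs.
pose J k s' := [/\ has_main s', nvar s' n_j = k.+1,
  rvar s' r_Y = \sum_(1 <= j < k.+1) gr j * rarr s x_cur j,
  rarr s' = rarr s /\ nvar s' n_flag = nvar s n_flag &
  (forall r, r \notin [:: r_x; r_tmp; r_Y] -> rvar s' r = rvar s r)].
apply: (wp_while (c := 19%N) (n := m) (I := J)).
- split=> //; first by rewrite big_geq //= r0 addr0.
  frame0_tac.
- move=> k s' [hs' jk hY [ha hf] fr].
  rewrite [eval_test _ _]/= (main_m hs') jk => km; split=> //.
  do 5!exec1; apply: wp_skip; split=> //; split.
  + exact: hs'.
  + by rewrite /= (main_one hs') jk addn1.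
  + rewrite /= jk hY (main_gram hs') ha [RHS]big_nat_recr //=.
  + by split; [exact: ha|exact: hf].
  + frame_tac fr.
move=> k T s' km TB [hs' jk hY [ha hf] fr].
rewrite [eval_test _ _]/= (main_m hs') jk -leqNgt => mk.
have kE : k = m by apply/eqP; rewrite eqn_leq km mk.
apply: wp_skip; apply: hQ => //; first by lia.
by rewrite hY kE.
Qed.

(** Shifting the packed product by one digit exposes the next coordinate,
    which is then scaled, rounded and combined with the previous iterate. *)
Definition unpack_prog : prog := seqs
  [:: Do (IReal RAdd r_nrm r_zero r_zero); Do (IConst n_j 1);
      While (TNatLe n_j n_m) (seqs
        [:: Do (IReal RMul r_Y r_Y r_B); Do (IReal RAdd r_in r_Y r_half); floor_prog;
            Do (IReal RSub r_Y r_Y r_fl); Do (IReal RMul r_in r_kappa r_fl); floor_prog;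
            Do (IRLoad r_x x_prev n_j); Do (IReal RSub r_x r_fl r_x);
            Do (IRLoad r_tmp x_cur n_j); Do (IRStore x_prev n_j r_tmp);
            Do (IRStore x_cur n_j r_x); Do (IReal RMul r_x r_x r_x);
            Do (IReal RAdd r_nrm r_nrm r_x); Do (INat NAdd n_j n_j n_one)])].

(** Digits may be negative; they are determined by the number because they
    are at most [B / 4] in absolute value. *)
Definition digits (y : nat -> R) a : R := \sum_(a <= j < m.+1) y j * B^-1 ^+ (j - a).+1.

Lemma digitsS y a : (a <= m)%N -> digits y a = B^-1 * (y a + digits y a.+1).
Proof.
move=> am; rewrite /digits big_ltn // subnn expr1 mulrDr mulrC; congr (_ + _).
rewrite mulr_sumr; apply: eq_big_nat => j /andP[aj _].
have -> : (j - a = (j - a.+1).+1)%N by lia.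
by rewrite exprS mulrCA.
Qed.

Lemma digits_shift y a : B != 0 -> (a <= m)%N -> digits y a * B = y a + digits y a.+1.
Proof. by move=> B0 am; rewrite digitsS // mulrC mulVKf. Qed.

Lemma digits_small y a : 4 <= B -> (forall j, (0 < j <= m)%N -> `|y j| <= B / 4) ->
  (0 < a)%N -> `|digits y a| <= 3^-1.
Proof.
move=> B4 hy; have B0 : 0 < B by lra.
have [n] := ubnP (m.+1 - a); elim: n a => [//|n IH] a an a0.
have [am|ma] := leqP a m; last by rewrite /digits big_geq // normr0 invr_ge0.
rewrite digitsS // normrM ger0_norm ?invr_ge0 ?(ltW B0) // ler_pdivrMl //.
have h1 := hy a; rewrite a0 am in h1; have {}h1 := h1 isT.
have h2 : `|digits y a.+1| <= 3^-1 by apply: IH => //; lia.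
by apply: le_trans (ler_normD _ _) _; lra.
Qed.

(** The later digits contribute at most 1/3, so that rounding to the nearest
    integer recovers the leading one. *)
Lemma digits_floor y a : 4 <= B -> (forall j, (0 < j <= m)%N -> `|y j| <= B / 4) ->
  (forall j, (0 < j <= m)%N -> y j \is a Num.int) -> (0 < a <= m)%N ->
  flr (digits y a * B + 2^-1) = y a /\ `|digits y a * B + 2^-1| < B.
Proof.
move=> B4 hy hi /andP[a0 am]; have B0 : B != 0 by rewrite gt_eqF //; lra.
rewrite (digits_shift y B0 am).
have h2 : `|digits y a.+1| <= 3^-1 by apply: digits_small.
have h1 := hy a; rewrite a0 am in h1; have {}h1 := h1 isT.
move: h2; rewrite ler_norml => /andP[h2 h3].
split; first by apply/esym/flr_unique; [apply: hi; rewrite a0 am|lra].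
by move: h1; rewrite ler_norml ltr_norml; lra.
Qed.

Definition nsq (v : nat -> R) : R := \sum_(1 <= j < m.+1) v j ^+ 2.

(** The values are only meaningful when [ok] holds, that is, when no digit
    overflows; time and frame conditions hold regardless. *)
Lemma wp_unpack s y (ok : Prop) Q : has_main s -> 4 <= B ->
  rvar s r_Y = digits y 1 ->
  (ok -> forall j, (0 < j <= m)%N ->
     [/\ y j \is a Num.int, `|y j| <= B / 4 & `|rvar s r_kappa * y j| < B]) ->
  (forall t s', (t <= (2 * floor_time (k_HB c) + 40) * m + 10)%N -> has_main s' ->
     (ok -> forall j, (0 < j <= m)%N -> rarr s' x_prev j = rarr s x_cur j /\
        rarr s' x_cur j = flr (rvar s r_kappa * y j) - rarr s x_prev j) ->
     rvar s' r_nrm = nsq (rarr s' x_cur) ->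
     rarr s' x_out = rarr s x_out -> nvar s' n_flag = nvar s n_flag ->
     (forall r, r \notin [:: r_Y; r_in; r_fl; r_bit; r_tmp; r_x; r_nrm] ->
        rvar s' r = rvar s r) -> Q t s') ->
  wp unpack_prog Q s.
Proof.
move=> hs B4 hY hok hQ; do 2!exec1; apply: wp_seq.
have B0 : B != 0 by rewrite gt_eqF //; lra.
have [_ _ _ _ [_ _ _ _ [_ r0]]] := main_reals hs.
pose J k s' := [/\ has_main s', nvar s' n_j = k.+1,
  (ok -> rvar s' r_Y = digits y k.+1 /\
     forall j, (0 < j)%N ->
       rarr s' x_prev j = (if (j <= k)%N then rarr s x_cur j else rarr s x_prev j) /\
       rarr s' x_cur j = (if (j <= k)%N then flr (rvar s r_kappa * y j) - rarr s x_prev j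
                           else rarr s x_cur j)),
  rvar s' r_nrm = \sum_(1 <= j < k.+1) rarr s' x_cur j ^+ 2 &
  [/\ rarr s' x_out = rarr s x_out, nvar s' n_flag = nvar s n_flag &
  (forall r, r \notin [:: r_Y; r_in; r_fl; r_bit; r_tmp; r_x; r_nrm] ->
        rvar s' r = rvar s r)]].
apply: (wp_while (c := (2 * floor_time (k_HB c) + 39)%N) (n := m) (I := J)).
- split=> //.
  + by move=> _; split=> // j j0; rewrite leqNgt j0.
  + by rewrite big_geq //= r0 addr0.
  split=> //.
  frame0_tac.
- move=> k s' [hs' jk hj hn [ho hf fr]].
  rewrite [eval_test _ _]/= (main_m hs') jk => km; split=> //.
  have [r1 r2 rh rB [_ _ _ _ [_ rz]]] := main_reals hs'.
  have kap : rvar s' r_kappa = rvar s r_kappa by exact: fr.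
  have km' : (0 < k.+1 <= m)%N by [].
  do 2!exec1; apply: wp_seq; apply: (wp_floor (HB := k_HB c)); [exact: r1|exact: r2|exact: rz|exact: rB|].
  move=> t1 a w1 w2 t1le ha.
  have {ha} aE : ok -> a = y k.+1.
    move=> hk; have [hYk _] := hj hk.
    have [f1 f2] : flr (digits y k.+1 * B + 2^-1) = y k.+1 /\ `|digits y k.+1 * B + 2^-1| < B.
      by apply: digits_floor => // j /(hok hk)[].
    by move: ha; rewrite /= hYk rh -/(k_B c) rB f1 => ->.
  do 2!exec1; apply: wp_seq; apply: (wp_floor (HB := k_HB c)); [exact: r1|exact: r2|exact: rz|exact: rB|].
  move=> t2 b w3 w4 t2le hb.
  have {hb} bE : ok -> b = flr (rvar s r_kappa * y k.+1).
    move=> hk; have [_ _ hkap] := hok hk _ km'.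
    by move: hb; rewrite /= kap (aE hk) => /(_ hkap).
  do 8!exec1; apply: wp_skip; split; first by lia.
  split.
  + exact: hs'.
  + by rewrite /= (main_one hs') jk addn1.
  + move=> hk; have [hYk hjk] := hj hk; split=> [|j j0].
      by rewrite /= (aE hk) hYk rB (digits_shift y B0 km) addrC addKr.
    have [e1 e2] := hjk _ j0.
    rewrite /= jk; case: (ltngtP j k.+1) => [lt|gt|->].
    * by rewrite e1 e2 -ltnS lt.
    * by rewrite e1 e2 leqNgt (ltnW gt).
    * by have [-> ->] := hjk k.+1 isT; rewrite ltnn (bE hk).
  + rewrite /= jk hn [RHS]big_nat_recr //= eqxx -expr2; congr (_ + _).
    by apply: eq_big_nat => j /andP[_ jk']; rewrite (ltn_eqF jk').
  + split; [exact: ho|exact: hf|].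
    frame_tac fr.
move=> k T s' km TB [hs' jk hj hn [ho hf fr]].
rewrite [eval_test _ _]/= (main_m hs') jk -leqNgt => mk.
have kE : k = m by apply/eqP; rewrite eqn_leq km mk.
apply: wp_skip; apply: hQ => //.
- by move: TB; move: (floor_time _) => f; nia.
- move=> hk j /andP[j0 jm]; have [_ hjk] := hj hk; have [] := hjk _ j0.
  by rewrite kE jm.
- by rewrite hn kE.
Qed.

End Loop.

(** * Bisection on the shift *)

Section Search.
Variable R : realType.
Variables (c : consts R) (g : ids R) (gr : nat -> R) (gd : nat -> nat).

Let m := i_m g.
Let B := k_B c.
Let Th := k_Z c ^+ 32.
Let main := has_main c g gr gd.

(** Stores the normalized iterate and ends the round by setting the step
    counter to its limit. *)
Definition exceed_prog : prog := seqs
  [:: Do (INat NAdd n_flag n_one n_zero); Do (IReal RAdd r_k r_K r_zero);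
      Do (ISqrt r_x r_nrm); Do (IConst n_j 1);
      While (TNatLe n_j n_m) (seqs
        [:: Do (IRLoad r_tmp x_cur n_j); Do (IReal RDiv r_tmp r_tmp r_x);
            Do (ILoad n_col a_back n_j); Do (IRStore x_out n_col r_tmp);
            Do (INat NAdd n_j n_j n_one)])].

Definition ids_inv : Prop :=
  (forall j, (0 < j <= m)%N -> i_id g (i_back g j) = j) /\
  (forall a, (0 < i_id g a)%N -> (i_id g a <= m)%N /\ i_back g (i_id g a) = a).

Lemma wp_exceed s Q : main s -> ids_inv ->
  (forall t s', (t <= 20 * m + 20)%N -> main s' -> nvar s' n_flag = 1%N ->
     rvar s' r_k = k_K c ->
     (forall a, rarr s' x_out a =
        if (0 < i_id g a)%N then rarr s x_cur (i_id g a) / Num.sqrt (rvar s r_nrm)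
        else rarr s x_out a) ->
     (forall r, r \notin [:: r_k; r_x; r_tmp] -> rvar s' r = rvar s r) -> Q t s') ->
  wp exceed_prog Q s.
Proof.
move=> hs [hid hbk] hQ; do 4!exec1; apply: wp_seq.
have [_ _ _ _ [_ _ rK _ [_ r0]]] := main_reals hs.
pose J k s' := [/\ main s', nvar s' n_j = k.+1,
  [/\ nvar s' n_flag = 1%N, rvar s' r_k = k_K c, rvar s' r_x = Num.sqrt (rvar s r_nrm) &
      rarr s' x_cur = rarr s x_cur],
  (forall a, rarr s' x_out a =
        if (0 < i_id g a <= k)%N then rarr s x_cur (i_id g a) / Num.sqrt (rvar s r_nrm)
        else rarr s x_out a) &
  (forall r, r \notin [:: r_k; r_x; r_tmp] -> rvar s' r = rvar s r)].
apply: (wp_while (c := 19%N) (n := m) (I := J)).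
- split=> //.
  + by split=> //=; rewrite ?(main_one hs) ?(main_zero hs) ?rK ?r0 ?addr0.
  + by move=> a; case: (i_id g a).
  + by move=> r; rewrite !inE /=; do ?[case: (r == _) => //].
- move=> k s' [hs' jk [hf hk hx hc] ho fr].
  rewrite [eval_test _ _]/= (main_m hs') jk => km; split=> //.
  do 5!exec1; apply: wp_skip; split=> //; split.
  + exact: hs'.
  + by rewrite /= (main_one hs') jk addn1.
  + by split; [exact: hf|exact: hk|exact: hx|exact: hc].
  + move=> a; rewrite /= jk (main_back hs') hx hc.
    have [->|na] := eqVneq a (i_back g k.+1); first by rewrite hid // leqnn.
    rewrite ho; have [e|ne] := eqVneq (i_id g a) k.+1.
      by case/eqP: na; rewrite -e; have [|_ ->] := hbk a; rewrite ?e.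
    by rewrite [in RHS](leq_eqVlt _ k.+1) (negbTE ne) ltnS.
  + frame_tac fr.
move=> k T s' km TB [hs' jk [hf hk hx hc] ho fr].
rewrite [eval_test _ _]/= (main_m hs') jk -leqNgt => mk.
have kE : k = m by apply/eqP; rewrite eqn_leq km mk.
apply: wp_skip; apply: hQ => //; first by lia.
move=> a; rewrite ho kE; case: (posnP (i_id g a)) => [->//|a0].
by have [-> _] := hbk a a0.
Qed.

Variable M : nat -> nat -> R.
Hypothesis hgr : forall k, (0 < k <= m)%N ->
  gr k = \sum_(1 <= j < m.+1) M j k * B^-1 ^+ j.
Hypothesis B4 : 4 <= B.

Definition mat_vec (v : nat -> R) j : R := \sum_(1 <= k < m.+1) M j k * v k.

(** Packing is linear: a combination of packed columns is the packed
    combination, whatever the size of the digits. *)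
Lemma packE v : \sum_(1 <= j < m.+1) gr j * v j = digits c g (mat_vec v) 1.
Proof.
transitivity (\sum_(1 <= k < m.+1) \sum_(1 <= j < m.+1) M j k * v k * B^-1 ^+ j).
  apply: eq_big_nat => k km; rewrite hgr // mulr_suml.
  by apply: eq_bigr => j _; rewrite mulrAC.
rewrite exchange_big /digits /=; apply: eq_big_nat => j /andP[j0 _].
by rewrite subn1 prednK // -/B mulr_suml.
Qed.

(* Control flow is verified for abstract predicates: [good mu] says that the
   shift and the draw are such that the numerical analysis applies, [inv] is the
   invariant of a round, and [out_ok] the correctness of an output. *)
Variables (good : R -> Prop) (inv : R -> nat -> (nat -> R) -> (nat -> R) -> Prop).
Variables (out_ok : (nat -> R) -> Prop) (l2 thr : R).
Let kappa := kappa_of (k_n c) Th.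
Let nsq := nsq g.

Hypothesis Hids : ids_inv.
Hypothesis Hinit : forall mu p v, good mu ->
  (forall j, (0 < j <= m)%N -> p j = 0 /\ v j = k_Z c ^+ 4 * (gd j)%:R) ->
  inv mu 0 p v /\ nsq v <= Th.
Hypothesis Hrange : forall mu k p v, good mu -> inv mu k p v -> nsq v <= Th ->
  forall j, (0 < j <= m)%N ->
    [/\ mat_vec v j \is a Num.int, `|mat_vec v j| <= B / 4 & `|kappa mu * mat_vec v j| < B].
Hypothesis Hstep : forall mu k p v p' v', good mu -> inv mu k p v -> nsq v <= Th ->
  (forall j, (0 < j <= m)%N -> p' j = v j /\ v' j = flr (kappa mu * mat_vec v j) - p j) ->
  inv mu k.+1 p' v'.
Hypothesis Hexceed : forall mu k p v o, good mu -> l2 <= mu -> inv mu k.+1 p v ->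
  k%:R < k_K c -> Th < nsq v ->
  (forall a, o a = if (0 < i_id g a)%N then v (i_id g a) / Num.sqrt (nsq v) else 0) ->
  out_ok o.
Hypothesis Hsurvive : forall mu k p v, good mu -> inv mu k p v -> nsq v <= Th ->
  k_K c <= k%:R -> thr < mu.

Definition out_zero (o : nat -> R) := forall a, i_id g a = 0%N -> o a = 0.

Definition cheb_prog : prog := seqs
  [:: pack_prog; unpack_prog; Do (IReal RAdd r_k r_k r_one);
      If (TRealLt r_Q r_nrm) exceed_prog Skip].

Definition cheb_time := ((2 * floor_time (k_HB c) + 100) * m + 100)%N.

Let cheb_vars := [:: r_x; r_tmp; r_Y; r_in; r_fl; r_bit; r_nrm; r_k].

Lemma wp_cheb s mu k Q : main s -> nvar s n_flag = 0%N -> rvar s r_k = k%:R ->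
  rvar s r_kappa = kappa mu -> k%:R < k_K c -> out_zero (rarr s x_out) ->
  (good mu -> inv mu k (rarr s x_prev) (rarr s x_cur) /\ nsq (rarr s x_cur) <= Th) ->
  (forall t s', (t <= cheb_time)%N -> main s' ->
     (forall r, r \notin cheb_vars -> rvar s' r = rvar s r) ->
     out_zero (rarr s' x_out) ->
     [/\ nvar s' n_flag = 0%N, rvar s' r_k = k.+1%:R, rarr s' x_out = rarr s x_out &
        good mu -> inv mu k.+1 (rarr s' x_prev) (rarr s' x_cur) /\ nsq (rarr s' x_cur) <= Th]
     \/ [/\ nvar s' n_flag = 1%N, rvar s' r_k = k_K c &
        good mu -> l2 <= mu -> out_ok (rarr s' x_out)] ->
     Q t s') ->
  wp cheb_prog Q s.
Proof.
move=> hs hf hk hkap kK hz hI hQ.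
apply: wp_seq; apply: wp_pack hs _ => t1 s1 t1le hs1 hY ha hf1 fr1.
apply: wp_seq; apply: (wp_unpack (y := mat_vec (rarr s x_cur)) (ok := good mu)) hs1 B4 _ _ _.
- by rewrite hY packE.
- have -> : rvar s1 r_kappa = kappa mu by rewrite fr1.
  by move=> gm j jm; have [i1 i2] := hI gm; exact: Hrange gm i1 i2 _ jm.
move=> t2 s2 t2le hs2 hpv hn ho hf2 fr2.
have [r1 _ _ _ [rQ _ _ _ [_ r0]]] := main_reals hs2.
have kap1 : rvar s1 r_kappa = kappa mu by rewrite fr1.
have k2 : rvar s2 r_k = k%:R by rewrite fr2 // fr1.
have Istep : good mu -> inv mu k.+1 (rarr s2 x_prev) (rarr s2 x_cur).
  move=> gm; have [i1 i2] := hI gm.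
  apply: (Hstep gm i1 i2) => j jm; have [-> ->] := hpv gm j jm.
  by rewrite kap1 ha.
have fr12 r : r \notin cheb_vars -> rvar s2 r = rvar s r.
  move=> hr; rewrite fr2; [rewrite fr1 //|]; move: hr; rewrite /cheb_vars !inE !negb_or;
  by do ?[case: (r == _) => //].
exec1.
set s3 := set_rvar _ _ _.
have hs3 : main s3 by exact: hs2.
apply: wp_seq; apply: wp_if.
  rewrite [eval_test _ _]/= rQ hn => exc.
  apply: wp_exceed hs3 Hids _ => t3 s4 t3le hs4 hf4 hk4 ho4 fr4.
  apply: wp_skip; apply: hQ => //.
  - by rewrite /cheb_time; lia.
  - move=> r hr; rewrite -(fr12 r hr) fr4 /s3 /=.
      by move: hr; rewrite /cheb_vars !inE !negb_or; do ?[case: (r == _) => //].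
    by move: hr; rewrite /cheb_vars !inE !negb_or; do ?[case: (r == _) => //].
  - move=> a a0; rewrite ho4 a0 /= ho; by rewrite ha; exact: hz.
  right; split=> // gm l2m; apply: (Hexceed gm l2m (Istep gm) kK exc) => a.
  rewrite ho4 /= hn; case: ifP => // /negbT; rewrite -leqNgt leqn0 => /eqP a0.
  by rewrite ho ha; exact: hz.
rewrite [eval_test _ _]/= rQ hn -leNgt => nexc.
apply: wp_skip; apply: wp_skip; apply: hQ.
- by rewrite /cheb_time; lia.
- exact: hs3.
- move=> r hr; rewrite -(fr12 r hr) /s3 /=.
  by move: hr; rewrite /cheb_vars !inE !negb_or; do ?[case: (r == _) => //].
- by move=> a a0; rewrite /= ho ha; exact: hz.
left; split.
- by rewrite -[LHS]/(nvar s2 n_flag) hf2 hf1.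
- by rewrite /= k2 r1 natr1.
- by rewrite -[LHS]/(rarr s2 x_out) ho ha.
- by move=> gm; split; [exact: Istep|exact: nexc].
Qed.

Definition round_prog : prog := seqs
  [:: Do (IReal RAdd r_mid r_lo r_hi); Do (IReal RDiv r_mid r_mid r_two); reset_prog;
      Do (IReal RMul r_tmp r_mid r_n); Do (IReal RMul r_tmp r_tmp r_Q);
      Do (IReal RMul r_tmp r_tmp r_Q); Do (IReal RDiv r_kappa r_two r_tmp);
      Do (IConst n_flag 0); Do (IReal RAdd r_k r_zero r_zero);
      While (TRealLt r_k r_K) cheb_prog].

Definition steps := (Num.truncn (k_K c)).+1.
Definition round_time := (steps * cheb_time.+1 + 20 * m + 100)%N.

Lemma wp_round s Q : main s -> out_zero (rarr s x_out) ->
  (forall t s', (t <= round_time)%N -> main s' -> out_zero (rarr s' x_out) ->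
     let mu := (rvar s r_lo + rvar s r_hi) / 2 in
     rvar s' r_mid = mu -> rvar s' r_lo = rvar s r_lo -> rvar s' r_hi = rvar s r_hi ->
     [/\ nvar s' n_flag = 0%N, rarr s' x_out = rarr s x_out & good mu -> thr < mu] \/
     nvar s' n_flag = 1%N /\ (good mu -> l2 <= mu -> out_ok (rarr s' x_out)) ->
     Q t s') ->
  wp round_prog Q s.
Proof.
move=> hs hz hQ; have [_ r2 _ _ _] := main_reals hs.
pose mu := (rvar s r_lo + rvar s r_hi) / 2.
do 2!exec1; apply: wp_seq.
set s1 := set_rvar _ _ _; have hs1 : main s1 by exact: hs.
have mid1 : rvar s1 r_mid = mu by rewrite /s1 /= r2.
have lo1 : rvar s1 r_lo = rvar s r_lo by [].
have hi1 : rvar s1 r_hi = rvar s r_hi by [].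
have out1 : rarr s1 x_out = rarr s x_out by [].
clearbody s1.
apply: wp_reset hs1 _ => t1 s2 t1le hs2 hpv ho fr.
have [_ rt2 _ _ [rQ _ _ _ [rn r0]]] := main_reals hs2.
have mid2 : rvar s2 r_mid = mu by rewrite fr.
have lo2 : rvar s2 r_lo = rvar s r_lo by rewrite fr.
have hi2 : rvar s2 r_hi = rvar s r_hi by rewrite fr.
have out2 : rarr s2 x_out = rarr s x_out by rewrite ho.
do 6!exec1; apply: wp_seq.
set s3 := set_rvar _ _ _; have hs3 : main s3 by exact: hs2.
have mid3 : rvar s3 r_mid = mu by exact: mid2.
have lo3 : rvar s3 r_lo = rvar s r_lo by exact: lo2.
have hi3 : rvar s3 r_hi = rvar s r_hi by exact: hi2.
have kap3 : rvar s3 r_kappa = kappa mu.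
  by rewrite /s3 /= rt2 mid2 rn rQ.
have k3 : rvar s3 r_k = 0 by rewrite /s3 /= r0 addr0.
have f3 : nvar s3 n_flag = 0%N by [].
have arr3 : rarr s3 = rarr s2 by [].
clearbody s3.
pose J k s' := [/\ main s', out_zero (rarr s' x_out),
  (forall r, r \notin cheb_vars -> rvar s' r = rvar s3 r) &
  [/\ nvar s' n_flag = 0%N, rvar s' r_k = k%:R, rarr s' x_out = rarr s x_out &
     good mu -> inv mu k (rarr s' x_prev) (rarr s' x_cur) /\ nsq (rarr s' x_cur) <= Th]
  \/ [/\ nvar s' n_flag = 1%N, rvar s' r_k = k_K c &
        good mu -> l2 <= mu -> out_ok (rarr s' x_out)]].
apply: (wp_while (c := cheb_time) (n := steps) (I := J)).
- split=> //; first by rewrite arr3 out2.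
  left; split=> //; first by rewrite arr3 out2.
  by move=> gm; apply: (Hinit gm) => j jm; rewrite arr3; exact: hpv.
- move=> k s' [hs' hz' fr' [[hf' hk' ho' hI']|[_ hk' _]]];
  have [_ _ _ _ [_ _ rK _ _]] := main_reals hs'; rewrite [eval_test _ _]/= rK hk' ?ltxx // => kK.
  split.
    rewrite /steps ltnS; have K0 : 0 <= k_K c by apply: le_trans (ltW kK).
    by have := truncn_itv K0 => /andP[_ h]; rewrite -ltnS -(ltr_nat R); apply: lt_trans kK h.
  apply: (wp_cheb (mu := mu) hs' hf' hk' _ kK hz' hI'); first by rewrite fr'.
  move=> t s4 tle hs4 fr4 hz4 hcase; split=> //; split=> //.
    by move=> r hr; rewrite fr4 // fr'.
  case: hcase => [[h1 h2 h3 h4]|h]; [left|by right].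
  by split=> //; rewrite h3.
move=> k T s' kn TB [hs' hz' fr' hcase] ht.
apply: wp_skip; apply: hQ => //.
- by move: TB; rewrite /round_time; lia.
- by rewrite fr'.
- by rewrite fr'.
- by rewrite fr'.
case: hcase => [[hf' hk' ho' hI']|[hf' hk' hO]]; last by right.
left; split=> // gm; have [i1 i2] := hI' gm.
apply: (Hsurvive gm i1 i2).
have [_ _ _ _ [_ _ rK _ _]] := main_reals hs'.
by move: ht; rewrite [eval_test _ _]/= rK hk' -leNgt.
Qed.

(** All eigenvalues are at most 1, so the search starts from the interval
    from 0 to 1. *)
Definition search_prog : prog := seqs
  [:: Do (IReal RAdd r_lo r_zero r_zero); Do (IReal RAdd r_hi r_one r_zero);
      Do (IReal RAdd r_diff r_one r_zero);
      While (TRealLt r_tau r_diff) (seqs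
        [:: round_prog;
            If (TNatLe n_flag n_zero) (Do (IReal RAdd r_hi r_mid r_zero))
                                      (Do (IReal RAdd r_lo r_mid r_zero));
            Do (IReal RSub r_diff r_hi r_lo)])].

Definition search_time := (k_log c * (round_time + 20) + 20)%N.

(* [G] is the event that the start has a sizeable leading component. *)
Hypothesis kd0 : 0 < k_kd c.
Hypothesis kdlog : k_kd c <= k_Z c.
Variable G : Prop.
Hypothesis Ggood : forall mu, G -> thr / 2 <= mu -> good mu.
Hypothesis thr1 : thr < 1.
Hypothesis l2thr : l2 + (k_kd c)^-1 <= thr.
Hypothesis l20 : 0 <= l2.

(** The upper end always stays above [thr], and the lower end is 0 or a
    shift whose round exceeded the threshold. Once the interval is no longer
    than [1 / k_kd], the lower end is above [l2], hence positive, and its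
    output is correct. *)
Lemma wp_search s Q : main s -> out_zero (rarr s x_out) ->
  (forall t s', (t <= search_time)%N ->
     (G -> out_ok (rarr s' x_out)) -> Q t s') ->
  wp search_prog Q s.
Proof.
move=> hs hz hQ; have [r1 _ _ _ [_ _ _ _ [_ r0]]] := main_reals hs.
do 3!exec1; apply: wp_seq.
(* [lo = 0] only before the first success, when nothing has been stored. *)
pose J k s' := [/\ main s', out_zero (rarr s' x_out),
  rvar s' r_diff = 2^-1 ^+ k /\ rvar s' r_diff = rvar s' r_hi - rvar s' r_lo,
  0 <= rvar s' r_lo &
  G -> thr < rvar s' r_hi /\ (l2 <= rvar s' r_lo -> 0 < rvar s' r_lo -> out_ok (rarr s' x_out))].
apply: (wp_while (c := (round_time + 19)%N) (n := k_log c) (I := J)).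
- split=> //=; rewrite ?r1 ?r0 ?addr0 ?subr0 ?expr0 //.
  by move=> _; split=> //; rewrite ltxx.
- move=> k s' [hs' hz' [d1 d2] lo0 hG].
  have [ra1 ra2 _ _ [_ _ _ rtau [_ _]]] := main_reals hs'.
  rewrite [eval_test _ _]/= rtau d1 => ht; split.
    have Z0 : 0 < k_Z c by rewrite exprn_gt0.
    rewrite ltnNge; apply/negP => kl; move: ht; rewrite ltNge => /negP; apply.
    apply: (@le_trans _ _ (k_Z c)^-1); last by rewrite lef_pV2 ?posrE.
    rewrite exprVn lef_pV2 ?posrE ?exprn_gt0 // /k_Z ler_weXn2l // ler1n //.
  apply: wp_seq; apply: wp_round hs' hz' _ => t s1 tle hs1 hz1 mu mid1 lo1 hi1 hcase.
  have [_ _ _ _ [_ _ _ _ [_ rz]]] := main_reals hs1.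
  have muE : mu = (rvar s' r_lo + rvar s' r_hi) / 2 by [].
  have dE : 2^-1 ^+ k.+1 = (rvar s' r_hi - rvar s' r_lo) / 2 :> R by rewrite exprSr -d1 d2.
  have dpos : 0 < rvar s' r_hi - rvar s' r_lo by rewrite -d2 d1 exprn_gt0 // invr_gt0.
  have gmu : G -> good mu.
    by move=> hg; apply: Ggood => //; have [h _] := hG hg; lra.
  apply: wp_seq; apply: wp_if; rewrite [eval_test _ _]/= (main_zero hs1).
    move=> hf; case: hcase => [[_ ho hthr]|[hf' _]]; last by rewrite hf' in hf.
    apply: wp_do; first reflexivity.
    exec1; apply: wp_skip.
    split; first by move: tle; move: round_time => rt; clear; lia.
    split.
    + exact: hs1.
    + exact: hz1.
    + by rewrite /= dE mid1 lo1 rz addr0; split=> //; lra.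
    + by rewrite /= lo1.
    + move=> hg; rewrite /= mid1 rz addr0 lo1 ho; split; first exact: hthr (gmu hg).
      by have [] := hG hg.
  move=> hf; case: hcase => [[hf' _ _]|[_ ho]]; first by rewrite hf' in hf.
  apply: wp_do; first reflexivity.
  exec1; apply: wp_skip.
  split; first by move: tle; move: round_time => rt; clear; lia.
  split.
  + exact: hs1.
  + exact: hz1.
  + by rewrite /= dE mid1 hi1 rz addr0; split=> //; lra.
  + by rewrite /= mid1 rz addr0; lra.
  + move=> hg; rewrite /= mid1 rz addr0 hi1; split; first by have [] := hG hg.
    by move=> l2m _; exact: ho (gmu hg) l2m.
move=> k T s' kn TB [hs' hz' [d1 d2] lo0 hG].
have [ra1 ra2 _ _ [_ _ _ rtau [_ _]]] := main_reals hs'.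
rewrite [eval_test _ _]/= rtau -leNgt d2 => ht.
apply: wp_skip; apply: hQ.
  by move: TB; rewrite /search_time; move: round_time => r; nia.
move=> hg; have [h1 h2] := hG hg; have := l2thr; have := l20.
by move=> h3 h4; apply: h2; lra.
Qed.

End Search.

(** * From arrays to vectors *)

Section Link.
Variable R : realType.
Variables (c1 c2 : R) (I : instance R).
Hypothesis wf : wf_instance c1 c2 I.

Let nz := enum (nonzero I).
Definition in_row : nat -> nat := nth 0%N [seq val ij.1 | ij <- enum (nonzero I)].
Definition in_col : nat -> nat := nth 0%N [seq val ij.2 | ij <- enum (nonzero I)].
Definition in_val : nat -> R := nth 0 [seq pts ij.1 ij.2 0 | ij <- enum (nonzero I)].

Let x0 : 'I_(npts I) * 'I_(pdim I).
Proof.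
have n0 := npts_gt0 wf; have d0 : (0 < pdim I)%N by case: wf => /andP[h _] *; lia.
exact: (Ordinal n0, Ordinal d0).
Qed.

Lemma size_nz : size nz = nnz I.
Proof. by rewrite /nz -cardE. Qed.

Lemma in_nthE e : (e < nnz I)%N ->
  [/\ in_row e = (nth x0 nz e).1, in_col e = (nth x0 nz e).2,
      in_val e = pts (nth x0 nz e).1 (nth x0 nz e).2 0 & nth x0 nz e \in nonzero I].
Proof.
move=> he; rewrite /in_row /in_col /in_val -/nz !(nth_map x0) ?size_nz //.
by split=> //; rewrite -mem_enum mem_nth // size_nz.
Qed.

Lemma in_nth_ex i a : a \in vsupp (pts (i := I) i) ->
  exists2 e, (e < nnz I)%N & in_col e = val a /\ in_row e = val i.
Proof.
move=> ia; have h : (i, a) \in nz by rewrite mem_enum nonzeroE.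
exists (index (i, a) nz); first by rewrite -size_nz index_mem.
have [|-> -> _ _] := @in_nthE (index (i, a) nz); first by rewrite -size_nz index_mem.
by rewrite nth_index.
Qed.

(** The three input arrays list exactly the nonzero coordinates. *)
Lemma sum_nz (F : nat -> nat -> R -> R) : (forall i a, F i a 0 = 0) ->
  \sum_(0 <= e < nnz I) F (in_row e) (in_col e) (in_val e) =
  \sum_(i < npts I) \sum_(a < pdim I) F i a (pts i a 0).
Proof.
move=> F0.
transitivity (\sum_(ij <- nz) F ij.1 ij.2 (pts ij.1 ij.2 0)).
  rewrite (big_nth x0) size_nz; apply: eq_big_nat => e /andP[_ he].
  by have [-> -> -> _] := in_nthE he.
rewrite /nz big_enum /= pair_bigA /= big_mkcond /=; apply: eq_bigr => -[i a] _ /=.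
by case: ifP => // /negbT; rewrite nonzeroE negbK => /eqP ->; rewrite F0.
Qed.

Lemma sum_pick (m a : nat) (F : nat -> R) : (0 < a <= m)%N ->
  \sum_(1 <= j < m.+1) (if a == j then F j else 0) = F a.
Proof.
move=> am; rewrite (bigD1_seq a) ?iota_uniq ?mem_index_iota ?eqxx //=.
by rewrite big1 ?addr0 // => j; rewrite eq_sym => /negbTE ->.
Qed.

Variables (c : consts R) (g : ids R).
Hypothesis cE : [/\ k_n c = npts I, k_nnz c = nnz I, k_row c = in_row,
   k_col c = in_col & k_val c = in_val].
Hypothesis idsok : ids_ok (k_col c) (k_nnz c) (i_m g) (i_id g) (i_back g).
Hypothesis powok : forall j, (0 < j <= i_m g)%N -> i_pow g j = (k_B c)^-1 ^+ j.

Let m := i_m g.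
Let idf := i_id g.
Let back := i_back g.
Let Q := k_Z c ^+ 32.
Let X i : 'cV[R]_(pdim I) := roundv Q (pts i).

Lemma id_active (a : 'I_(pdim I)) : (0 < idf a)%N = (a \in @active R I).
Proof.
have [_ ek ec ecol _] := cE; have [_ h1 h2 h3] := idsok.
apply/idP/idP => [/h2[_ _ [e eN ea]]|].
  rewrite ek in eN; rewrite ecol in ea; have [_ h _ hz] := in_nthE eN.
  rewrite inE; apply/existsP; exists (nth x0 nz e).1.
  move: hz; rewrite (surjective_pairing (nth x0 nz e)) nonzeroE /=.
  by have -> : (nth x0 nz e).2 = a by apply: val_inj; exact: etrans (esym h) ea.
rewrite inE => /existsP[i /in_nth_ex[e eN [ea _]]].
by have := h1 e; rewrite ek ecol ea; apply.
Qed.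

Lemma id_range (a : nat) : (0 < idf a)%N -> (0 < idf a <= m)%N.
Proof. by move=> a0; rewrite a0; have [_ _ h _] := idsok; have [] := h _ a0. Qed.

Lemma id_inj (a b : 'I_(pdim I)) : (0 < idf b)%N -> idf a = idf b -> a = b.
Proof.
move=> b0 e; have [_ _ h _] := idsok.
have [_ hb _] := h _ b0; have [|_ ha _] := h a; first by rewrite [i_id g a]e.
by apply: val_inj; exact: etrans (esym ha) (etrans (congr1 _ e) hb).
Qed.

Lemma back_lt j : (0 < j <= m)%N -> (back j < pdim I)%N.
Proof.
have [_ ek ec ecol _] := cE; have [_ h1 h2 h3] := idsok => jm.
have [|_ _ [e eN eb]] := h2 (back j); first by rewrite h3 //; case/andP: jm.
rewrite -eb ecol; rewrite ek in eN.
by have [_ -> _ _] := in_nthE eN.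
Qed.

Lemma ids_invP : ids_inv g.
Proof.
have [_ h1 h2 h3] := idsok; split=> [j jm|a a0]; first exact: h3.
by have [ha hb _] := h2 a a0.
Qed.

Lemma id_back j : (0 < j <= m)%N -> idf (back j) = j.
Proof. by have [h _] := ids_invP; exact: h. Qed.

Lemma back_id a : (0 < idf a)%N -> back (idf a) = a.
Proof. by have [_ h] := ids_invP; move=> /h[]. Qed.

Definition lift_vec (v : nat -> R) : 'cV[R]_(pdim I) :=
  \col_a (if (0 < idf a)%N then v (idf a) else 0).

Lemma sum_active (F : nat -> R) :
  \sum_(a < pdim I) (if (0 < idf a)%N then F (idf a) else 0) = \sum_(1 <= j < m.+1) F j.
Proof.
transitivity (\sum_(a < pdim I) \sum_(1 <= j < m.+1) (if idf a == j then F j else 0)).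
  apply: eq_bigr => a _; case: posnP => [->|a0].
    by rewrite big_nat_cond big1 // => j /andP[/andP[j0 _] _]; rewrite eq_sym gtn_eqF.
  by rewrite sum_pick ?id_range.
rewrite exchange_big /=; apply: eq_big_nat => j jm.
rewrite (bigD1 (Ordinal (back_lt jm))) //= big1 ?addr0 => [|a an].
  by rewrite id_back // eqxx.
case: eqP => // e; case/eqP: an; apply: val_inj => /=.
by rewrite -e back_id // e; case/andP: jm.
Qed.

Lemma nsq_lift v : nsq g v = dotv (lift_vec v) (lift_vec v).
Proof.
rewrite dotvE /nsq -sum_active; apply: eq_bigr => a _; rewrite !mxE.
by case: ifP => _; rewrite ?mulr0 // expr2.
Qed.

Definition gram_entry j k : R :=
  \sum_(0 <= e < nnz I) \sum_(0 <= e' < nnz I)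
    if (idf (in_col e) == k) && (in_row e' == in_row e) && (idf (in_col e') == j)
    then entry c e * entry c e' else 0.

Lemma id_col e : (e < nnz I)%N -> (0 < idf (in_col e) <= m)%N.
Proof.
have [_ ek ec ecol _] := cE; have [_ h1 _ _] := idsok.
by move=> eN; apply: id_range; have := h1 e; rewrite ek ecol; apply.
Qed.

(** The packed columns computed by the program have the entries of the Gram
    matrix as digits. *)
Lemma gram_sumE k : gram_sum c g (nnz I) k =
  \sum_(1 <= j < m.+1) gram_entry j k * (k_B c)^-1 ^+ j.
Proof.
have [_ ek er ecol _] := cE.
rewrite /gram_sum /row_sum ek er ecol /gram_entry.
under [RHS]eq_bigr => j _ do rewrite mulr_suml.
rewrite [RHS]exchange_big /=; apply: eq_big_nat => e eN; rewrite -/idf.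
under [RHS]eq_bigr => j _ do rewrite mulr_suml.
rewrite [RHS]exchange_big /=; case: eqP => [ke|_]; last first.
  by rewrite big1 // => e' _; rewrite big1 // => j _; rewrite /= mul0r.
rewrite mulr_sumr; apply: eq_big_nat => e' /andP[_ eN'] /=; rewrite -/idf.
case: eqP => /= _; last by rewrite mulr0 big1 // => j _; rewrite mul0r.
rewrite powok ?id_col // mulrA -[LHS](sum_pick (m := m) (fun j => entry c e * entry c e' * (k_B c)^-1 ^+ j) (id_col eN')).
by apply: eq_bigr => j _; case: eqP => _; rewrite ?mul0r.
Qed.

Lemma mat_vecE v j : mat_vec g gram_entry v j =
  \sum_(0 <= e < nnz I) \sum_(0 <= e' < nnz I)
    if (in_row e' == in_row e) && (idf (in_col e') == j)
    then entry c e * entry c e' * v (idf (in_col e)) else 0.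
Proof.
rewrite /mat_vec /gram_entry.
under eq_bigr => k _ do rewrite mulr_suml.
rewrite exchange_big /=; apply: eq_big_nat => e /andP[_ eN].
under eq_bigr => k _ do rewrite mulr_suml.
rewrite exchange_big /=; apply: eq_bigr => e' _.
rewrite -(sum_pick (m := m) (fun k => if (in_row e' == in_row e) && (idf (in_col e') == j)
    then entry c e * entry c e' * v k else 0) (id_col eN)).
apply: eq_bigr => k _; rewrite -andbA; case: eqP => _ /=; last by rewrite mul0r.
by case: ifP => _; rewrite ?mul0r.
Qed.

(** The matrix in the numbering of the active columns acts on arrays as the
    Gram matrix of the rounded points acts on vectors. *)
Lemma mat_vec_lift v (a : 'I_(pdim I)) : (0 < idf a)%N ->
  mat_vec g gram_entry v (idf a) = (gram X *m lift_vec v) a 0.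
Proof.
move=> a0; have [_ ek er ecol ev] := cE.
rewrite mat_vecE gram_mul summxE.
pose F i b x : R := flr (Q * x) * v (idf b) *
  \sum_(0 <= e' < nnz I) if (in_row e' == i) && (idf (in_col e') == idf a)
     then entry c e' else 0.
transitivity (\sum_(0 <= e < nnz I) F (in_row e) (in_col e) (in_val e)).
  apply: eq_big_nat => e _; rewrite /F mulr_sumr; apply: eq_bigr => e' _.
  by case: ifP => _; rewrite ?mulr0 // /entry ev -/Q; ring.
rewrite sum_nz => [|i b]; last by rewrite /F mulr0 flr0 !mul0r.
apply: eq_bigr => i _; rewrite mxE dotvE mulr_suml; apply: eq_bigr => b _.
have -> : F i b (pts i b 0) = flr (Q * pts i b 0) * v (idf b) * (X i) a 0.
  rewrite /F; congr (_ * _).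
  pose F' i' b' x : R := if (i' == val i) && (idf b' == idf a) then flr (Q * x) else 0.
  transitivity (\sum_(0 <= e < nnz I) F' (in_row e) (in_col e) (in_val e)).
    by apply: eq_bigr => e' _; rewrite /F' /entry ev.
  rewrite sum_nz => [|i' b']; last by rewrite /F' mulr0 flr0 if_same.
  rewrite (bigD1 i) //= [X in _ + X]big1 ?addr0 => [|i' ii].
    rewrite (bigD1 a) //= [X in _ + X]big1 ?addr0 => [|b' bb].
      by rewrite /F' !eqxx /= mxE.
    rewrite /F' eqxx /=; case: eqP => // /(id_inj a0) e.
    by rewrite e eqxx in bb.
  rewrite big1 // => b' _; rewrite /F'; case: eqP => // e.
  by case/eqP: ii; apply: val_inj.
congr (_ * _); rewrite !mxE; case: posnP => [b0|//].
suff -> : pts i b 0 = 0 by rewrite mulr0 flr0 !mul0r.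
apply/eqP/negPn/negP => hb; have : (0 < idf b)%N by rewrite id_active inE; apply/existsP; exists i.
by rewrite b0.
Qed.

Lemma mat_vec_int v j : (forall k, (0 < k <= m)%N -> v k \is a Num.int) ->
  mat_vec g gram_entry v j \is a Num.int.
Proof.
move=> hv; rewrite mat_vecE big_nat_cond rpred_sum // => e /andP[/andP[_ eN] _].
rewrite rpred_sum // => e' _; case: ifP => _; last exact: rpred0.
by rewrite !rpredM ?hv ?id_col // /entry /flr intr_int.
Qed.

Lemma size_active : (m <= pdim I)%N /\ (m <= nnz I)%N.
Proof.
have [_ ek _ _ _] := cE; have [h0 h1 h2 h3] := idsok; split; last by rewrite -ek.
rewrite -[m](size_iota 1) -(size_map back) -[X in (_ <= X)%N](size_iota 0).
apply: uniq_leq_size.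
  rewrite map_inj_in_uniq ?iota_uniq // => i j; rewrite !mem_iota => hi hj e.
  by rewrite -[i]id_back // -[j]id_back // e.
by move=> a /mapP[j]; rewrite !mem_iota => hj ->; rewrite /= add0n back_lt.
Qed.

End Link.

(** * Correctness of the search on an instance *)

Section Correct.
Variable R : realType.
Variables (c1 c2 : R) (I : instance R) (eps : R).
Hypothesis wf : wf_instance c1 c2 I.
Variables (c : consts R) (g : ids R).
Hypothesis cE : [/\ k_n c = npts I, k_nnz c = nnz I, k_row c = in_row I,
   k_col c = in_col I & k_val c = in_val I].
Hypothesis idsok : ids_ok (k_col c) (k_nnz c) (i_m g) (i_id g) (i_back g).
Hypothesis powok : forall j, (0 < j <= i_m g)%N -> i_pow g j = (k_B c)^-1 ^+ j.
Hypothesis eps0 : 0 < eps.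
Hypothesis Z64 : 64 <= k_Z c.
Hypothesis nZ : (npts I)%:R <= k_Z c.
Hypothesis NZ : 64 * (nnz I)%:R <= k_Z c.
Hypothesis gapZ : 64 / gap I <= k_kd c.
Hypothesis kdZ : k_kd c <= k_Z c.
Hypothesis epsZ : eps^-1 <= k_Z c.

Let m := i_m g.
Let idf := i_id g.
Let back := i_back g.
Let Z := k_Z c.
Let l1 := (eigs I)`_0.
Let l2 := (eigs I)`_1.
Let lift := lift_vec I g.
Let M := gram_entry I c g.

Definition lead_at (a : nat) : R := oapp (fun b : 'I_(pdim I) => lead I b 0) 0 (insub a).

Lemma lead_atE (a : 'I_(pdim I)) : lead_at a = lead I a 0.
Proof. by rewrite /lead_at valK. Qed.

Lemma dot_lead_lift v : dotv (lead I) (lift v) = \sum_(1 <= j < m.+1) lead_at (back j) * v j.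
Proof.
rewrite dotvE -(sum_active wf cE idsok); apply: eq_bigr => a _.
rewrite mxE -/idf; case: posnP => [_|a0]; first by rewrite mulr0.
by rewrite /back (back_id idsok) // lead_atE.
Qed.

Lemma lead_active_sqr : \sum_(1 <= j < m.+1) lead_at (back j) ^+ 2 = 1.
Proof.
rewrite -(lead_dot wf) dotvE -(sum_active wf cE idsok); apply: eq_bigr => a _.
rewrite -/idf; case: posnP => [a0|a0]; last by rewrite /back (back_id idsok) // lead_atE expr2.
by rewrite (lead_supp wf) ?mulr0 // -(id_active wf cE idsok) -/idf a0.
Qed.

Definition lead_coefs : seq R := [seq lead_at (back j) | j <- iota 1 m].

Lemma lincombE (f : nat -> R) a w (h : nat -> nat) :
  (forall i, (i < size w)%N -> h (a + i)%N = nth 0%N w i) ->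
  lincomb [seq f j | j <- iota a (size w)] w =
  \sum_(a <= j < a + size w) f j * (h j)%:R.
Proof.
elim: w a => [|v w IH] a hw /=; first by rewrite addn0 big_geq.
rewrite big_ltn ?addnS ?ltnS ?leq_addr //.
have := hw 0%N isT; rewrite addn0 => -> /=; congr (_ + _).
by rewrite IH => [|i iw]; [rewrite addSn|rewrite addSnnS hw].
Qed.

Lemma m_gt0 : (0 < m)%N.
Proof.
rewrite lt0n; apply/eqP => m0; have := lead_active_sqr; rewrite m0 big_geq // => /eqP.
by rewrite eq_sym oner_eq0.
Qed.

(** A unit vector supported on [m] coordinates has one of absolute value at
    least [1 / sqrt m]. *)
Lemma lead_coef_large : has (fun u => 1 <= `|u| * (2 * m)%:R) lead_coefs.
Proof.
apply/negP => /negP /hasPn h.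
have : \sum_(1 <= j < m.+1) (lead_at (back j) * (2 * m)%:R) ^+ 2 <= \sum_(1 <= j < m.+1) 1.
  rewrite big_nat_cond [leRHS]big_nat_cond; apply: ler_sum => j /andP[/andP[j0 jm] _].
  rewrite -real_normK ?num_real // expr_le1 ?normr_ge0 // normrM normr_nat ltW // ltNge.
  by apply: h; apply/mapP; exists j => //; rewrite mem_iota j0 add1n.
under eq_bigr => j _ do rewrite exprMn.
rewrite -mulr_suml lead_active_sqr mul1r sumr_const_nat subn1 /= -natrX ler_nat.
by move: m_gt0; move: m => k; clear; nia.
Qed.

Variable gd : nat -> nat.
Hypothesis gdG : forall j, (0 < j <= m)%N -> (gd j <= k_G c)%N.

Definition draw_dot : R := \sum_(1 <= j < m.+1) lead_at (back j) * (gd j)%:R.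

(* The sign is chosen so that the start has a nonnegative component along [u]. *)
Let u := if 0 <= draw_dot then lead I else - lead I.

Let u_unit : norm2 u = 1.
Proof. by rewrite /u; case: ifP => _; rewrite ?norm2N (lead_unit wf). Qed.

Let u_eig : covmx I *m u = l1 *: u.
Proof. by rewrite /u; case: ifP => _; rewrite ?mulmxN ?scalerN (lead_eig wf). Qed.

Let u_perp w : dotv u w = 0 -> norm2 (covmx I *m w) <= l2 * norm2 w.
Proof.
rewrite /u; case: ifP => _ h; first by have [] := eig1_bound wf h.
have : dotv (lead I) w = 0 by move/eqP: h; rewrite dotvNl oppr_eq0 => /eqP.
by move=> /(eig1_bound wf)[].
Qed.

Let u_dot : dotv u (lift (fun j => (gd j)%:R)) = `|draw_dot|.
Proof.
rewrite /u; case: ifPn => [d0|d0]; first by rewrite dot_lead_lift ger0_norm.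
by rewrite dotvNl dot_lead_lift ltr0_norm // ltNge.
Qed.

Let n0 : (0 < npts I)%N. Proof. exact: npts_gt0 wf. Qed.
Let x1 i : norm2 (pts (i := I) i) <= 1. Proof. exact: pts_le1 wf i. Qed.
Let l20 : 0 <= l2. Proof. exact: eig1_ge0 wf. Qed.
Let l12 : l2 < l1. Proof. by rewrite -subr_gt0; exact: gap_gt0 wf. Qed.
Let l1_le1 : l1 <= 1. Proof. exact: eig0_le1 wf. Qed.
Let gapE : l1 - l2 = gap I. Proof. by []. Qed.
Let Z1 : 1 <= Z. Proof. by have := Z64; rewrite -/Z; lra. Qed.
Let Z0 : 0 < Z. Proof. by have := Z64; rewrite -/Z; lra. Qed.
Let BE : k_B c = Z ^+ 128. Proof. by rewrite /k_B /k_HB exprM. Qed.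

Let Zle a b : (a <= b)%N -> Z ^+ a <= Z ^+ b.
Proof. by move=> ab; rewrite ler_weXn2l. Qed.

Definition run_inv (mu : R) k (p v : nat -> R) : Prop :=
  [/\ round_inv (pts (i := I)) u l1 l2 Z mu k (lift p) (lift v),
     forall j, (0 < j <= m)%N -> p j \is a Num.int &
     forall j, (0 < j <= m)%N -> v j \is a Num.int].

(** Every shift met by the search satisfies the second condition, since the
    upper end of its interval stays above [l1 - gap / 4 >= 3 / 4 gap] and a
    shift is at least half of it. *)
Definition run_good (mu : R) : Prop := 1 <= `|draw_dot| /\ 3 / 8 * gap I <= mu.

Definition run_out (o : nat -> R) : Prop :=
  norm2 (\col_(j < pdim I) o j) = 1 /\ 1 - eps <= dotv (\col_(j < pdim I) o j) (lead I) ^+ 2.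

Let nsqE v : Num.sqrt (nsq g v) = norm2 (lift v).
Proof. by rewrite /norm2 /lift -(nsq_lift wf cE idsok). Qed.

Let nsq_le v : (nsq g v <= k_Z c ^+ 32) = (norm2 (lift v) <= Z ^+ 16).
Proof.
rewrite -[RHS](@ler_pXn2r _ 2) ?nnegrE ?norm2_ge0 ?exprn_ge0 ?(ltW Z0) //.
by rewrite sqr_norm2 -(exprM Z 16 2) /lift -(nsq_lift wf cE idsok v).
Qed.

Let lift_ext v v' : (forall j, (0 < j <= m)%N -> v j = v' j) -> lift v = lift v'.
Proof.
move=> h; apply/colP => a; rewrite !mxE; case: ifP => // a0; apply: h.
exact: (id_range idsok).
Qed.

Lemma run_init mu p v : run_good mu ->
  (forall j, (0 < j <= m)%N -> p j = 0 /\ v j = Z ^+ 4 * (gd j)%:R) ->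
  run_inv mu 0 p v /\ nsq g v <= k_Z c ^+ 32.
Proof.
move=> [hd hmu] hpv; set gv := lift (fun j => (gd j)%:R).
have lp : lift p = 0.
  rewrite (@lift_ext p (fun=> 0)) => [|j /hpv[]//].
  by apply/colP => a; rewrite !mxE if_same.
have lv : lift v = Z ^+ 4 *: gv.
  rewrite (@lift_ext v (fun j => Z ^+ 4 * (gd j)%:R)) => [|j /hpv[]//].
  by apply/colP => a; rewrite !mxE; case: ifP; rewrite ?mulr0.
have gvn : norm2 gv <= Z ^+ 3.
  apply: (@le_trans _ _ ((nnz I)%:R * Z ^+ 2)).
    apply: (norm2_sparse (P := @active R I)); first exact: card_active.
    - by rewrite exprn_ge0 ?(ltW Z0).
    - by move=> a; rewrite -(id_active wf cE idsok) -leqNgt leqn0 => /eqP a0; rewrite mxE a0.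
    - move=> a; rewrite mxE; case: ifP => a0; last by rewrite normr0 exprn_ge0 ?(ltW Z0).
      rewrite normr_nat /Z /k_Z -!natrX ler_nat.
      exact: gdG (id_range idsok a0).
  rewrite [leRHS]exprS ler_wpM2r ?exprn_ge0 ?(ltW Z0) //.
  by have := NZ; rewrite -/Z; have : 0 <= (nnz I)%:R :> R by []; lra.
have vn : norm2 (lift v) <= Z ^+ 7.
  rewrite lv norm2Z ger0_norm ?exprn_ge0 ?(ltW Z0) // (exprD Z 4 3).
  by rewrite ler_wpM2l ?exprn_ge0 ?(ltW Z0).
split; last by rewrite nsq_le (le_trans vn) // Zle.
split=> [|j /hpv[-> _]|j /hpv[_ ->]].
- rewrite lp; apply: round_init => //.
  by rewrite lv dotvZr -[leLHS]mulr1 ler_wpM2l ?exprn_ge0 ?(ltW Z0) // u_dot.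
- exact: rpred0.
- by rewrite rpredM ?natr_int // /Z /k_Z -exprM -natrX natr_int.
Qed.

Let id_ord j (jm : (0 < j <= m)%N) :
  exists a : 'I_(pdim I), idf a = j.
Proof. by exists (Ordinal (back_lt wf cE idsok jm)); rewrite /idf /=; exact: (id_back idsok). Qed.

Lemma run_range mu k p v : run_good mu -> run_inv mu k p v -> nsq g v <= k_Z c ^+ 32 ->
  forall j, (0 < j <= m)%N ->
    [/\ mat_vec g M v j \is a Num.int, `|mat_vec g M v j| <= k_B c / 4 &
        `|kappa_of (k_n c) (k_Z c ^+ 32) mu * mat_vec g M v j| < k_B c].
Proof.
move=> [_ hmu] [_ _ hv]; rewrite nsq_le => vn j jm.
have [a aj] := id_ord jm; have a0 : (0 < idf a)%N by rewrite aj; case/andP: jm.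
split; first by apply: (mat_vec_int cE idsok).
  rewrite -aj /M (mat_vec_lift wf cE idsok) // BE.
  exact: (range_M x1 (@card_active R I) l20 l12 l1_le1 Z64 nZ NZ a vn).
have [-> _ _ _ _] := cE; rewrite -aj /M (mat_vec_lift wf cE idsok) // BE.
exact: (range_kappa n0 x1 (@card_active R I) l20 l12 l1_le1 Z64 nZ NZ gapZ kdZ a hmu vn).
Qed.

Lemma run_step mu k p v p' v' : run_good mu -> run_inv mu k p v ->
  nsq g v <= k_Z c ^+ 32 ->
  (forall j, (0 < j <= m)%N -> p' j = v j /\
     v' j = flr (kappa_of (k_n c) (k_Z c ^+ 32) mu * mat_vec g M v j) - p j) ->
  run_inv mu k.+1 p' v'.
Proof.
move=> [_ hmu] [hr hp hv]; rewrite nsq_le => vn hpv.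
split=> [|j jm|j jm]; last 2 first.
- by have [-> _] := hpv j jm; exact: hv.
- by have [_ ->] := hpv j jm; rewrite rpredB ?hp // /flr intr_int.
rewrite (@lift_ext p' v) => [|j /hpv[]//].
have -> : lift v' = next_vec (pts (i := I)) Z mu (lift p) (lift v).
  apply/colP => a; rewrite [LHS]mxE [RHS]mxE [lift p a 0]mxE -/idf.
  case: posnP => [a0|a0].
    suff -> : (gram (fun i => roundv (Z ^+ 32) (pts (i := I) i)) *m lift v) a 0 = 0.
      by rewrite mulr0 flr0 subr0.
    rewrite gram_mul summxE big1 // => i _; rewrite !mxE.
    suff -> : pts i a 0 = 0 by rewrite mulr0 flr0 mulr0.
    apply/eqP/negPn/negP => hb.
    have : (0 < idf a)%N by rewrite (id_active wf cE idsok) inE; apply/existsP; exists i.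
    by rewrite a0.
  have [_ ->] := hpv _ (id_range idsok a0); have [-> _ _ _ _] := cE.
  by rewrite /M (mat_vec_lift wf cE idsok).
exact: (round_step n0 x1 (@card_active R I) u_unit u_eig l20 l12 l1_le1 u_perp
  Z64 NZ gapZ kdZ hmu vn hr).
Qed.

(** The number of steps is below [Z^3] because [k_K] is at most [32 Z^2]. *)
Lemma run_exceed mu k p v o : run_good mu -> l2 <= mu -> run_inv mu k.+1 p v ->
  k%:R < k_K c -> k_Z c ^+ 32 < nsq g v ->
  (forall a, o a = if (0 < i_id g a)%N then v (i_id g a) / Num.sqrt (nsq g v) else 0) ->
  run_out o.
Proof.
move=> [_ hmu] l2mu [hr _ _] kK; rewrite ltNge nsq_le -ltNge => vn ho.
have oE : \col_(j < pdim I) o j = (norm2 (lift v))^-1 *: lift v.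
  by apply/colP => a; rewrite !mxE ho nsqE; case: ifP; rewrite ?mulr0 // mulrC.
have v0 : 0 < norm2 (lift v) by apply: le_lt_trans vn; rewrite exprn_ge0 ?(ltW Z0).
have mu0 : 0 < mu by apply: lt_le_trans hmu; have := gap_gt0 wf; lra.
rewrite /run_out oE norm2Z gtr0_norm ?invr_gt0 // mulVf ?gt_eqF //; split=> //.
have k3 : k.+3%:R <= Z ^+ 3.
  have H0 : (k_log c)%:R <= Z by rewrite /Z /k_Z -natrX ler_nat ltnW // ltn_expl.
  have kd1 : 1 <= k_kd c.
    apply: le_trans gapZ; rewrite ler_pdivlMr ?(gap_gt0 wf) // mul1r.
    by have := l1_le1; have := l20; rewrite -gapE; lra.
  have s1 : Num.sqrt (k_kd c) <= Z.
    apply: le_trans kdZ; rewrite -[leRHS](@sqr_sqrtr _ (k_kd c)); last lra.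
    by rewrite expr2 ler_peMl ?sqrtr_ge0 // -[1]sqrtr1 ler_sqrt; lra.
  have : k_K c <= 32 * Z * Z.
    rewrite /k_K ler_pM ?mulr_ge0 ?sqrtr_ge0 // ler_wpM2l //.
  have : 64 * (Z * Z) <= Z * (Z * Z) by rewrite ler_wpM2r ?mulr_ge0 ?(ltW Z0).
  have : 1 <= Z * Z by rewrite mulr_ege1.
  rewrite -!natr1 !exprS expr0 mulr1; move: kK; lra.
have := round_exceed u_unit l20 l12 l1_le1 u_perp Z64 eps0 epsZ l2mu mu0 k3 hr vn.
rewrite /u; case: ifP => // _; by rewrite dotvNr sqrrN.
Qed.

Lemma run_survive mu k p v : run_good mu -> run_inv mu k p v -> nsq g v <= k_Z c ^+ 32 ->
  k_K c <= k%:R -> l1 - gap I / 4 < mu.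
Proof.
move=> [_ hmu] [hr _ _]; rewrite nsq_le => vn kK.
exact: (round_survive u_unit l20 l12 l1_le1 Z64 (erefl _) gapZ kdZ kK hr vn).
Qed.

Lemma gramE gr : (forall k, gr k = gram_sum c g (nnz I) k) ->
  forall k, (0 < k <= m)%N -> gr k = \sum_(1 <= j < m.+1) M j k * (k_B c)^-1 ^+ j.
Proof. by move=> h k _; rewrite h (gram_sumE cE idsok powok). Qed.

Lemma search_good s : has_consts c s -> has_ids g s ->
  (forall k, rarr s x_gram k = gram_sum c g (nnz I) k) ->
  narr s a_g = gd -> (forall a, rarr s x_out a = 0) ->
  wp search_prog (fun t s' => (t <= search_time c g)%N /\
     (1 <= `|draw_dot| -> good I eps s')) s.
Proof.
move=> hc hg hgr hgd hout.
have B4 : 4 <= k_B c.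
  by rewrite BE (@le_trans _ _ (Z ^+ 1)) ?Zle // expr1; have := Z64; rewrite -/Z; lra.
have kd0 : 0 < k_kd c by apply: lt_le_trans gapZ; rewrite divr_gt0 ?(gap_gt0 wf).
apply: (wp_search (g := g) (gr := rarr s x_gram) (gd := gd) (M := M) (good := run_good)
  (inv := run_inv) (out_ok := run_out) (l2 := l2) (thr := l1 - gap I / 4)
  (gramE hgr) B4 (ids_invP idsok) run_init run_range run_step run_exceed run_survive
  kd0 kdZ (G := 1 <= `|draw_dot|)).
- move=> mu hd hmu; split=> //; move: hmu; have := l20; rewrite -gapE; lra.
- by have := l1_le1; have := gap_gt0 wf; lra.
- have : (k_kd c)^-1 <= gap I / 64.
    rewrite -[leRHS]invrK invf_div lef_pV2 ?posrE ?divr_gt0 ?(gap_gt0 wf) //.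
  by have := gap_gt0 wf; rewrite -gapE; lra.
- exact: l20.
- by split.
- by move=> a _; exact: hout.
move=> t s' ht hout'; split=> // /hout' [h1 h2].
by rewrite /good; apply/andP; split; [apply/eqP|].
Qed.

End Correct.

(** * The complete algorithm and its success probability *)

Section Assembly.
Variable R : realType.

Definition prep_prog (kc : nat) : prog := seqs
  [:: init_prog kc; ids_prog; rows_prog; gram_prog; Do (IConst n_j 1)].

Definition algorithm (kc : nat) : prog := Seq (prep_prog kc) (Seq rand_loop search_prog).

Definition prep_time (H N : nat) : nat :=
  (8 * H + (floor_time (H * 128) + 110) * N + 200)%N.

Variables (c1 c2 : R) (I : instance R) (eps p : R) (kc : nat).
Hypothesis wf : wf_instance c1 c2 I.
Hypothesis c10 : 0 < c1.
Hypothesis eps0 : 0 < eps.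
Hypothesis p0 : 0 < p.
Hypothesis kc64 : (64 <= kc)%N.
Hypothesis kc2 : 64 * c2 <= kc%:R.

Let goal := log_goal kc (npts I) (nnz I) eps p (gap_est I).
Let cst H := Consts (npts I) (nnz I) (in_row I) (in_col I) (in_val I) H (kc%:R / gap_est I).

Lemma gap_est_gt0 : 0 < gap_est I.
Proof. by case: wf => _ _ _ _ [g0 /andP[h _]]; apply: lt_le_trans h; rewrite mulr_gt0. Qed.

Lemma gap_est_le : gap_est I <= c2 * gap I.
Proof. by case: wf => _ _ _ _ [g0 /andP[_ h]]. Qed.

Lemma gap_est_ge : c1 * gap I <= gap_est I.
Proof. by case: wf => _ _ _ _ [g0 /andP[h _]]. Qed.

Lemma log_goal_bounds z : goal <= z ->
  [/\ 64 <= z, (npts I)%:R <= z, 64 * (nnz I)%:R <= z, 64 / gap I <= kc%:R / gap_est I &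
   [/\ kc%:R / gap_est I <= z, eps^-1 <= z & p^-1 <= z]].
Proof.
rewrite /goal /log_goal => hz.
have k64 : 64 <= kc%:R :> R by rewrite ler_nat.
have n1 : 1 <= (npts I)%:R :> R by rewrite ler1n (npts_gt0 wf).
have N0 : 0 <= (nnz I)%:R :> R by [].
have e0 : 0 <= eps^-1 by rewrite invr_ge0 ltW.
have q0 : 0 <= p^-1 by rewrite invr_ge0 ltW.
have d0 : 0 <= kc%:R / gap_est I by rewrite divr_ge0 // ltW // gap_est_gt0.
have h1 : 64 * (npts I)%:R <= (npts I)%:R * kc%:R :> R by rewrite [X in _ <= X]mulrC ler_wpM2r.
have h2 : 64 * (nnz I)%:R <= (nnz I)%:R * kc%:R :> R by rewrite [X in _ <= X]mulrC ler_wpM2r.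
have h3 : 64 * eps^-1 <= eps^-1 * kc%:R :> R by rewrite [X in _ <= X]mulrC ler_wpM2r.
have h4 : 64 * p^-1 <= p^-1 * kc%:R :> R by rewrite [X in _ <= X]mulrC ler_wpM2r.
have h5 : 64 / gap I <= kc%:R / gap_est I.
  rewrite ler_pdivrMr ?(gap_gt0 wf) // mulrAC ler_pdivlMr ?gap_est_gt0 //.
  apply: le_trans (ler_wpM2l _ gap_est_le) _ => //.
  by rewrite mulrA ler_wpM2r // ltW ?(gap_gt0 wf).
split; [lra|lra|lra|exact: h5|split; lra].
Qed.

Lemma in_val_le1 e : (e < nnz I)%N -> `|in_val I e| <= 1.
Proof.
move=> eN; have [_ _ -> _] := in_nthE wf eN.
by apply: le_trans (norm2_coord _ _) (pts_le1 wf _).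
Qed.

Definition prepared H (g : ids R) (s : state R) : Prop :=
  [/\ has_consts (cst H) s, has_ids g s,
     ids_ok (in_col I) (nnz I) (i_m g) (i_id g) (i_back g),
     forall j, (0 < j <= i_m g)%N -> i_pow g j = (k_B (cst H))^-1 ^+ j &
   [/\ forall k, rarr s x_gram k = gram_sum (cst H) g (nnz I) k,
      forall a, rarr s x_out a = 0, nvar s n_j = 1%N,
      goal <= 2 ^+ H & H = 0%N \/ 2 ^+ H < 2 * goal]].

(** Everything before the random draws is deterministic. *)
Lemma wp_prep : wp (prep_prog kc)
  (fun t s => exists H g, (t <= prep_time H (nnz I))%N /\ prepared H g s)
  (input I eps p).
Proof.
apply: wp_seq; apply: (wp_init (n := npts I) (nnz := nnz I) (eps := eps) (p := p)
  (gp := gap_est I)) => //.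
move=> t1 H s1 t1le hH hH2 hc1 hm1 hn1 hr1.
have {}hc1 : has_consts (cst H) s1 by exact: hc1.
have [Z64 nZ NZ _ [kdZ _ _]] := log_goal_bounds hH.
apply: wp_seq; apply: wp_ids hc1 _ _ _; first by rewrite hm1.
  by move=> x; rewrite hn1 /= nth_nil.
move=> t2 s2 t2le hc2 hids hpow hr2.
pose g := Ids (nvar s2 n_m) (narr s2 a_id) (narr s2 a_back) (rarr s2 x_pow).
apply: wp_seq; apply: (wp_rows (g := g)) hc2 _ _ _ _ => //.
- by move=> x; rewrite hr2 // hr1 /= nth_nil.
- move=> e eN; rewrite normrM ger0_norm ?exprn_ge0 //.
  apply: (@le_lt_trans _ _ (k_Z (cst H) ^+ 32 * 1)).
    by rewrite ler_wpM2l ?exprn_ge0 ?exprn_ge0 ?in_val_le1.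
  have z1 : 1 < k_Z (cst H) by rewrite /k_Z /=; move: Z64; lra.
  by rewrite mulr1 /k_B /k_HB exprM -/(k_Z (cst H)) ltr_eXn2l.
move=> t3 s3 t3le hc3 hg3 hx3 hrow3 hr3.
apply: wp_seq; apply: (wp_gram (g := g)) hc3 hg3 _ hx3 hrow3 _.
  by move=> x; rewrite hr3 // hr2 // hr1 /= nth_nil.
move=> t4 s4 t4le hc4 hg4 hgr4 hr4.
exec1; apply: wp_skip; exists H, g; split.
  move: t1le t2le t3le t4le; rewrite /prep_time /cst /k_HB /=.
  by move: (floor_time _) (nnz I) => f N; clear; lia.
split=> //; split=> //.
by move=> a; rewrite /= hr4 // hr3 // hr2 // hr1 /= nth_nil.
Qed.

Lemma runs_halts P (s s' : state R) t T E : runs P s t s' -> (t <= T)%N ->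
  halts_in T [:: P] s /\ prob_in T E [:: P] s = (E s')%:R.
Proof.
move=> h tT; rewrite -(subnKC tT); have [-> ->] := h [::] (T - t)%N.
by case: (T - t)%N.
Qed.

Lemma mean_ge (T : eqType) (l : seq T) (F : T -> R) (b : pred T) (p' : R) n :
  size l = n -> (0 < n)%N -> (forall w, w \in l -> ~~ b w -> 1 <= F w) ->
  (forall w, w \in l -> 0 <= F w) -> (count b l)%:R <= p' * n%:R ->
  1 - p' <= n%:R^-1 * \sum_(w <- l) F w.
Proof.
move=> sz n0 h1 h0 hc; have nR : 0 < n%:R :> R by rewrite ltr0n.
rewrite ler_pdivlMl // mulrBr mulr1 [n%:R * p']mulrC.
apply: (@le_trans _ _ (n%:R - (count b l)%:R)); first by rewrite lerB.
rewrite -sz lerBlDr -sum1_count natr_sum -sum1_size natr_sum.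
rewrite [\sum_(i <- l | b i) _]big_mkcond -big_split /=.
rewrite big_seq [leRHS]big_seq; apply: ler_sum => w wl.
by case: ifPn => [_|/(h1 _ wl)]; [rewrite lerDr h0|rewrite addr0].
Qed.

(** The search fails only for draws with [|<g, u>| < 1]. At most [4 m / (Z^2
    + 1)] of the draws are such, and this is at most [p] since [64 m <= Z]
    and [1 / p <= Z]. *)
Lemma algorithm_solves : exists H m t : nat,
  [/\ (m <= pdim I)%N, (0 < m <= nnz I)%N, goal <= 2 ^+ H, H = 0%N \/ 2 ^+ H < 2 * goal &
   [/\ exists g : ids R, i_m g = m /\
         (t <= prep_time H (nnz I) + 8 * m + 10 + search_time (cst H) g)%N,
      halts_in t [:: algorithm kc] (input I eps p) &
      1 - p <= prob_in t (good I eps) [:: algorithm kc] (input I eps p)]].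
Proof.
have [t1 [s1 [hrun [H [g [t1le [hc hg hids hpow [hgr hout hj hH hH2]]]]]]]] := wp_prep.
have [Z64 nZ NZ gapZ [kdZ epsZ pZ]] := log_goal_bounds hH.
pose c := cst H; pose m := i_m g.
have cE : [/\ k_n c = npts I, k_nnz c = nnz I, k_row c = in_row I,
   k_col c = in_col I & k_val c = in_val I] by [].
have m0 : (0 < m)%N := m_gt0 wf cE hids.
have [md mN] := size_active wf cE hids.
pose st := search_time c g.
have [hn [h1 [_ [hG _]]]] := hc.
have [hm _] := hg.
have hjm : (nvar s1 n_j + m = (nvar s1 n_m).+1)%N by rewrite hj hm add1n.
have key w : w \in draws (k_G c) m ->
    halts_in st [:: search_prog] (rand_final s1 w) /\
    (0 <= prob_in st (good I eps) [:: search_prog] (rand_final s1 w) /\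
     (~~ near0 (lincomb (lead_coefs I g) w + 0) ->
      1 <= prob_in st (good I eps) [:: search_prog] (rand_final s1 w))).
  move=> hw; have [szw /allP aw] := in_draws hw.
  pose sw := rand_final s1 w.
  have [hgd _] := rand_final_g w h1; rewrite hj in hgd.
  have gdG j : (0 < j <= i_m g)%N -> (narr sw a_g j <= k_G c)%N.
    case: j => [//|j] jm; rewrite -add1n hgd ?szw //.
    by apply: aw; rewrite mem_nth // szw.
  have hcw : has_consts c sw by apply: (rand_final_inv (P := has_consts c)).
  have hgw : has_ids g sw by apply: (rand_final_inv (P := has_ids g)).
  have raw : rarr sw = rarr s1 by apply: (rand_final_inv (P := fun s => rarr s = rarr s1)).
  have [||t [s' [hr [tle hgood]]]] := search_good (s := sw) (eps := eps) wf cE hids hpow eps0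
    Z64 nZ NZ gapZ kdZ epsZ gdG hcw hgw _ (erefl _) _.
  - by rewrite raw; exact: hgr.
  - by rewrite raw; exact: hout.
  have [-> ->] := runs_halts (good I eps) hr tle; split=> //; split=> //.
  rewrite addr0 /near0 -leNgt => hbig; rewrite hgood // /draw_dot.
  apply: le_trans hbig _; rewrite /lead_coefs -[X in iota 1 X]szw.
  by rewrite (@lincombE _ _ _ _ (narr sw a_g)) // szw add1n.
exists H, m, (t1 + (8 * m + 1 + st).+1).+1; split=> //; first by rewrite m0.
have hal : halts_in (t1 + (8 * m + 1 + st).+1).+1 [:: algorithm kc] (input I eps p) =
    halts_in (8 * m + 1 + st) [:: rand_loop; search_prog] s1.
  rewrite (@halts_step1 _ _ _ [::] [:: prep_prog kc; Seq rand_loop search_prog] _ (input I eps p)) //.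
  have [-> _] := hrun [:: Seq rand_loop search_prog] (8 * m + 1 + st).+1.
  by rewrite (@halts_step1 _ _ _ [::] [:: rand_loop; search_prog] _ s1).
have hpr : prob_in (t1 + (8 * m + 1 + st).+1).+1 (good I eps) [:: algorithm kc] (input I eps p) =
    prob_in (8 * m + 1 + st) (good I eps) [:: rand_loop; search_prog] s1.
  rewrite (@prob_step1 _ _ _ [::] [:: prep_prog kc; Seq rand_loop search_prog] _ (input I eps p)) //.
  have [_ ->] := hrun [:: Seq rand_loop search_prog] (8 * m + 1 + st).+1.
  by rewrite (@prob_step1 _ _ _ [::] [:: rand_loop; search_prog] _ s1).
split; rewrite ?hal ?hpr.
- by exists g; split=> //; rewrite -/c -/st; move: t1le; clear; lia.
- by apply: rand_halts => // w; rewrite hG => /key[].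
rewrite rand_prob // hG.
apply: (mean_ge (b := fun w => near0 (lincomb (lead_coefs I g) w + 0))).
- exact: size_draws.
- by rewrite expn_gt0.
- by move=> w /key[_ [_ h]].
- by move=> w /key[_ [h _]].
have szl : size (lead_coefs I g) = m by rewrite size_map size_iota.
have m2 : (0 < 2 * m)%N by rewrite muln_gt0.
have := @count_draws R (lead_coefs I g) 0 (k_G c) (2 * m) m2
  (lead_coef_large wf cE hids).
rewrite szl.
set cnt := count _ _ => hcnt.
have Gp : 0 < (k_G c).+1%:R :> R by rewrite ltr0n.
have {}hcnt : cnt%:R * (k_G c).+1%:R <= (4 * m)%:R * ((k_G c).+1 ^ m)%:R :> R.
  by rewrite -!natrM ler_nat (leq_trans hcnt) // mulnA.
rewrite -(ler_pM2r Gp); apply: le_trans hcnt _.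
rewrite mulrAC ler_wpM2r //.
have mZ : 64 * m%:R <= 2 ^+ H :> R.
  by apply: le_trans NZ; rewrite ler_wpM2l // ler_nat.
have GE : (2 ^+ H) ^+ 2 <= (k_G c).+1%:R :> R.
  by rewrite /k_G -!natrX ler_nat.
rewrite natrM -[leLHS]mul1r.
have p1 : 1 <= p * 2 ^+ H by rewrite -ler_pdivrMl // mulr1.
apply: (@le_trans _ _ (p * 2 ^+ H * 2 ^+ H)).
  by rewrite ler_pM //; have : 0 <= m%:R :> R by []; lra.
by rewrite -mulrA -expr2 ler_wpM2l // ltW.
Qed.

End Assembly.

(** * The running time *)

Section TimeBound.
Variable R : realType.
Variables (c1 c2 : R) (I : instance R) (eps p : R) (kc : nat).
Hypothesis wf : wf_instance c1 c2 I.
Hypothesis c10 : 0 < c1.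
Hypothesis eps0 : 0 < eps.
Hypothesis p0 : 0 < p.
Hypothesis gap_small : (nnz I)%:R * gap I ^+ 2 <= (pdim I)%:R.

Let W := 3 + (pdim I)%:R + eps^-1 + p^-1 + (gap I)^-1.

(** Here the smallness of the gap is used: it gives [N^(1/4) sqrt gap <=
    d^(1/4)]. *)
Lemma nnz_time_bound : (nnz I)%:R <= time_bound I.
Proof.
have g0 := gap_gt0 wf; rewrite /time_bound.
rewrite ler_pdivlMr ?sqrtr_gt0 //.
have N0 : 0 <= (nnz I)%:R :> R by [].
have {1}-> : (nnz I)%:R = (nnz I)%:R `^ (3 / 4) * (nnz I)%:R `^ (1 / 4) :> R.
  by rewrite -powRD; [rewrite -mulrDl [X in X / 4](_ : _ = 4) ?divff ?powRr1 //; lra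
                     |rewrite pnatr_eq0 -lt0n (nnz_gt0 wf) implybT].
rewrite -mulrA ler_wpM2l ?powR_ge0 //.
have -> : Num.sqrt (gap I) = (gap I ^+ 2) `^ (1 / 4).
  rewrite -powR12_sqrt ?ltW // -powR_mulrn ?ltW // -powRrM; congr (_ `^ _); lra.
rewrite -powRM ?exprn_ge0 ?(ltW g0) //.
by rewrite ge0_ler_powR // ?nnegrE ?mulr_ge0 ?exprn_ge0 // ?(ltW g0) //.
Qed.

Lemma active_time_bound (m : nat) : (m <= pdim I)%N -> (m <= nnz I)%N ->
  m%:R <= (nnz I)%:R `^ (3 / 4) * (pdim I)%:R `^ (1 / 4) :> R.
Proof.
move=> md mN; have [->|m0] := posnP m; first by rewrite mulr_ge0 ?powR_ge0.
have {1}-> : m%:R = m%:R `^ (3 / 4) * m%:R `^ (1 / 4) :> R.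
  by rewrite -powRD; [rewrite -mulrDl [X in X / 4](_ : _ = 4) ?divff ?powRr1 //; lra
                     |rewrite pnatr_eq0 -lt0n m0 implybT].
by rewrite ler_pM ?powR_ge0 // ge0_ler_powR ?nnegrE ?ler_nat //; lra.
Qed.

(** With [W] the argument of the logarithm, [N <= d / gap^2 <= W^3] and [n
    <= N / gap <= W^4]. *)
Lemma log_goal_le : log_goal kc (npts I) (nnz I) eps p (gap_est I) <=
  kc%:R * (4 + c1^-1) * W ^+ 4.
Proof.
have g0 := gap_gt0 wf.
have [d0 e0 q0 g1] : [/\ 0 <= (pdim I)%:R :> R, 0 <= eps^-1, 0 <= p^-1 & 0 <= (gap I)^-1].
  by split; rewrite // invr_ge0 ltW.
have W1 : 1 <= W by rewrite /W; lra.
have gW : (gap I)^-1 <= W by rewrite /W; lra.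
have W0 : 0 <= W by lra.
have NW : (nnz I)%:R <= W ^+ 3.
  apply: (@le_trans _ _ ((pdim I)%:R * (gap I)^-1 ^+ 2)).
    by rewrite exprVn ler_pdivlMr ?exprn_gt0.
  have pW : (pdim I)%:R <= W by rewrite /W; lra.
  by rewrite [W ^+ 3]exprS ler_pM ?exprn_ge0 // lerXn2r ?nnegrE.
have nW : (npts I)%:R <= W ^+ 4.
  apply: (@le_trans _ _ ((nnz I)%:R * (gap I)^-1)).
    by rewrite ler_pdivlMr // (npts_gap wf).
  by rewrite exprSr ler_pM.
have W3 : W ^+ 3 <= W ^+ 4 by rewrite ler_weXn2l.
have W4 : W <= W ^+ 4 by rewrite -[X in X <= _]expr1 ler_weXn2l.
have dW : (gap_est I)^-1 <= c1^-1 * W ^+ 4.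
  apply: (@le_trans _ _ (c1^-1 * (gap I)^-1)).
    rewrite -invfM lef_pV2 ?posrE ?mulr_gt0 // ?(gap_est_ge wf) //.
    by apply: gap_est_gt0 wf c10.
  by rewrite ler_wpM2l ?invr_ge0 ?(le_trans gW) // ltW.
have hs : (npts I)%:R + (nnz I)%:R + eps^-1 + p^-1 <= 4 * W ^+ 4.
  have : eps^-1 <= W by rewrite /W; lra.
  have : p^-1 <= W by rewrite /W; lra.
  lra.
rewrite /log_goal [_ * kc%:R]mulrC -mulrDr -mulrA ler_wpM2l // mulrDl.
by rewrite lerD.
Qed.

Lemma log_le (H : nat) (z : R) : (64 <= kc)%N ->
  2 ^+ H <= 2 * log_goal kc (npts I) (nnz I) eps p (gap_est I) ->
  H%:R <= (ln (2 * kc%:R * (4 + c1^-1)) / ln 3 + 4) / ln 2 * logfactor I eps p.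
Proof.
move=> kc64 hH; set A := 2 * _ * _.
have k64 : 64 <= kc%:R :> R by rewrite ler_nat.
have c0 : 0 < c1^-1 by rewrite invr_gt0.
have A1 : 1 <= A.
  rewrite -[1]mulr1 ler_pM //; lra.
have W3 : 3 <= W.
  have : 0 <= (pdim I)%:R :> R by [].
  have : 0 <= eps^-1 by rewrite invr_ge0 ltW.
  have : 0 <= p^-1 by rewrite invr_ge0 ltW.
  have : 0 <= (gap I)^-1 by rewrite invr_ge0 ltW ?(gap_gt0 wf).
  rewrite /W; lra.
have ln2 : 0 < ln 2 :> R by rewrite ln_gt0 //; lra.
have ln3 : 0 < ln 3 :> R by rewrite ln_gt0 //; lra.
have lW : ln 3 <= ln W by rewrite ler_ln ?posrE //; lra.
rewrite mulrAC ler_pdivlMr // mulrDl.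
have -> : logfactor I eps p = ln W by [].
have h1 : ln (2 ^+ H) <= ln (A * W ^+ 4).
  rewrite ler_ln ?posrE ?mulr_gt0 ?exprn_gt0 //; try lra.
  apply: le_trans hH _; rewrite /A -!mulrA ler_pM2l // mulrA; exact: log_goal_le.
move: h1; rewrite lnM ?posrE ?exprn_gt0 //; try lra.
rewrite !lnXn; try lra.
rewrite -[ln 2 *+ H]mulr_natl -[ln W *+ 4]mulr_natl => h1; apply: le_trans h1 _.
rewrite lerD2r mulrAC ler_pdivlMr // ler_wpM2l // ln_ge0 //.
Qed.

End TimeBound.

Definition run_time (H N m s : nat) : nat :=
  (prep_time H N + 8 * m + 10 +
   (H * (s * ((2 * floor_time (H * 128) + 100) * m + 100).+1 + 20 * m + 100 + 20) + 20))%N.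

(** Only the order of growth matters, so every term is charged to one of the
    two products. *)
Lemma run_time_le : exists k : nat, forall H N m s : nat,
  (0 < H)%N -> (0 < N)%N -> (0 < m <= N)%N -> (0 < s)%N ->
  (run_time H N m s <= k * (H * N + s * (H ^ 2 * m)))%N.
Proof.
exists 3200%N; rewrite /run_time /prep_time /floor_time.
case=> // H [//|N] [//|m] [//|s] _ _ /= mN _.
nia.
Qed.

Lemma solves_time (R : realType) (c1 c2 : R) (kc : nat) :
  0 < c1 -> (64 <= kc)%N -> 64 * c2 <= kc%:R ->
  exists C : R, forall (I : instance R) (eps p : R), wf_instance c1 c2 I ->
  0 < eps -> 0 < p -> (nnz I)%:R * gap I ^+ 2 <= (pdim I)%:R ->
  solves_in_time (algorithm kc) I eps p (C * logfactor I eps p ^+ 3 * time_bound I).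
Proof.
move=> c10 kc64 kc2; have [k hk] := run_time_le.
pose a := (ln (2 * kc%:R * (4 + c1^-1)) / ln 3 + 4) / ln 2.
pose S := Num.sqrt (kc%:R / c1); have S0 : 0 <= S := sqrtr_ge0 _.
exists (k%:R * (1 + 64 * S) * a ^+ 3) => I eps p wf eps0 p0 gs.
have [H [m [t [md /andP[m0 mN] hH hH2 [[g [gm tle]] hh hp]]]]] :=
  algorithm_solves wf c10 eps0 p0 kc64 kc2.
exists t; split=> //.
have [Z64 _ _ gapZ _] := log_goal_bounds wf c10 eps0 p0 kc64 kc2 hH.
have H0 : (0 < H)%N by case: (H) Z64 => //; rewrite expr0; lra.
have {}hH2 : 2 ^+ H <= 2 * log_goal kc (npts I) (nnz I) eps p (gap_est I).
  by case: hH2 => [h|/ltW//]; rewrite h in H0.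
have aL : H%:R <= a * logfactor I eps p by exact: (log_le wf).
have N0 := nnz_gt0 wf.
set c := Consts _ _ _ _ _ _ _ in tle.
have kdE : k_kd c = kc%:R / gap_est I by [].
have g0 := gap_gt0 wf.
have ge0 : 0 < gap_est I by apply: gap_est_gt0 wf c10.
have kd1 : 1 <= k_kd c.
  apply: le_trans gapZ; rewrite ler_pdivlMr // mul1r.
  by have := eig0_le1 wf; have := eig1_ge0 wf; rewrite /gap; lra.
have r1 : 1 <= Num.sqrt (k_kd c) by rewrite -[X in X <= _]sqrtr1 ler_wsqrtr.
have H1 : 1 <= H%:R :> R by rewrite ler1n.
have KE : k_K c = 32 * H%:R * Num.sqrt (k_kd c) by [].
have K1 : 1 <= k_K c.
  by rewrite KE -[X in X <= _]mulr1 ler_pM //; lra.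
have sK : (steps c)%:R <= 2 * k_K c.
  rewrite /steps -natr1; have /andP[] := truncn_itv (le_trans ler01 K1 : 0 <= k_K c).
  by move: K1; lra.
have {}tle : (t <= k * (H * nnz I + steps c * (H ^ 2 * m)))%N.
  apply: leq_trans tle (leq_trans _ (hk _ _ _ _ H0 N0 _ _)) => //; last by rewrite m0.
  by rewrite /run_time /search_time /round_time /cheb_time gm.
have rT : m%:R * Num.sqrt (k_kd c) <= S * time_bound I.
  rewrite [X in _ <= X](_ : _ = (nnz I)%:R `^ (3 / 4) * (pdim I)%:R `^ (1 / 4) *
     (S / Num.sqrt (gap I))); last by rewrite /time_bound; ring.
  rewrite ler_pM ?sqrtr_ge0 ?active_time_bound //.
  rewrite -sqrtrV ?(ltW g0) // -sqrtrM ?divr_ge0 ?(ltW c10) // ler_wsqrtr // kdE.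
  by rewrite -mulrA ler_wpM2l // -invfM lef_pV2 ?posrE ?mulr_gt0 // (gap_est_ge wf).
have NT := nnz_time_bound wf gs.
have T0 : 0 <= time_bound I by apply: le_trans NT.
apply: (@le_trans _ _ ((k * (H * nnz I + steps c * (H ^ 2 * m)))%N%:R)).
  by rewrite ler_nat.
rewrite !natrM natrD !natrM -expr2.
have K0 : 0 <= k%:R * (1 + 64 * S) by rewrite mulr_ge0 // addr_ge0 // mulr_ge0.
apply: (@le_trans _ _ (k%:R * (1 + 64 * S) * H%:R ^+ 3 * time_bound I)); last first.
  rewrite (ler_wpM2r T0) // -[X in _ <= X]mulrA (ler_wpM2l K0) //.
  by rewrite -exprMn lerXn2r ?nnegrE // (le_trans _ aL).
have h1 : H%:R * (nnz I)%:R <= H%:R ^+ 3 * time_bound I :> R.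
  by rewrite ler_pM // -[X in X <= _]expr1 ler_weXn2l.
have h2 : (steps c)%:R * (H%:R ^+ 2 * m%:R) <=
    64 * H%:R ^+ 3 * (S * time_bound I).
  apply: (@le_trans _ _ (2 * k_K c * (H%:R ^+ 2 * m%:R))).
    by rewrite ler_wpM2r // mulr_ge0 ?exprn_ge0.
  rewrite KE [X in X <= _](_ : _ = 64 * H%:R ^+ 3 * (m%:R * Num.sqrt (k_kd c))); last by ring.
  by rewrite ler_wpM2l // mulr_ge0 ?exprn_ge0.
have -> : k%:R * (1 + 64 * S) * H%:R ^+ 3 * time_bound I = k%:R *
    (H%:R ^+ 3 * time_bound I + 64 * H%:R ^+ 3 * (S * time_bound I)) by ring.
by rewrite ler_wpM2l // lerD.
Qed.

Local Open Scope classical_set_scope.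
Local Open Scope ring_scope.

Theorem theorem1p2 (R : realType) (c1 c2 : R) (hc1 : 0 < c1) (hc2 : c1 < c2) :
  exists (P : prog) (C : R) (q : nat),
    forall I : nat -> instance R,
      (forall k, wf_instance c1 c2 (I k)) ->
      (fun k => gap (I k) : R^o) =o_\oo
        (fun k => Num.sqrt ((pdim (I k))%:R / (nnz (I k))%:R) : R^o) ->
      \forall k \near \oo, forall eps p : R, 0 < eps -> 0 < p ->
        solves_in_time P (I k) eps p
          (C * logfactor (I k) eps p ^+ q * time_bound (I k)).
Proof.
have c20 : 0 < c2 by apply: lt_trans hc2.
(* With [kc >= 64 c2] the ratio [kc / gap_est] is at least [64 / gap]. *)
pose kc := (64 + 64 * (Num.truncn c2).+1)%N.
have kc2 : 64 * c2 <= kc%:R.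
  have := truncnS_gt c2.
  rewrite /kc natrD natrM; lra.
have kc64 : (64 <= kc)%N by rewrite /kc leq_addr.
have [C hC] := solves_time hc1 kc64 kc2.
exists (algorithm kc), C, 3%N => I wfI small.
have /eqoP/(_ _ ltr01) := small.
apply: filterS => k hk eps p eps0 p0; apply: hC (wfI k) eps0 p0 _.
have N0 := nnz_gt0 (wfI k); have g0 := gap_gt0 (wfI k).
rewrite mulrC -ler_pdivlMr ?ltr0n //.
rewrite -[X in _ <= X]sqr_sqrtr ?divr_ge0 // lerXn2r ?nnegrE ?sqrtr_ge0 ?(ltW g0) //.
by move: hk; rewrite /= mul1r (ger0_norm (ltW g0)) (ger0_norm (sqrtr_ge0 _)).
Qed.
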